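(* Let $W^0\in H^1(\mathbb{R}^n,K)$, $\epsilon>0$, and let $W_\epsilon\in H^1(]0,T[\times\mathbb{R}^n,\mathbb{R}^m)$ be the unique solution of $$\partial_t W_{\epsilon} + \sum_{j=1}^n B_j \partial_j W_{\epsilon} = \frac{P_K(W_{\epsilon})-W_{\epsilon}}{\epsilon}\ \text{ on } ]0,T]\times \mathbb{R}^n,\qquad W_{\epsilon}(0,\cdot)=W^0 .$$ Then for all $\kappa\in K$ and all $\phi\in W^{1,\infty}((-\infty,T)\times\mathbb{R}^n,\mathbb{R}^+)$ with compact support in $]-\infty,T[\times\mathbb{R}^n$, one has $$\int_0^T\int_{\mathbb{R}^n}\Big(|W_\epsilon-\kappa|^2\partial_t\phi+\sum_{j=1}^n\langle W_\epsilon-\kappa;B_j(W_\epsilon-\kappa)\rangle\partial_j\phi\Big)\,dt\,dx+\int_{\mathbb{R}^n}|W^0(x)-\kappa|^2\phi(0,x)\,dx\ge 0 .$$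
   Context: Setting: $n,m\ge 1$ are integers, $T>0$; $K\subset\mathbb{R}^m$ is a fixed non-empty closed convex set containing $0$ in its interior; $B_1,\dots,B_n$ are real symmetric $m\times m$ matrices independent of time and space; $P_K:\mathbb{R}^m\to K$ is the orthogonal projection onto $K$; $\langle\cdot;\cdot\rangle$ and $|\cdot|$ are the canonical scalar product and norm of $\mathbb{R}^m$; $\partial_j=\partial_{x_j}$; $\mathbb{R}^+=[0,\infty)$. $H^1(\mathbb{R}^n,K)$ denotes the set of functions in $H^1(\mathbb{R}^n,\mathbb{R}^m)$ with values in $K$ almost everywhere. Solution of the relaxation problem: $W_\epsilon\in H^1(]0,T[\times\mathbb{R}^n,\mathbb{R}^m)$ such that for all $\phi\in\mathcal{C}^\infty_c(\mathbb{R}\times\mathbb{R}^n,\mathbb{R}^m)$ $$\int_0^T\int_{\mathbb{R}^n}\Big\langle \partial_t W_\epsilon+\sum_{j=1}^n B_j\partial_j W_\epsilon;\phi\Big\rangle\,dx\,dt=\int_0^T\int_{\mathbb{R}^n}\Big\langle\frac{P_K(W_\epsilon)-W_\epsilon}{\epsilon};\phi\Big\rangle\,dx\,dt,$$ and $W_\epsilon(0,\cdot)=W^0$ in $L^2(\mathbb{R}^n,\mathbb{R}^m)$; for $W^0\in H^1(\mathbb{R}^n,K)$ such a solution exists and is unique. *)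

(* Defs.v *)
From HB Require Import structures.
From mathcomp Require Import all_boot all_order all_algebra.
From mathcomp Require Import all_classical all_reals all_analysis.

Set Implicit Arguments.
Unset Strict Implicit.
Unset Printing Implicit Defensive.

Import Order.TTheory GRing.Theory Num.Theory.
Import numFieldNormedType.Exports.

Local Open Scope classical_set_scope.
Local Open Scope ring_scope.

(* Matrices carry the sigma-algebra generated by their entries; over the
   reals this is the Borel sigma-algebra. *)
Definition mx_coord_sets d (T : measurableType d) (m n : nat) :
    set (set 'M[T]_(m, n)) :=
  [set A | exists i j B, measurable B /\ A = [set M : 'M[T]_(m, n) | B (M i j)]].

Definition measure_mx_display : measure_display -> measure_display.
Proof. exact. Qed.

Section measurable_matrix.
Context d (T : measurableType d) (m n : nat).

Let mx_set0 : <<s @mx_coord_sets d T m n >> set0.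
Proof. exact: sigma_algebra0. Qed.

Let mx_setC A :
  <<s @mx_coord_sets d T m n >> A -> <<s @mx_coord_sets d T m n >> (~` A).
Proof. exact: sigma_algebraC. Qed.

Let mx_bigcup (F : (set 'M[T]_(m, n))^nat) :
  (forall i, <<s @mx_coord_sets d T m n >> (F i)) ->
  <<s @mx_coord_sets d T m n >> (\bigcup_i (F i)).
Proof. exact: sigma_algebra_bigcup. Qed.

HB.instance Definition _ := @isMeasurable.Build (measure_mx_display d)
  'M[T]_(m, n) <<s @mx_coord_sets d T m n >> mx_set0 mx_setC mx_bigcup.

End measurable_matrix.

Lemma measurable_mx_coord d (T : measurableType d) m n i j :
  measurable_fun [set: 'M[T]_(m, n)] (fun M : 'M[T]_(m, n) => M i j).
Proof.
move=> _ B mB; rewrite setTI; apply: sub_sigma_algebra.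
by exists i, j, B.
Qed.

Lemma measurable_mxP d1 d2 (S : measurableType d1) (T : measurableType d2) m n
    (f : S -> 'M[T]_(m, n)) :
  (forall i j, measurable_fun setT (fun x => f x i j)) ->
  measurable_fun setT f.
Proof.
move=> mf; apply: (@measurability _ _ _ _ _ _ (@mx_coord_sets d2 T m n)) => //.
move=> _ [_ [i [j [B [mB ->]]]] <-].
exact: mf.
Qed.

Section cons_rV.
Context (R : realType) (n : nat).

(* The point (t, x) of R x R^n = R^(1+n): coordinate 0 is t. *)
Definition cons_rV (t : R) (x : 'rV[R]_n) : 'rV[R]_n.+1 :=
  \row_i oapp (x ord0) t (unlift ord0 i).

Definition behead_rV (z : 'rV[R]_n.+1) : 'rV[R]_n :=
  \row_i z ord0 (lift ord0 i).

Lemma cons_rV0 t (x : 'rV[R]_n) : cons_rV t x ord0 ord0 = t.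
Proof. by rewrite mxE unlift_none. Qed.

Lemma cons_rVS t (x : 'rV[R]_n) i : cons_rV t x ord0 (lift ord0 i) = x ord0 i.
Proof. by rewrite mxE liftK. Qed.

Lemma behead_rVK (z : 'rV[R]_n.+1) : cons_rV (z ord0 ord0) (behead_rV z) = z.
Proof.
apply/rowP => i; case: (unliftP ord0 i) => [j|] ->.
  by rewrite cons_rVS mxE.
by rewrite cons_rV0.
Qed.

Lemma cons_rVK t (x : 'rV[R]_n) : behead_rV (cons_rV t x) = x.
Proof. by apply/rowP => i; rewrite mxE cons_rVS. Qed.

Lemma measurable_cons_rV :
  measurable_fun setT
    (fun p : measurableTypeR R * 'rV[R]_n => cons_rV p.1 p.2).
Proof.
apply: measurable_mxP => i j; rewrite ord1.
case: (unliftP ord0 j) => [k|] ->.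
- under eq_fun do rewrite cons_rVS.
  exact: (measurableT_comp (measurable_mx_coord _ k) measurable_snd).
- by under eq_fun do rewrite cons_rV0; exact: measurable_fst.
Qed.

Lemma measurable_uncons_rV :
  measurable_fun setT
    (fun z : 'rV[R]_n.+1 => (z ord0 ord0, behead_rV z) : measurableTypeR R * 'rV[R]_n).
Proof.
apply/measurable_fun_pair => /=; first exact: measurable_mx_coord.
apply: measurable_mxP => i j.
under eq_fun do rewrite mxE.
exact: measurable_mx_coord.
Qed.

End cons_rV.

Section leb_step.
Context (R : realType) (n : nat).
Variable mu : {sigma_finite_measure set 'rV[R]_n -> \bar R}.

Definition leb_step : set 'rV[R]_n.+1 -> \bar R :=
  pushforward (@lebesgue_measure R \x mu)%E 
    (fun p : measurableTypeR R * 'rV[R]_n => cons_rV p.1 p.2).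

Let mcons := @measurable_cons_rV R n.

Let leb_step0 : leb_step set0 = 0%E.
Proof. by rewrite /leb_step /pushforward preimage_set0 measure0. Qed.

Let leb_step_ge0 A : (0 <= leb_step A)%E.
Proof. exact: measure_ge0. Qed.

Let leb_step_sigma_additive : semi_sigma_additive leb_step.
Proof.
move=> F mF tF mUF; rewrite /leb_step /pushforward preimage_bigcup.
apply: (@measure_semi_sigma_additive _ _ _ (@lebesgue_measure R \x mu)%E).
- by move=> k; rewrite -[X in measurable X]setTI; exact: mcons.
- apply/trivIsetP => /= i j _ _ ij; rewrite -preimage_setI.
  by move/trivIsetP : tF => /(_ _ _ _ _ ij) ->//; rewrite preimage_set0.
- by rewrite -preimage_bigcup -[X in measurable X]setTI; exact: mcons.
Qed.

HB.instance Definition _ := isMeasure.Build _ _ _ leb_step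
  leb_step0 leb_step_ge0 leb_step_sigma_additive.

Let leb_step_sigma_finite : sigma_finite setT leb_step.
Proof.
have /sigma_finiteP[F [TF ndF Foo]] := sigma_finiteT (@lebesgue_measure R).
have /sigma_finiteP[G [TG ndG Goo]] := sigma_finiteT mu.
pose u (z : 'rV[R]_n.+1) : measurableTypeR R * 'rV[R]_n :=
  (z ord0 ord0, behead_rV z).
exists (fun k => u @^-1` (F k `*` G k)).
  apply/seteqP; split => // z _.
  have [k _ Fk] : (\bigcup_k F k) (z ord0 ord0) by rewrite -TF.
  have [l _ Gl] : (\bigcup_l G l) (behead_rV z) by rewrite -TG.
  exists (maxn k l) => //; split => /=.
    by move: Fk; exact/subsetPset/ndF/leq_maxl.
  by move: Gl; exact/subsetPset/ndG/leq_maxr.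
move=> k; have [mF Fkoo] := Foo k; have [mG Gkoo] := Goo k; split.
  rewrite -[X in measurable X]setTI; apply: measurable_uncons_rV => //.
  exact: measurableX.
rewrite /leb_step /pushforward.
rewrite (_ : _ @^-1` _ = F k `*` G k).
  by rewrite product_measure1E// lte_mul_pinfty// ge0_fin_numE.
by apply/seteqP; split => -[t x] /=; rewrite cons_rV0 cons_rVK.
Qed.

HB.instance Definition _ := Measure_isSigmaFinite.Build _ _ _ leb_step
  leb_step_sigma_finite.

End leb_step.

(* Lebesgue measure on R^n, as the n-fold product of the one on R. *)
Fixpoint leb (R : realType) (n : nat) :
    {sigma_finite_measure set 'rV[R]_n -> \bar R} :=
  match n with
  | 0 => \d_(0 : 'rV[R]_0)
  | n'.+1 => leb_step (leb R n')
  end.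

Lemma leb_box (R : realType) (n : nat) (A : 'I_n -> set R) :
  (forall i, measurable (A i)) ->
  leb R n [set x | forall i, A i (x ord0 i)] =
  (\prod_(i < n) lebesgue_measure (A i))%E.
Proof.
elim: n A => [|n IH] A mA.
  rewrite big_ord0 /= diracE; case: (boolP (_ \in _)) => //.
  by rewrite notin_setE => h; exfalso; apply: h; case.
rewrite big_ord_recl -IH => [|i]; last exact: mA.
rewrite -product_measure1E //; last first.
  rewrite (_ : mkset _ =
      \bigcap_(i in [set: 'I_n]) [set x | A (lift ord0 i) (x ord0 i)]).
    apply: fin_bigcap_measurable => // i _.
    rewrite -[X in measurable X]setTI.
    exact: (@measurable_mx_coord _ _ 1 n ord0 i).
  apply/seteqP; split => x /=; first by move=> Ax i _; exact: Ax.
  by move=> Ax i; exact: (Ax i).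
  exact: mA.
rewrite -[LHS]/((@lebesgue_measure R \x leb R n)%E
  ((fun p : measurableTypeR R * 'rV[R]_n => cons_rV p.1 p.2) @^-1` _)).
congr (_ _).
apply/seteqP; split => -[t x] /=.
  move=> Atx; split=> [|i]; first by have := Atx ord0; rewrite cons_rV0.
  by have := Atx (lift ord0 i); rewrite cons_rVS.
move=> [At Ax] i; case: (unliftP ord0 i) => [j|] ->; last by rewrite cons_rV0.
by rewrite cons_rVS.
Qed.

(* Smoothness: every iterated directional derivative exists and is
   differentiable.  In finite dimension this is C^oo. *)
Definition smooth (R : realType) (V W : normedModType R) (f : V -> W) : Prop :=
  forall (s : seq V) (x : V), differentiable (foldr (fun v g => 'D_v g) f s) x.

Definition test_function (R : realType) (V W : normedModType R) (O : set V)
    (f : V -> W) : Prop :=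
  [/\ smooth f, compact (closure [set x | f x != 0]) &
      closure [set x | f x != 0] `<=` O].

Section sobolev.
Context (R : realType) (d : nat).
Local Notation E := 'rV[R]_d.

Definition L2 (O : set E) (f : E -> R) : Prop :=
  measurable_fun O f /\ (leb R d).-integrable O (fun x => (f x ^+ 2)%:E).

Definition Loo (O : set E) (f : E -> R) : Prop :=
  measurable_fun O f /\
  exists M : R, {ae leb R d, forall x, O x -> `|f x| <= M}.

(* g is the i-th weak partial derivative of f on the open set O. *)
Definition weak_partial (O : set E) (i : 'I_d) (f g : E -> R) : Prop :=
  forall psi : E -> R, test_function O psi ->
    \int[leb R d]_(x in O) (f x * 'D_(delta_mx 0 i) psi x) =
    - \int[leb R d]_(x in O) (g x * psi x).

(* f belongs to H^1(O), resp. W^{1,oo}(O), and has weak gradient Df. *)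
Definition H1 (O : set E) (f : E -> R) (Df : 'I_d -> E -> R) : Prop :=
  L2 O f /\ forall i, L2 O (Df i) /\ weak_partial O i f (Df i).

Definition W1oo (O : set E) (f : E -> R) (Df : 'I_d -> E -> R) : Prop :=
  Loo O f /\ forall i, Loo O (Df i) /\ weak_partial O i f (Df i).

Definition L2v (m : nat) (O : set E) (f : E -> 'cV[R]_m) : Prop :=
  forall k, L2 O (fun x => f x k ord0).

Definition H1v (m : nat) (O : set E) (f : E -> 'cV[R]_m)
    (Df : 'I_d -> E -> 'cV[R]_m) : Prop :=
  forall k, H1 O (fun x => f x k ord0) (fun i x => Df i x k ord0).

End sobolev.

Section euclidean.
Context (R : realType) (m : nat).
Implicit Types (u v : 'cV[R]_m) (K : set 'cV[R]_m).

Definition dot u v : R := \sum_(k < m) u k ord0 * v k ord0.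

(* The canonical norm of R^m; the norm `|u| of the library on matrices is the
   maximum norm. *)
Definition enorm u : R := Num.sqrt (dot u u).

Definition euclid_proj K u : 'cV[R]_m :=
  xget 0 [set p | K p /\ forall q, K q -> enorm (u - p) <= enorm (u - q)].

End euclidean.

Section relaxation.
Context (R : realType) (n m : nat).

(* ]0,T[ x R^n and ]-oo,T[ x R^n as subsets of R^(1+n). *)
Definition slab (T : R) : set 'rV[R]_n.+1 :=
  [set z | 0 < z ord0 ord0 < T].

Definition below (T : R) : set 'rV[R]_n.+1 :=
  [set z | z ord0 ord0 < T].

(* W(0,.) = W0 in L^2, for W in H^1(]0,T[ x R^n): the element w of
   C([0,T], L^2(R^n)) that represents W takes the value W0 at time 0. *)
Definition initial_value (T : R) (W : 'rV[R]_n.+1 -> 'cV[R]_m)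
    (W0 : 'rV[R]_n -> 'cV[R]_m) : Prop :=
  exists w : R -> 'rV[R]_n -> 'cV[R]_m,
  [/\ forall t : R, 0 <= t <= T -> L2v setT (w t),
      forall s : R, 0 <= s <= T ->
        \int[leb R n]_x (enorm (w t x - w s x) ^+ 2)
          @[t --> within `[0, T] (nbhs s)] --> (0 : R),
      {ae lebesgue_measure, forall t : R, 0 < t < T ->
        {ae leb R n, forall x, W (cons_rV t x) = w t x}} &
      {ae leb R n, forall x, w 0 x = W0 x}].

Definition relaxation_solution (T eps : R) (K : set 'cV[R]_m)
    (B : 'I_n -> 'M[R]_m) (W0 : 'rV[R]_n -> 'cV[R]_m)
    (W : 'rV[R]_n.+1 -> 'cV[R]_m) : Prop :=
  exists DW : 'I_n.+1 -> 'rV[R]_n.+1 -> 'cV[R]_m,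
  [/\ H1v (slab T) W DW,
      forall phi : 'rV[R]_n.+1 -> 'cV[R]_m, test_function setT phi ->
        \int[leb R n.+1]_(z in slab T)
          dot (DW ord0 z + \sum_(j < n) B j *m DW (lift ord0 j) z) (phi z) =
        \int[leb R n.+1]_(z in slab T)
          dot (eps^-1 *: (euclid_proj K (W z) - W z)) (phi z) &
      initial_value T W W0].

(* phi in W^{1,oo}(]-oo,T[ x R^n, R^+), with weak gradient Dphi and with
   compact support in ]-oo,T[ x R^n.  phi is the continuous representative of
   its class, which gives phi(0,.) a meaning. *)
Definition entropy_test (T : R) (phi : 'rV[R]_n.+1 -> R)
    (Dphi : 'I_n.+1 -> 'rV[R]_n.+1 -> R) : Prop :=
  [/\ W1oo (below T) phi Dphi,
      {within below T, continuous phi},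
      forall z, below T z -> 0 <= phi z &
      exists C, [/\ compact C, C `<=` below T &
        forall z, below T z -> ~ C z -> phi z = 0]].

End relaxation.

(* Main.v *)
(* Weak partial derivatives are handled by absolute continuity on lines: on
   almost every line parallel to an axis, a function with an integrable weak
   partial derivative coincides almost everywhere with a primitive of it (du
   Bois-Reymond on the line, with bump functions in the other variables).  The
   product rule on lines and Fubini then give, for every entry of
   (W - kappa)(W - kappa)^T phi, the divergence formula on a box containing the
   support of phi; the only boundary term is the one at time 0, identified by
   the initial value.  Contracting with the identity for the time derivative and
   with the symmetric B_j for the space derivatives, and using the equation,
   which holds almost everywhere, the left-hand side of the entropy inequality
   equals minus the integral of 2 phi <W - kappa, P_K(W) - W> / eps.  The latter
   scalar product is at most -|W - P_K(W)|^2, by the variational inequality of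
   the projection. *)

Require Import Defs.
From mathcomp Require Import all_boot all_order all_algebra.
From mathcomp Require Import all_classical all_reals all_analysis.
From mathcomp Require Import measurable_realfun ring lra.

Set Implicit Arguments.
Unset Strict Implicit.
Unset Printing Implicit Defensive.

Import Order.TTheory GRing.Theory Num.Theory.
Import numFieldNormedType.Exports.

Local Open Scope classical_set_scope.
Local Open Scope ring_scope.

(** * Test functions *)

(** The entropy is quadratic in [W]: a product of two H^1 entries with [phi] has merely integrable
    derivatives. On a line such a product is absolutely continuous with the derivative given by
    Leibniz' rule, which replaces any approximation of [W] by smooth functions. The obstacle is an
    order of quantifiers. The weak derivative gives, for each test function, an identity on almost
    every line, and the null set depends on the test function; du Bois-Reymond on one line needs all
    its test functions at once. They are therefore cut down to a countable family, with rational
    endpoints. A second mismatch occurs at time 0. The initial value is prescribed through L^2 norms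
    on time slices, while the boundary term appears line by line, as the end value of an absolutely
    continuous representative. Averages over short time intervals connect the two, by Tonelli and
    Fatou. Time 0 is also a null set for the class of [phi]: the continuity of [phi] is what fixes
    its boundary values there. *)

Section smooth_line.
Context (R : realType).

(* C^oo, witnessed by a class of functions stable under derivation. *)
Definition smooth1 (f : R -> R) : Prop :=
  exists2 P : set (R -> R), P f &
    forall g, P g -> exists2 g', P g' & forall x : R, is_derive x 1 g (g' x).

Lemma smooth1_derive f : smooth1 f ->
  exists2 f', smooth1 f' & forall x : R, is_derive x 1 f (f' x).
Proof.
move=> [P Pf PP]; have [f' Pf' ff'] := PP _ Pf.
by exists f' => //; exists P.
Qed.

Lemma smooth1_cst c : smooth1 (cst c).
Proof.
exists (range (fun a : R => cst a : R -> R)); first by exists c.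
move=> _ [a _ <-]; exists (cst 0); first by exists 0.
by move=> x; exact: is_derive_cst.
Qed.

(** The product rule creates sums of products, so both operations are needed for a closure stable
    under derivation. [V] is arbitrary because the closure serves on the line and on normed
    spaces. *)
Inductive ring_span (V : Type) (P : set (V -> R)) : set (V -> R) :=
| ring_span_in g of P g : ring_span P g
| ring_span_add g h of ring_span P g & ring_span P h : ring_span P (g + h)
| ring_span_mul g h of ring_span P g & ring_span P h : ring_span P (g * h).

Lemma ring_span_derive (P : set (R -> R)) :
  (forall g, P g -> exists2 g', P g' & forall x : R, is_derive x 1 g (g' x)) ->
  forall g, ring_span P g ->
    exists2 g', ring_span P g' & forall x : R, is_derive x 1 g (g' x).
Proof.
move=> PP g; elim=> {g} [g Pg|g h sg [g' sg' gg'] sh [h' sh' hh']|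
    g h sg [g' sg' gg'] sh [h' sh' hh']].
- have [g' Pg' gg'] := PP _ Pg; exists g' => //; exact: ring_span_in.
- exists (g' + h'); first exact: ring_span_add.
  by move=> x; apply: is_deriveD.
- exists (g * h' + h * g').
    by apply: ring_span_add; exact: ring_span_mul.
  by move=> x; apply: is_deriveM.
Qed.

(** Two smooth functions come with unrelated witnessing classes; the span of the union is a common
    one. *)
Lemma smooth1_span2 f g : smooth1 f -> smooth1 g ->
  exists2 P : set (R -> R),
    [/\ P f, P g & forall u v, P u -> P v -> P (u + v) /\ P (u * v)] &
    forall g, P g -> exists2 g', P g' & forall x : R, is_derive x 1 g (g' x).
Proof.
move=> [P Pf PP] [Q Qg QQ]; exists (ring_span (P `|` Q)).
  split; [by apply: ring_span_in; left|by apply: ring_span_in; right|].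
  by move=> u v Pu Pv; split; [exact: ring_span_add|exact: ring_span_mul].
apply: ring_span_derive => h [Ph|Qh].
- by have [h' Ph' ?] := PP _ Ph; exists h' => //; left.
- by have [h' Qh' ?] := QQ _ Qh; exists h' => //; right.
Qed.

Lemma smooth1D f g : smooth1 f -> smooth1 g -> smooth1 (f + g).
Proof.
move=> sf sg; have [P [Pf Pg PD] PP] := smooth1_span2 sf sg.
by exists P => //; apply: (PD _ _ _ _).1.
Qed.

Lemma smooth1M f g : smooth1 f -> smooth1 g -> smooth1 (f * g).
Proof.
move=> sf sg; have [P [Pf Pg PD] PP] := smooth1_span2 sf sg.
by exists P => //; apply: (PD _ _ _ _).2.
Qed.

Lemma smooth1_primitive f g : smooth1 g ->
  (forall x : R, is_derive x 1 f (g x)) -> smooth1 f.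
Proof.
move=> [P Pg PP] fg; exists (f |` P); first by left.
move=> h [->|/PP[h' Ph' ?]]; first by exists g => //; right.
by exists h' => //; right.
Qed.

Lemma smooth1_continuous f : smooth1 f -> continuous f.
Proof.
move=> /smooth1_derive[f' _ ff'] x.
by apply: differentiable_continuous; apply/derivable1_diffP; case: (ff' x).
Qed.

Lemma smooth1_affine f a b : smooth1 f -> smooth1 (fun x => f (a * x + b)).
Proof.
move=> [P Pf PP].
(* The chain rule produces a factor [a] at each derivation, hence the coefficient [k]. *)
exists [set h | exists g k, P g /\ h = (fun x => k * g (a * x + b))].
  by exists f, 1; split=> //; apply/funext => x; rewrite mul1r.
move=> _ [g [k [Pg ->]]]; have [g' Pg' gg'] := PP _ Pg.
exists (fun x => (k * a) * g' (a * x + b)); first by exists g', (k * a).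
move=> x.
have ? : is_derive x 1 (fun y => a * y + b) a.
  rewrite (_ : (fun _ => _) = a *: (id : R -> R) + cst b)//.
  by apply: is_derive_eq; rewrite addr0 [LHS]mulr1.
have ? : is_derive x 1 (g \o (fun y => a * y + b)) (a * g' (a * x + b)).
  rewrite mulrC; apply: (@is_derive1_comp _ g (fun y => a * y + b)).
rewrite (_ : (fun _ => _) = k *: (g \o (fun y => a * y + b)))//.
by rewrite -mulrA; apply: is_deriveZ.
Qed.

End smooth_line.

(** * Functions flat at 0 *)

Section flat.
Context (R : realType).

(* The class of these functions, [exp(-1/x)] among them, is stable under
   derivation. *)
Definition flat (p : {poly R}) (x : R) : R :=
  if 0 < x then p.[x^-1] * expR (- x^-1) else 0.

(** With y = 1/x, the exponential series gives exp y >= y^(i+2)/(i+2)!, so y^i exp(-y) <= (i+2)! x^2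
    for each monomial. The power 2 is what makes the difference quotient at 0 vanish. *)
Lemma flat_bound p : exists2 C, 0 <= C & forall x, `|flat p x| <= C * x ^+ 2.
Proof.
exists (\sum_(i < size p) `|p`_i| * (i.+2)`!%:R).
  by apply: sumr_ge0 => i _; rewrite mulr_ge0.
move=> x; rewrite /flat; case: ifPn => [x0|_]; last first.
  rewrite normr0 mulr_ge0 ?sqr_ge0//.
  by apply: sumr_ge0 => i _; rewrite mulr_ge0.
rewrite horner_coef mulr_suml mulr_suml; apply: (le_trans (ler_norm_sum _ _ _)).
apply: ler_sum => i _; rewrite !normrM -!mulrA ler_wpM2l//.
have y0 : 0 < x^-1 by rewrite invr_gt0.
rewrite (ger0_norm (expR_ge0 _)) expRN normrX (gtr0_norm y0).
rewrite ler_pdivrMr ?expR_gt0//.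
have := expR_ge1Dxn i.+1 (ltW y0) => h.
have {}h : x^-1 ^+ i.+2 / (i.+2)`!%:R <= expR x^-1.
  by apply: le_trans h; rewrite lerDr.
rewrite ler_pdivrMr ?ltr0n ?fact_gt0// in h.
have -> : x^-1 ^+ i = x ^+ 2 * x^-1 ^+ i.+2.
  have -> : x^-1 ^+ i.+2 = x^-1 ^+ 2 * x^-1 ^+ i by rewrite -exprD.
  rewrite mulrA -exprMn.
  by rewrite mulfV ?gt_eqF// expr1n mul1r.
by rewrite [leRHS]mulrAC [leRHS]mulrC ler_wpM2l ?sqr_ge0// [leRHS]mulrC.
Qed.

(** With y = 1/x and dy/dx = -y^2, the derivative of p(y) exp(-y) is y^2 (p - p')(y) exp(-y). At 0
    the difference quotient is at most C |h| by [flat_bound]. *)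
Lemma is_derive_flat p (x : R) :
  is_derive x 1 (flat p) (flat ('X^2 * (p - p^`())) x).
Proof.
have [x0|x0|<-] := ltgtP 0 x.
- apply: (@near_eq_is_derive _ R^o R^o (fun y => p.[y^-1] * expR (- y^-1))).
    near=> y; rewrite /flat ifT//.
    by near: y; exact: lt_nbhsr.
  rewrite /flat x0.
  have dV : is_derive x 1 (fun y : R => y^-1) (- x ^- 2).
    have := @is_deriveV R id x 1 1; rewrite /= [_ *: 1]mulr1; apply.
    by rewrite gt_eqF.
  have dp : is_derive x 1 (fun y => p.[y^-1]) (p^`().[x^-1] * - x ^- 2).
    exact: (@is_derive1_comp _ (horner p) (fun y => y^-1)).
  have dN : is_derive x 1 (fun y : R => - y^-1) (x ^- 2).
    by apply: is_derive_eq; rewrite opprK.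
  have de : is_derive x 1 (fun y => expR (- y^-1)) (expR (- x^-1) * x ^- 2).
    exact: (@is_derive1_comp _ expR (fun y => - y^-1)).
  apply: is_derive_eq; rewrite !hornerE /= -!/(_ * _) exprVn.
  by rewrite /GRing.scale/=; ring.
- apply: (@near_eq_is_derive _ R^o R^o (cst 0)).
    near=> y; rewrite /flat ifF//; apply/negbTE; rewrite -leNgt ltW//.
    by near: y; exact: lt_nbhsl.
  rewrite /flat ltNge ltW//=; exact: is_derive_cst.
- rewrite [X in is_derive _ _ _ X](_ : _ = 0); last by rewrite /flat ltxx.
  have [C C0 Cf] := flat_bound p.
  have f0 : flat p 0 = 0 by rewrite /flat ltxx.
  have H : (fun h : R => h^-1 *: ((flat p \o shift 0) (h *: (1:R)) - flat p 0))
      @ 0^' --> (0 : R).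
    apply/cvgr0Pnorm_lt => e e0; near=> h.
    rewrite /= f0 subr0 addr0 [_ *: 1]mulr1 normrM normfV.
    have h0 : h != 0 by near: h; exact: nbhs_dnbhs_neq.
    have nh0 : 0 < `|h| by rewrite normr_gt0.
    rewrite mulrC ltr_pdivrMr// (le_lt_trans (Cf h))//.
    rewrite -real_normK ?num_real// expr2 mulrA ltr_pM2r//.
    rewrite (@le_lt_trans _ _ ((C + 1) * `|h|))//.
      by rewrite ler_wpM2r// lerDl.
    rewrite mulrC -ltr_pdivlMr ?ltr_wpDl//.
    near: h; apply: dnbhs0_lt; by rewrite divr_gt0// ltr_wpDl.
  apply: DeriveDef; first by apply/cvg_ex; exists 0.
  exact: (cvg_lim _ H).
Unshelve. all: by end_near. Qed.

Lemma smooth1_flat p : smooth1 (flat p).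
Proof.
exists (range flat); first by exists p.
move=> _ [q _ <-]; exists (flat ('X^2 * (q - q^`()))).
  by exists ('X^2 * (q - q^`())).
exact: is_derive_flat.
Qed.

End flat.

Section bump.
Context (R : realType).

(* Supported in [c + 1/(N+1), d - 1/(N+1)], and tends to the indicator of
   ]c, d[ as N grows. *)
Definition bump (c d : R) (N : nat) (x : R) : R :=
  flat 1 (N.+1%:R * (x - c) - 1) * flat 1 (N.+1%:R * (d - x) - 1).

Lemma smooth1_bump c d N : smooth1 (bump c d N).
Proof.
rewrite (_ : bump c d N =
    (fun x => flat 1 (N.+1%:R * x + (- N.+1%:R * c - 1))) *
    (fun x => flat 1 (- N.+1%:R * x + (N.+1%:R * d - 1)))).
  by apply: smooth1M; apply: smooth1_affine; exact: smooth1_flat.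
by apply/funext => x; rewrite /bump fctE; congr (flat _ _ * flat _ _); ring.
Qed.

Lemma flat1_ge0 (x : R) : 0 <= flat 1 x.
Proof. by rewrite /flat; case: ifPn => // x0; rewrite hornerC mul1r expR_ge0. Qed.

Lemma flat1_le1 (x : R) : flat 1 x <= 1.
Proof.
rewrite /flat; case: ifPn => // x0.
by rewrite hornerC mul1r -expR0 ler_expR oppr_le0 invr_ge0 ltW.
Qed.

Lemma bump_ge0 c d N x : 0 <= bump c d N x.
Proof. by rewrite mulr_ge0// flat1_ge0. Qed.

Lemma bump_le1 c d N x : bump c d N x <= 1.
Proof. by rewrite mulr_ile1 ?flat1_ge0 ?flat1_le1. Qed.

Lemma bump_neq0 c d N x : bump c d N x != 0 ->
  c + N.+1%:R^-1 <= x <= d - N.+1%:R^-1.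
Proof.
rewrite /bump /flat; case: ifPn => [cx|]; last by rewrite mul0r eqxx.
case: ifPn => [dx _|]; last by rewrite mulr0 eqxx.
have v0 : 0 < N.+1%:R^-1 :> R by rewrite invr_gt0.
have := mulr_gt0 v0 cx; have := mulr_gt0 v0 dx.
rewrite !mulrBr !mulKf ?pnatr_eq0// mulr1 => h1 h2.
by apply/andP; split; move: h1 h2; set v := N.+1%:R^-1; lra.
Qed.

Lemma flat1_cvg (y : R) : 0 < y ->
  flat 1 (N.+1%:R * y - 1) @[N --> \oo] --> (1 : R).
Proof.
move=> y0.
have Hy : N.+1%:R * y - 1 @[N --> \oo] --> +oo.
  apply/cvgryPge => A; near=> n.
  rewrite lerBrDr -ler_pdivrMr// (@le_trans _ _ n%:R) ?ler_nat//.
  near: n; exact: nbhs_infty_ger.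
have Hy0 : \forall N \near \oo, 0 < N.+1%:R * y - 1.
  near=> n; rewrite subr_gt0 -ltr_pdivrMr// (@lt_le_trans _ _ n%:R) ?ler_nat//.
  near: n; exact: nbhs_infty_gtr.
have HV : (N.+1%:R * y - 1)^-1 @[N --> \oo] --> (0 : R) by apply/gtr0_cvgV0.
have : expR (- (N.+1%:R * y - 1)^-1) @[N --> \oo] --> (1 : R).
  rewrite -[X in _ --> X]expR0 -oppr0.
  have C : expR (- z) @[z --> (0 : R)] --> expR (- (0 : R)).
    apply: continuous_comp; first exact: oppr_continuous.
    exact: continuous_expR.
  exact: (cvg_comp _ _ HV C).
apply: cvg_trans; apply: near_eq_cvg; near=> n.
rewrite /flat ifT ?hornerC ?mul1r//.
by near: n.
Unshelve. all: by end_near. Qed.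

Lemma bump_cvg c d x : bump c d N x @[N --> \oo] --> (\1_`]c, d[%classic x : R).
Proof.
rewrite indicE mem_setE in_itv/=; have [cx|xc] := ltP c x; last first.
  rewrite (_ : (fun _ => _) = cst 0); first exact: cvg_cst.
  apply/funext => N; apply/eqP/negPn/negP => /bump_neq0/andP[+ _].
  by apply/negP; rewrite -ltNge (le_lt_trans xc)// ltrDl invr_gt0.
have [xd|dx] := ltP x d; last first.
  rewrite (_ : (fun _ => _) = cst 0); first exact: cvg_cst.
  apply/funext => N; apply/eqP/negPn/negP => /bump_neq0/andP[_].
  by apply/negP; rewrite -ltNge (lt_le_trans _ dx)// ltrBlDr ltrDl invr_gt0.
rewrite -[X in _ --> X]mulr1; apply: cvgM; apply: flat1_cvg;
  by rewrite subr_gt0.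
Qed.

End bump.

(** * Smooth functions of several variables *)

Section smooth_space.
Context (R : realType) (V : normedModType R).

(** The device of [smooth1] again: a class stable under every ['D_v] disposes of the iteration in
    [smooth]. *)
Definition smooth_class (f : V -> R) : Prop :=
  exists2 P : set (V -> R), P f & forall g, P g ->
    (forall x, differentiable g x) /\ forall v, P ('D_v g).

Lemma smooth_class_smooth f : smooth_class f -> smooth f.
Proof.
move=> [P Pf PP] s x; suff : P (foldr (fun v g => 'D_v g) f s) by move=> /PP[].
by elim: s => //= v s IH; apply: (PP _ IH).2.
Qed.

Lemma smooth_class_cst c : smooth_class (cst c).
Proof.
exists (range (fun a : R => cst a : V -> R)); first by exists c.
move=> _ [a _ <-]; split => [x|v]; first exact: differentiable_cst.
by exists 0 => //; apply/funext => x; rewrite derive_cst.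
Qed.

Lemma ring_span_smooth (P : set (V -> R)) :
  (forall g, P g -> (forall x, differentiable g x) /\ forall v, P ('D_v g)) ->
  forall g, ring_span P g ->
    (forall x, differentiable g x) /\ forall v, ring_span P ('D_v g).
Proof.
move=> PP g0; elim=> {g0} [g /PP[dg Pg]|g h Sg [dg Sdg] Sh [dh Sdh]|
    g h Sg [dg Sdg] Sh [dh Sdh]].
- by split=> // v; exact: ring_span_in.
- split=> [x|v]; first exact: differentiableD.
  rewrite (_ : 'D_v _ = 'D_v g + 'D_v h); first exact: ring_span_add.
  by apply/funext => x; rewrite deriveD//; exact: diff_derivable.
- split=> [x|v]; first exact: differentiableM.
  rewrite (_ : 'D_v _ = g * 'D_v h + h * 'D_v g).
    by apply: ring_span_add; exact: ring_span_mul.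
  by apply/funext => x; rewrite deriveM//; exact: diff_derivable.
Qed.

Lemma smooth_classM f g :
  smooth_class f -> smooth_class g -> smooth_class (f * g).
Proof.
move=> [P Pf PP] [Q Qg QQ]; exists (ring_span (P `|` Q)).
  by apply: ring_span_mul; apply: ring_span_in; [left|right].
apply: ring_span_smooth => h [Ph|Qh].
- by have [dh Ph'] := PP _ Ph; split => // v; left.
- by have [dh Qh'] := QQ _ Qh; split => // v; right.
Qed.

Lemma smooth_class_prod I (s : seq I) (F : I -> V -> R) :
  (forall i, smooth_class (F i)) ->
  smooth_class (fun x => \prod_(i <- s) F i x).
Proof.
move=> sF; elim: s => [|i s IH].
  rewrite (_ : (fun _ => _) = cst 1); first exact: smooth_class_cst.
  by apply/funext => x; rewrite big_nil.
rewrite (_ : (fun _ => _) = F i * (fun x => \prod_(i <- s) F i x)).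
  exact: smooth_classM.
by apply/funext => x; rewrite big_cons.
Qed.

End smooth_space.

Section coordinates.
Context (R : realType) (d : nat).
Local Notation E := 'rV[R]_d.

Lemma derive_coord_comp (i : 'I_d) (f f' : R -> R) (v z : E) :
  (forall x : R, is_derive x 1 f (f' x)) ->
  is_derive z v (fun z : E => f (z 0 i)) (v 0 i * f' (z 0 i)).
Proof.
move=> ff'.
have df : differentiable f (z 0 i) by apply/derivable1_diffP; case: (ff' (z 0 i)).
have dc : differentiable (fun z : E => z 0 i) z by exact: differentiable_coord.
have dfc : differentiable (fun z : E => f (z 0 i)) z.
  exact: (@differentiable_comp _ _ _ _ (fun z : E => z 0 i) f).
apply: DeriveDef; first exact: diff_derivable.
have [dfz <-] := ff' (z 0 i).
rewrite deriveE// (@diff_comp _ _ _ _ (fun z : E => z 0 i) f)//= deriv1E//.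
rewrite /GRing.scale/=; congr (_ * _); last by rewrite derive1E.
rewrite -deriveE// /derive.
rewrite (_ : (fun _ => _) = (fun h : R => h^-1 * h * v 0 i)); last first.
  apply/funext => h /=; rewrite !mxE addrK /GRing.scale/=; ring.
apply: cvg_lim => //.
rewrite -[X in _ --> X]mul1r; apply: cvgM; last exact: cvg_cst.
have H : cst 1 @ (0 : R)^' --> (1 : R) by exact: cvg_cst.
apply: cvg_trans H; apply: near_eq_cvg; near=> h.
rewrite mulVf//; near: h; exact: nbhs_dnbhs_neq.
Unshelve. all: by end_near. Qed.

Lemma smooth_class_coord (i : 'I_d) (f : R -> R) :
  smooth1 f -> smooth_class (fun z : E => f (z 0 i)).
Proof.
move=> [P Pf PP].
exists [set h | exists g k, P g /\ h = (fun z : E => k * g (z 0 i))].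
  by exists f, 1; split=> //; apply/funext => x; rewrite mul1r.
move=> _ [g [k [Pg ->]]]; have [g' Pg' gg'] := PP _ Pg.
have dg (z : E) : differentiable (fun z : E => g (z 0 i)) z.
  apply: (@differentiable_comp _ _ _ _ (fun z : E => z 0 i) g).
    exact: differentiable_coord.
  by apply/derivable1_diffP; case: (gg' (z 0 i)).
have dz := fun v z => @derive_coord_comp i _ _ v z gg'.
rewrite (_ : (fun _ => _) = k *: (fun z : E => g (z 0 i)))//.
split => [z|v]; first exact: differentiableZ.
exists g', (k * v 0 i); split => //; apply/funext => z.
have [? dgz] := dz v z.
by rewrite deriveZ// dgz [LHS]mulrA.
Qed.

Lemma test_function_prod (f : 'I_d -> R -> R) (a b : 'I_d -> R) (O : set E) :
  (forall k, smooth1 (f k)) ->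
  (forall k x, f k x != 0 -> a k <= x <= b k) ->
  (forall z : E, (forall k, a k <= z 0 k <= b k) -> O z) ->
  test_function O (fun z : E => \prod_k f k (z 0 k)).
Proof.
move=> sf fab abO.
pose C : set E := [set z | forall k, z 0 k \in `[a k, b k] ].
have cC : compact C.
  by apply: (@rV_compact R d (fun k => `[a k, b k]%classic)) => k; exact: segment_compact.
have clC : closed C by apply: compact_closed => //; exact: norm_hausdorff.
have fC : closure [set z : E | \prod_k f k (z 0 k) != 0] `<=` C.
  rewrite closureE => z; apply; split => // y /= /prodf_neq0 H k.
  by rewrite in_itv/=; apply/fab/H.
split.
- apply: smooth_class_smooth.
  by apply: smooth_class_prod => k; exact: smooth_class_coord.
- by apply: (subclosed_compact _ cC) => //; exact: closed_closure.
- by move=> z /fC Cz; apply: abO => k; have := Cz k; rewrite in_itv.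
Qed.

End coordinates.

Section insertion.
Context (R : realType) (n : nat).

(** For [i = ord0] this is convertible to [cons_rV], the form in which the initial value is
    stated. *)
Definition ins (i : 'I_n.+1) (t : R) (y : 'rV[R]_n) : 'rV[R]_n.+1 :=
  \row_k oapp (y ord0) t (unlift i k).

Definition del (i : 'I_n.+1) (z : 'rV[R]_n.+1) : 'rV[R]_n :=
  \row_k z ord0 (lift i k).

Lemma ins_eq i t y : ins i t y 0 i = t.
Proof. by rewrite mxE unlift_none. Qed.

Lemma ins_lift i t y k : ins i t y 0 (lift i k) = y 0 k.
Proof. by rewrite mxE liftK. Qed.

Lemma insK i t y : del i (ins i t y) = y.
Proof. by apply/rowP => k; rewrite mxE ins_lift. Qed.

Lemma forall_ord_lift (i : 'I_n.+1) (P : 'I_n.+1 -> Prop) :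
  P i -> (forall k, P (lift i k)) -> forall j, P j.
Proof. by move=> Pi Pl j; case: (unliftP i j) => [k|] ->. Qed.

End insertion.

Section line_test.
Context (R : realType) (n : nat) (i : 'I_n.+1).
Local Notation E := 'rV[R]_n.+1.

(** A tensor product: differentiation along axis [i] touches [th] alone, and the other factors
    localise the line. *)
Definition line_test (th : R -> R) (ch : 'I_n -> R -> R) (z : E) : R :=
  th (z 0 i) * \prod_k ch k (z 0 (lift i k)).

Lemma derive_line_test th th' ch (z : E) :
  (forall x : R, is_derive x 1 th (th' x)) ->
  'D_(delta_mx 0 i) (line_test th ch) z = line_test th' ch z.
Proof.
move=> dth; rewrite [RHS]/line_test; have := @derive_coord_comp R _ i _ _ (delta_mx 0 i) z dth.
rewrite mxE !eqxx mul1r => -[dv <-].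
rewrite /derive /line_test.
set X := \prod_k _.
rewrite (_ : (fun h : R => _) = fun h : R =>
    (h^-1 *: (th ((h *: delta_mx 0 i + z) 0 i) - th (z 0 i))) * X).
  apply: cvg_lim => //; apply: cvgM; last exact: cvg_cst.
  exact: dv.
apply/funext => h /=; rewrite [in X in X - _](_ : \prod_k _ = X) -?mulrBl.
  by rewrite -[LHS]/(_ * _) mulrA.
apply: eq_bigr => k _; congr (ch _ _).
by rewrite !mxE eqxx/= [lift i k == i]eq_sym (negbTE (neq_lift _ _)) mulr0 add0r.
Qed.

Lemma test_function_line th ch (a b : 'I_n.+1 -> R) (O : set E) :
  smooth1 th -> (forall k, smooth1 (ch k)) ->
  (forall x, th x != 0 -> a i <= x <= b i) ->
  (forall k x, ch k x != 0 -> a (lift i k) <= x <= b (lift i k)) ->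
  (forall z : E, (forall k, a k <= z 0 k <= b k) -> O z) ->
  test_function O (line_test th ch).
Proof.
move=> sth sch tha cha abO.
pose f j := oapp ch th (unlift i j).
rewrite (_ : line_test th ch = fun z => \prod_j f j (z 0 j)).
  apply: (test_function_prod (a := a) (b := b)) => // k.
    by rewrite /f; case: (unlift i k).
  move=> x; rewrite /f; case: (unliftP i k) => [j|] -> /=; first exact: cha.
  exact: tha.
apply/funext => z; rewrite (bigD1_ord i)//= /f unlift_none; congr (_ * _).
by apply: eq_bigr => k _; rewrite liftK.
Qed.

End line_test.

(** * Integration on R^n *)

Section Rintegral_lemmas.
Context d (T : measurableType d) (R : realType).
Variable mu : {measure set T -> \bar R}.
Implicit Types (D : set T) (f g h : T -> R).

Lemma Rintegral_dct D (f_ : nat -> T -> R) f g : measurable D ->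
  (forall n, measurable_fun D (f_ n)) ->
  (forall x, D x -> f_ ^~ x @ \oo --> f x) ->
  mu.-integrable D (EFin \o g) ->
  (forall n x, D x -> `|f_ n x| <= g x) ->
  mu.-integrable D (EFin \o f) /\
  \int[mu]_(x in D) f_ n x @[n --> \oo] --> \int[mu]_(x in D) f x.
Proof.
move=> mD mf_ f_f ig f_g.
have mf : measurable_fun D f by apply: (measurable_fun_cvg mf_).
have [|||||fi _ H] := @dominated_convergence _ _ _ mu D mD
    (fun n => EFin \o f_ n) (EFin \o f) (EFin \o g).
- by move=> n; exact/measurable_EFinP.
- exact/measurable_EFinP.
- by apply/aeW => x Dx; apply/fine_cvgP; split; [exact: nearW|exact: f_f].
- exact: ig.
- by apply/aeW => x n Dx; rewrite lee_fin f_g.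
split => //; rewrite /Rintegral; apply: fine_cvg; rewrite fineK//.
exact: integrable_fin_num.
Qed.

Lemma integrable_dominated D f g : measurable D -> measurable_fun D f ->
  mu.-integrable D (EFin \o g) -> (forall x, D x -> `|f x| <= g x) ->
  mu.-integrable D (EFin \o f).
Proof.
move=> mD mf ig fg; apply: le_integrable ig => //; first exact/measurable_EFinP.
by move=> x Dx /=; rewrite lee_fin (le_trans (fg _ Dx))// ler_norm.
Qed.

Lemma integrable_measurable D f : measurable D ->
  mu.-integrable D (EFin \o f) -> measurable_fun D f.
Proof. by move=> mD /measurable_int/measurable_EFinP. Qed.

Lemma integrable_mulr_bounded D f h M : measurable D ->
  mu.-integrable D (EFin \o f) -> measurable_fun D h ->
  (forall x, D x -> `|h x| <= M) ->
  mu.-integrable D (EFin \o (fun x => f x * h x)).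
Proof.
move=> mD fi mh hM.
have mf := integrable_measurable mD fi.
apply: (@integrable_dominated D _ (fun x => `|M| * `|f x|)) => //.
- exact: measurable_funM.
- exact: (integrableZl mD `|M| (integrable_norm fi)).
- move=> x Dx; rewrite normrM mulrC ler_wpM2r//.
  by rewrite (le_trans (hM _ Dx))// ler_norm.
Qed.

Lemma integrableRD D f g : measurable D ->
  mu.-integrable D (EFin \o f) -> mu.-integrable D (EFin \o g) ->
  mu.-integrable D (EFin \o (fun x => f x + g x)).
Proof. by move=> mD fi gi; exact: (integrableD mD fi gi). Qed.

Lemma integrableRB D f g : measurable D ->
  mu.-integrable D (EFin \o f) -> mu.-integrable D (EFin \o g) ->
  mu.-integrable D (EFin \o (fun x => f x - g x)).
Proof. by move=> mD fi gi; exact: (integrableB mD fi gi). Qed.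

Lemma integrableRZ D f c : measurable D ->
  mu.-integrable D (EFin \o f) ->
  mu.-integrable D (EFin \o (fun x => c * f x)).
Proof. by move=> mD fi; exact: (integrableZl mD c fi). Qed.

Lemma integrableR_mkcond D f : measurable D ->
  mu.-integrable D (EFin \o f) <-> mu.-integrable setT (EFin \o (f \_ D)).
Proof.
move=> mD; rewrite -restrict_EFin.
exact: integrable_mkcond.
Qed.

Lemma integrableR_sum I (s : seq I) D (f : I -> T -> R) : measurable D ->
  (forall i, mu.-integrable D (EFin \o f i)) ->
  mu.-integrable D (EFin \o (fun x => \sum_(i <- s) f i x)).
Proof.
move=> mD fi; elim: s => [|i s IH].
  rewrite (_ : _ \o _ = cst 0%E); first exact: integrable0.
  by apply/funext => x /=; rewrite big_nil.
rewrite (_ : _ \o _ = EFin \o (fun x => f i x + \sum_(i <- s) f i x)).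
  exact: integrableRD.
by apply/funext => x /=; rewrite big_cons.
Qed.

Lemma Rintegral_sum I (s : seq I) D (f : I -> T -> R) : measurable D ->
  (forall i, mu.-integrable D (EFin \o f i)) ->
  \int[mu]_(x in D) (\sum_(i <- s) f i x) =
  \sum_(i <- s) \int[mu]_(x in D) f i x.
Proof.
move=> mD fi; elim: s => [|i s IH].
  rewrite big_nil -[RHS](Rintegral_set0 mu (fun=> 0)).
  rewrite /Rintegral integral_set0 integral0_eq// => x Dx.
  by rewrite big_nil.
rewrite big_cons -IH -RintegralD//; last exact: integrableR_sum.
by apply: eq_Rintegral => x _; rewrite big_cons.
Qed.

Lemma Rintegral_ae_eq D f g : measurable D ->
  measurable_fun D f -> measurable_fun D g ->
  {ae mu, forall x, D x -> f x = g x} ->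
  \int[mu]_(x in D) f x = \int[mu]_(x in D) g x.
Proof.
move=> mD mf mg fg; congr fine; apply: ae_eq_integral => //;
  [exact/measurable_EFinP|exact/measurable_EFinP|].
by apply: filterS fg => x /= fg Dx; rewrite fg.
Qed.

Lemma Rintegral_sub_support (D E : set T) f :
  D `<=` E -> (forall x, E x -> ~ D x -> f x = 0) ->
  \int[mu]_(x in E) f x = \int[mu]_(x in D) f x.
Proof.
move=> DE f0; rewrite Rintegral_mkcond [RHS]Rintegral_mkcond.
congr (Rintegral _ _ _); apply/funext => x; rewrite !patchE.
case: ifPn => xE; case: ifPn => xD //.
  by apply: f0; [rewrite inE in xE|rewrite notin_setE in xD].
by move: xE; rewrite notin_setE => -[]; apply: DE; rewrite inE in xD.
Qed.

End Rintegral_lemmas.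

(** * Functions determined by their integrals over a pi-system *)

Section pi_system.
Context d (T : measurableType d) (R : realType).
Variable mu : {measure set T -> \bar R}.

(** The measurable sets over which [h] integrates to 0 form a lambda-system: increasing unions pass
    by dominated convergence, and the exhaustion [g] puts [setT] in it. Dynkin's theorem then
    reaches all measurable sets. *)
Lemma pi_system_ae0 (G : set (set T)) (g : nat -> set T) (h : T -> R) :
  measurable = <<s G>> -> setI_closed G ->
  (forall k, G (g k)) -> nondecreasing_seq g -> \bigcup_k g k = setT ->
  mu.-integrable setT (EFin \o h) ->
  (forall A, G A -> \int[mu]_(x in A) h x = 0) ->
  {ae mu, forall x, h x = 0}.
Proof.
move=> mG GI Gg ndg gT hi hG.
have mh := integrable_measurable measurableT hi.
pose H := [set E | measurable E /\ \int[mu]_(x in E) h x = 0].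
have Hnd : ndseq_closed H.
  move=> F ndF HF; have mF n := (HF n).1.
  have mU : measurable (\bigcup_n F n) by exact: bigcup_measurable.
  split=> //; rewrite Rintegral_mkcond.
  have [||||_] := @Rintegral_dct _ _ _ mu setT (fun n => h \_ (F n))
      (h \_ (\bigcup_n F n)) (fun x => `|h x|) measurableT.
  - by move=> n; apply/(measurable_restrictT _ (mF n)).1; exact: measurable_funTS.
  - move=> x _; rewrite patchE; case: ifPn => [|xU].
      rewrite inE => -[n _ Fnx].
      apply: cvg_near_cst; near=> k; rewrite patchE mem_set//.
      have nk : (n <= k)%N by near: k; exact: nbhs_infty_ge.
      by move/subsetPset : (ndF _ _ nk); apply.
    apply: cvg_near_cst; apply: nearW => k; rewrite patchE memNset// => Fkx.
    by move: xU; rewrite notin_setE; apply; exists k.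
  - exact: integrable_norm.
  - by move=> n x _; rewrite patchE; case: ifPn => //; rewrite normr0.
  rewrite (_ : (fun n => _) = cst 0).
    by move/(cvg_lim (@Rhausdorff R)) => <-; rewrite lim_cst//; exact: Rhausdorff.
  by apply/funext => n; rewrite -Rintegral_mkcond (HF n).2.
have HG : G `<=` H by move=> A GA; split; [rewrite mG; exact: sub_sigma_algebra|exact: hG].
have HT : H setT by rewrite -gT; apply: Hnd => // k; exact/HG.
have Hlam : lambda_system setT H.
  split => //.
  move=> A B BA [mA hA] [mB hB]; split; first exact: measurableD.
  have : \int[mu]_(x in (A `\` B) `|` B) h x = 0.
    by rewrite setUC setDUK.
  rewrite Rintegral_setU//.
  - by rewrite hB addr0.
  - exact: measurableD.
  - by apply: integrableS hi => //; apply: measurableU => //; exact: measurableD.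
  - by apply/disj_setPRL => x Bx; apply/not_andP; right.
have HE E : measurable E -> \int[mu]_(x in E) h x = 0.
  rewrite mG => /(lambda_system_subset GI Hlam HG) -[]//.
have : ae_eq mu setT (EFin \o h) (cst 0%E).
  apply: integral_ae_eq => // E _ mE.
  rewrite integral0 -[LHS]fineK; last first.
    by apply: integrable_fin_num => //; apply: integrableS hi.
  by have := HE _ mE; rewrite /Rintegral => ->.
by apply: filterS => x /(_ I)[].
Unshelve. all: by end_near. Qed.

End pi_system.

Section boxes.
Context (R : realType) (n : nat).
Local Notation E := 'rV[R]_n.

Definition box (a b : 'I_n -> R) : set E :=
  [set x | forall k, a k < x ord0 k < b k].

Definition boxes : set (set E) := [set A | exists a b, A = box a b].

Lemma measurable_box a b : measurable (box a b).
Proof.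
rewrite (_ : box a b = \bigcap_(k in [set: 'I_n])
    ((fun x : E => x ord0 k) @^-1` `]a k, b k[)).
  apply: fin_bigcap_measurable => // k _; rewrite -[X in measurable X]setTI.
  exact: measurable_mx_coord.
apply/seteqP; split => x xab k; first by move=> _; rewrite /= in_itv; exact: xab.
by have := xab k I; rewrite /= in_itv.
Qed.

Lemma setI_box a b c e :
  box a b `&` box c e = box (fun k => Num.max (a k) (c k)) (fun k => Num.min (b k) (e k)).
Proof.
apply/seteqP; split => x /= => [[xab xce] k|xabce].
  by have /andP[? ?] := xab k; have /andP[? ?] := xce k; rewrite gt_max lt_min; apply/andP; split; apply/andP.
by split => k; have := xabce k; rewrite gt_max lt_min => /andP[/andP[? ?] /andP[? ?]]; apply/andP.
Qed.

Lemma nd_box (a b : nat -> 'I_n -> R) :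
  (forall k i j, (i <= j)%N -> a j k <= a i k) ->
  (forall k i j, (i <= j)%N -> b i k <= b j k) ->
  nondecreasing_seq (fun i => box (a i) (b i)).
Proof.
move=> Ha Hb i j ij; apply/subsetPset => x xab k; have /andP[ax xb] := xab k.
by rewrite (le_lt_trans (Ha _ _ _ ij))//= (lt_le_trans xb)// Hb.
Qed.

Definition cube (i : nat) : set E := box (fun=> - i%:R) (fun=> i%:R).

Lemma bigcup_cube : \bigcup_i cube i = setT.
Proof.
rewrite -subTset => x _.
exists (\sum_k (Num.truncn `|x ord0 k|).+1)%N => // k /=.
rewrite -ltr_norml (lt_le_trans (truncnS_gt _))// ler_nat.
by rewrite (bigD1 k)//= leq_addr.
Qed.

Lemma boxesE : @measurable _ E = <<s boxes>>.
Proof.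
apply/seteqP; split; last first.
  apply: smallest_sub; first exact: sigma_algebra_measurable.
  by move=> _ [a [b ->]]; exact: measurable_box.
apply: smallest_sub; first exact: smallest_sigma_algebra.
move=> _ [i [j [B [mB ->]]]]; rewrite ord1.
suff : measurable_fun setT ((fun x => x ord0 j) : g_sigma_algebraType boxes -> R).
  by move=> /(_ measurableT B mB); rewrite setTI.
apply: (measurability (RGenOInfty.G (R := R))); first exact: RGenOInfty.measurableE.
move=> _ [_ [x ->] <-]; rewrite setTI.
rewrite (_ : _ @^-1` _ =
    \bigcup_i box (fun k => if k == j then x else - i%:R) (fun=> i%:R)).
  apply: bigcupT_measurable => k; apply: sub_sigma_algebra.
  by exists (fun k0 => if k0 == j then x else - k%:R), (fun=> k%:R).
apply/seteqP; split => [y /=|y [k _ /(_ j)]]; last first.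
  by rewrite eqxx /= in_itv/= andbT => /andP[].
rewrite in_itv/= andbT => xy.
have [k _ Hk] : (\bigcup_i cube i) y by rewrite bigcup_cube.
exists k => // l; have /andP[Hl1 ->] := Hk l; rewrite andbT.
by case: ifPn => // /eqP ->.
Qed.

Lemma boxesI : setI_closed boxes.
Proof. by move=> _ _ [a [b ->]] [c [e ->]]; rewrite setI_box; do 2!eexists. Qed.

Lemma nd_cube : nondecreasing_seq cube.
Proof.
by apply: nd_box => k i j ij; rewrite ?lerN2 ler_nat.
Qed.

Lemma leb_boxE a b :
  leb R n (box a b) = (\prod_(i < n) lebesgue_measure `]a i, b i[%classic)%E.
Proof.
rewrite -leb_box; last by move=> i; exact: measurable_itv.
by congr (leb R n _).
Qed.

Lemma leb_box_lty a b : (leb R n (box a b) < +oo)%E.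
Proof.
rewrite leb_boxE ltey_eq; apply/orP; left; elim/big_ind: _ => //.
  by move=> x y; exact: fin_numM.
by move=> i _; rewrite lebesgue_measure_itv/=; case: ifP.
Qed.

Lemma ae0_boxes (h : E -> R) :
  (leb R n).-integrable setT (EFin \o h) ->
  (forall a b, \int[leb R n]_(x in box a b) h x = 0) ->
  {ae leb R n, forall x, h x = 0}.
Proof.
move=> hi h0; apply: (pi_system_ae0 boxesE boxesI _ nd_cube bigcup_cube) => //.
  by move=> k; do 2!eexists.
by move=> _ [a [b ->]].
Qed.

End boxes.

(** * Fubini along an arbitrary axis *)

Section ins_measure.
Context (R : realType) (n : nat) (i : 'I_n.+1).
Local Notation lam := (@lebesgue_measure R).

Definition insp (p : measurableTypeR R * 'rV[R]_n) : 'rV[R]_n.+1 := ins i p.1 p.2.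

Lemma measurable_insp : measurable_fun setT insp.
Proof.
apply: measurable_mxP => k j; rewrite ord1.
case: (unliftP i j) => [l|] ->.
- under eq_fun do rewrite ins_lift.
  exact: (measurableT_comp (measurable_mx_coord _ l) measurable_snd).
- by under eq_fun do rewrite ins_eq; exact: measurable_fst.
Qed.

Lemma measurable_insl (t : R) : measurable_fun setT (ins i t : 'rV[R]_n -> _).
Proof.
apply: (measurableT_comp measurable_insp (g := fun y => (t, y))).
exact: pair1_measurable.
Qed.

Lemma measurable_insr (y : 'rV[R]_n) :
  measurable_fun setT ((fun t => ins i t y) : measurableTypeR R -> _).
Proof.
apply: (measurableT_comp measurable_insp (g := fun t => (t, y))).
exact: pair2_measurable.
Qed.

Lemma preimage_ins_box (a b : 'I_n.+1 -> R) :
  insp @^-1` (box a b) = `]a i, b i[%classic `*`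
    box (fun k => a (lift i k)) (fun k => b (lift i k)).
Proof.
apply/seteqP; split => -[t y] /=.
  move=> H; split; first by rewrite in_itv/=; have := H i; rewrite ins_eq.
  by move=> k; have := H (lift i k); rewrite ins_lift.
rewrite in_itv/= => -[ht hy]; apply: (forall_ord_lift (i := i)) => [|k].
  by rewrite ins_eq.
by rewrite ins_lift; exact: hy.
Qed.

(** [leb] is built by splitting off coordinate 0. Splitting off coordinate [i] instead only permutes
    the side lengths in the measure of a box, and boxes are a generating pi-system of finite
    measure. *)
Lemma leb_ins A : measurable A ->
  leb R n.+1 A = pushforward (lam \x leb R n)%E insp A.
Proof.
pose m2 : {measure set 'rV[R]_n.+1 -> \bar R} :=
  measure_function_pushforward__canonical__measure_function_Measure
    (lam \x leb R n)%E measurable_insp.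
move=> mA; apply: (@measure_unique _ _ _ _ _ (boxesE R n.+1) (@boxesI R n.+1)
  _ (@bigcup_cube R n.+1) (leb R n.+1) m2 _ _ A mA).
- by move=> k; do 2!eexists.
- move=> _ [a [b ->]]; rewrite /= /pushforward preimage_ins_box.
  rewrite product_measure1E; [|exact: measurable_itv|exact: measurable_box].
  by rewrite !leb_boxE (bigD1_ord i).
- by move=> k; exact: leb_box_lty.
Qed.

Lemma ge0_integral_ins (f : 'rV[R]_n.+1 -> \bar R) :
  measurable_fun setT f -> (forall z, 0 <= f z)%E ->
  (\int[leb R n.+1]_z f z = \int[(lam \x leb R n)%E]_p f (insp p))%E.
Proof.
move=> mf f0.
rewrite (eq_measure_integral (measure_function_pushforward__canonical__measure_function_Measure
    (lam \x leb R n)%E measurable_insp)); last by move=> A mA _; exact: leb_ins.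
by rewrite ge0_integral_pushforward//; exact: measurable_insp.
Qed.

Lemma tonelli_ins (f : 'rV[R]_n.+1 -> \bar R) :
  measurable_fun setT f -> (forall z, 0 <= f z)%E ->
  (\int[leb R n.+1]_z f z = \int[leb R n]_y \int[lam]_t f (ins i t y))%E.
Proof.
move=> mf f0; rewrite ge0_integral_ins// fubini_tonelli2//.
by apply: measurableT_comp => //; exact: measurable_insp.
Qed.

Lemma tonelli_ins' (f : 'rV[R]_n.+1 -> \bar R) :
  measurable_fun setT f -> (forall z, 0 <= f z)%E ->
  (\int[leb R n.+1]_z f z = \int[lam]_t \int[leb R n]_y f (ins i t y))%E.
Proof.
move=> mf f0; rewrite ge0_integral_ins// fubini_tonelli1//.
by apply: measurableT_comp => //; exact: measurable_insp.
Qed.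

Lemma measurable_slice_int (f : 'rV[R]_n.+1 -> \bar R) :
  measurable_fun setT f -> (forall z, 0 <= f z)%E ->
  measurable_fun setT (fun y => \int[lam]_t f (ins i t y))%E.
Proof.
move=> mf f0; apply: (measurable_fun_fubini_tonelli_G (f \o insp)) => [|z]; last exact: f0.
by apply: measurableT_comp => //; exact: measurable_insp.
Qed.

Section fubini.
Variable f : 'rV[R]_n.+1 -> R.
Hypothesis fi : (leb R n.+1).-integrable setT (EFin \o f).

Let mf := integrable_measurable measurableT fi.

Let mfi : measurable_fun setT (f \o insp).
Proof. by apply: measurableT_comp => //; exact: measurable_insp. Qed.

Lemma integrable_insp : (lam \x leb R n)%E.-integrable setT (EFin \o (f \o insp)).
Proof.
move/integrableP : fi => [mf' foo]; apply/integrableP; split.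
  exact/measurable_EFinP.
move: foo; rewrite ge0_integral_ins//.
by apply: measurableT_comp.
Qed.

Lemma ae_integrable_slice :
  {ae leb R n, forall y, lam.-integrable setT (EFin \o (fun t => f (ins i t y)))}.
Proof. exact: (ae_integrable2 integrable_insp). Qed.

Let EFin_slice : {ae leb R n, forall y, setT y ->
  (\int[lam]_t (f (ins i t y))%:E = (\int[lam]_t f (ins i t y))%:E)%E}.
Proof.
apply: filterS ae_integrable_slice => y fy _.
by rewrite /Rintegral fineK//; exact: (integrable_fin_num _ fy).
Qed.

Lemma measurable_slice_Rint :
  measurable_fun setT (fun y => \int[lam]_t f (ins i t y)).
Proof.
apply: measurableT_comp; first exact: fine_measurable.
exact: (lebesgue_integral_fubini.measurable_fubini_G integrable_insp).
Qed.

Lemma integrable_slice_Rint :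
  (leb R n).-integrable setT (EFin \o (fun y => \int[lam]_t f (ins i t y))).
Proof.
apply/integrableP; split.
  by apply/measurable_EFinP; exact: measurable_slice_Rint.
have mfa : measurable_fun setT (fun z => `|f z|%:E).
  by apply/measurable_EFinP; exact: measurableT_comp.
have /integrableP[_] := fi; rewrite /= tonelli_ins//; apply: le_lt_trans.
apply: ge0_le_integral => //.
- apply/measurable_EFinP; apply: measurableT_comp => //.
  exact: measurable_slice_Rint.
- by apply: (@measurable_slice_int (fun z => `|f z|%:E)) => // z; rewrite lee_fin.
- move=> y _ /=; apply: le_trans (_ : `|\int[lam]_t (f (ins i t y))%:E| <= _)%E.
    rewrite /Rintegral; case: (\int[_]_t _)%E => //=; rewrite ?leey//.
  apply: le_abse_integral => //; apply/measurable_EFinP.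
  by apply: measurableT_comp => //; exact: measurable_insr.
Qed.

(** The inner real integral is the [fine] of the extended one; the two agree on almost every line,
    where the slice is integrable. *)
Lemma Rintegral_slice :
  \int[leb R n]_y \int[lam]_t f (ins i t y) = \int[leb R n.+1]_z f z.
Proof.
congr fine; rewrite -(ae_eq_integral _ _ _ _ _ EFin_slice)//.
- rewrite (integral21_prod_meas1 integrable_insp) /=.
  rewrite (eq_measure_integral (measure_function_pushforward__canonical__measure_function_Measure
    (lam \x leb R n)%E measurable_insp)); last by move=> A mA _; exact: leb_ins.
  rewrite integral_pushforward//; first exact: measurable_insp.
    exact/measurable_EFinP.
  by rewrite preimage_setT; exact: integrable_insp.
- exact: (lebesgue_integral_fubini.measurable_fubini_G integrable_insp).
- by apply/measurable_EFinP; exact: measurable_slice_Rint.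
Qed.

End fubini.

End ins_measure.

Section almost_everywhere.
Context d (T : measurableType d) (R : realType) (mu : {measure set T -> \bar R}).

Lemma aeS (P Q : T -> Prop) : (forall x, P x -> Q x) ->
  {ae mu, forall x, P x} -> {ae mu, forall x, Q x}.
Proof. by move=> PQ; apply: filterS. Qed.

Lemma aeI (P Q : T -> Prop) : {ae mu, forall x, P x} ->
  {ae mu, forall x, Q x} -> {ae mu, forall x, P x /\ Q x}.
Proof. exact: filterI. Qed.

Lemma ae_all (I : countType) (P : I -> T -> Prop) :
  (forall i, {ae mu, forall x, P i x}) -> {ae mu, forall x, forall i, P i x}.
Proof.
move=> aeP.
have : {ae mu, forall x, forall n, if unpickle n is Some i then P i x else True}.
  by apply/ae_foralln => n; case: (unpickle n) => [i|]; [exact: aeP|exact: aeW].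
by apply: aeS => x H i; have := H (pickle i); rewrite pickleK.
Qed.

End almost_everywhere.

(** * The fundamental lemma of the calculus of variations *)

Section fundamental_lemma.
Context (R : realType).
Local Notation lam := (@lebesgue_measure R).

Lemma cvg_prod_seq I (s : seq I) (F : nat -> I -> R) (l : I -> R) :
  (forall i, F N i @[N --> \oo] --> l i) ->
  \prod_(i <- s) F N i @[N --> \oo] --> \prod_(i <- s) l i.
Proof.
move=> Fl; elim: s => [|i s IH].
  rewrite big_nil; apply: cvg_near_cst; apply: nearW => N; exact: big_nil.
rewrite big_cons; under eq_cvg do rewrite big_cons.
exact: cvgM.
Qed.

Lemma measurable_bump c d N : measurable_fun setT (bump c d N : R -> R).
Proof. by apply: continuous_measurable_fun; apply: smooth1_continuous; exact: smooth1_bump. Qed.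

Lemma norm_bump c d N (x : R) : `|bump c d N x| <= 1.
Proof. by rewrite ger0_norm ?bump_ge0// bump_le1. Qed.

Section space.
Context (n : nat).
Local Notation E := 'rV[R]_n.

Definition bump_box (c d : 'I_n -> R) (N : nat) (x : E) : R :=
  \prod_k bump (c k) (d k) N (x 0 k).

Lemma measurable_bump_box c d N : measurable_fun setT (bump_box c d N).
Proof.
apply: measurable_prod => k _.
exact: (measurableT_comp (measurable_bump _ _ _) (measurable_mx_coord _ _)).
Qed.

Lemma norm_bump_box c d N x : `|bump_box c d N x| <= 1.
Proof.
rewrite /bump_box normr_prod; apply: prodr_ile1 => k _.
by rewrite normr_ge0 norm_bump.
Qed.

Lemma bump_box_cvg c d x :
  bump_box c d N x @[N --> \oo] --> (\1_(box c d) x : R).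
Proof.
have -> : \1_(box c d) x = \prod_k (\1_`]c k, d k[%classic (x 0 k)) :> R.
  rewrite indicE; case: (boolP (_ \in _)) => [|xn].
    rewrite inE => xcd; rewrite big1// => k _.
    by rewrite indicE mem_set//= in_itv/=; exact: xcd.
  apply/esym/eqP/prodf_eq0 => /=.
  move: xn; rewrite notin_setE => /existsNP[k xk]; exists k => //.
  by rewrite indicE memNset//= in_itv.
by apply: cvg_prod_seq => k; exact: bump_cvg.
Qed.

(** As [N] grows, dominated convergence turns the bumps into indicators of sub-boxes of [box a b],
    and [ae0_boxes] applies to [h] extended by 0. *)
Lemma bump_box_ae0 (a b : 'I_n -> R) (h : E -> R) :
  (leb R n).-integrable (box a b) (EFin \o h) ->
  (forall c d N, (forall k, a k <= c k) -> (forall k, d k <= b k) ->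
     \int[leb R n]_(x in box a b) (h x * bump_box c d N x) = 0) ->
  {ae leb R n, forall x, box a b x -> h x = 0}.
Proof.
move=> hi h0; have mab := measurable_box a b.
have hi1 : (leb R n).-integrable setT (EFin \o (h \_ (box a b))).
  exact: (integrableR_mkcond _ _ mab).1.
have : {ae leb R n, forall x, (h \_ (box a b)) x = 0}.
  apply: ae0_boxes => // a' b'.
  rewrite -Rintegral_mkcondr setI_box.
  set c := (fun k => Num.max (a' k) _); set d := (fun k => Num.min (b' k) _).
  rewrite -[box c d](setIidr (A := box a b)); last first.
    move=> x xcd k; have := xcd k.
    by rewrite gt_max lt_min => /andP[/andP[_ ->] /andP[_ ->]].
  rewrite Rintegral_mkcondr.
  have [||||_] := @Rintegral_dct _ _ _ (leb R n) (box a b)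
      (fun N x => h x * bump_box c d N x) (h \_ (box c d)) (fun x => `|h x|) mab.
  - move=> N; apply: measurable_funM; first exact: (integrable_measurable mab hi).
    by apply: measurable_funTS; exact: measurable_bump_box.
  - move=> x _; rewrite (_ : (h \_ (box c d)) x = h x * \1_(box c d) x).
      by apply: cvgM; [exact: cvg_cst|exact: bump_box_cvg].
    by rewrite patchE indicE; case: ifP; rewrite ?mulr1 ?mulr0.
  - exact: integrable_norm.
  - by move=> N x _; rewrite normrM ler_piMr// norm_bump_box.
  rewrite (_ : (fun N => _) = cst 0).
    by move/(cvg_lim (@Rhausdorff R)) => <-; rewrite lim_cst//; exact: Rhausdorff.
  apply/funext => N; apply: h0 => k; first by rewrite le_max lexx orbT.
  by rewrite ge_min lexx orbT.
by apply: filterS => x + xab; rewrite patchE mem_set.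
Qed.

End space.

(** Rational endpoints still generate the Borel sets and leave countably many intervals, hence
    countably many test functions on a line. *)
Definition rat_itvs : set (set R) :=
  [set A | exists p q : rat, A = `]ratr p, ratr q[%classic].

Lemma rat_itvsE : @measurable _ (measurableTypeR R) = <<s rat_itvs>>.
Proof.
apply/seteqP; split; last first.
  apply: smallest_sub; first exact: sigma_algebra_measurable.
  by move=> _ [p [q ->]]; exact: measurable_itv.
rewrite [X in X `<=` _]RGenOInfty.measurableE.
apply: smallest_sub; first exact: smallest_sigma_algebra.
move=> _ [x ->].
rewrite (_ : `]x, +oo[%classic = \bigcup_(q : rat)
    if x <= ratr q then \bigcup_(N : nat) `]ratr q, ratr N%:R[%classic else set0).
  apply: (@bigcupT_measurable_rat _ (g_sigma_algebraType rat_itvs)) => q.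
  case: ifP => // _; apply: bigcupT_measurable => N; apply: sub_sigma_algebra.
  by exists q, N%:R.
apply/seteqP; split => [y|y [q _]] /=; last first.
  case: ifP => // xq [N _]; rewrite /= !in_itv/= andbT => /andP[+ _].
  exact: le_lt_trans.
rewrite in_itv/= andbT => /rat_in_itvoo[q] /[!inE]/= /itvP xqy.
have xq : x < ratr q by rewrite xqy.
have qy : ratr q < y by rewrite xqy.
exists q => //; rewrite (ltW xq); exists (Num.truncn `|y|).+1 => //=.
by rewrite in_itv/= qy ratr_nat (le_lt_trans (ler_norm _))// truncnS_gt.
Qed.

Lemma rat_itvsI : setI_closed rat_itvs.
Proof.
move=> _ _ [p [q ->]] [p' [q' ->]].
exists (Num.max p p'), (Num.min q q').
have -> : ratr (Num.max p p') = Num.max (ratr p) (ratr p') :> R.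
  by rewrite !maxEle ler_rat; case: ifP.
have -> : ratr (Num.min q q') = Num.min (ratr q) (ratr q') :> R.
  by rewrite !minEle ler_rat; case: ifP.
apply/seteqP; split => x /=; rewrite !in_itv/= gt_max lt_min.
  by move=> [/andP[-> ->] /andP[-> ->]].
by move=> /andP[/andP[-> ->] /andP[-> ->]].
Qed.

Lemma bump_rat_ae0 (a b : R) (h : R -> R) :
  lam.-integrable `]a, b[ (EFin \o h) ->
  (forall (p q : rat) N,
     \int[lam]_(x in `]a, b[)
       (h x * bump (Num.max a (ratr p)) (Num.min b (ratr q)) N x) = 0) ->
  {ae lam, forall x, x \in `]a, b[ -> h x = 0}.
Proof.
move=> hi h0; have mab : measurable (`]a, b[%classic : set (measurableTypeR R)).
  exact: measurable_itv.
have mh : measurable_fun (`]a, b[%classic : set (measurableTypeR R)) h.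
  exact: (@integrable_measurable _ (measurableTypeR R) R lam).
have : {ae lam, forall x, (h \_ `]a, b[) x = 0}.
  apply: (@pi_system_ae0 _ (measurableTypeR R) R lam rat_itvs
    (fun k => `]ratr (- k%:R), ratr k%:R[%classic) _ rat_itvsE rat_itvsI).
  - by move=> k; do 2!eexists.
  - move=> i j ij; apply/subsetPset => x /=; rewrite !in_itv/= => /andP[xi ix].
    rewrite (le_lt_trans _ xi) ?(lt_le_trans ix)// ler_rat ?lerN2 ler_nat//.
  - rewrite -subTset => x _; exists (Num.truncn `|x|).+1 => //=.
    by rewrite in_itv/= rmorphN/= ratr_nat -ltr_norml truncnS_gt.
  - exact: ((integrableR_mkcond lam h mab).1 hi).
  move=> _ [p [q ->]]; rewrite -Rintegral_mkcondr.
  pose c : R := Num.max a (ratr p); pose d : R := Num.min b (ratr q).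
  rewrite (_ : _ `&` _ = `]a, b[ `&` `]c, d[); last first.
    apply/seteqP; split => x /=; rewrite !in_itv/= gt_max lt_min.
      by move=> [/andP[-> ->] /andP[-> ->]].
    by move=> [_ /andP[/andP[-> ->] /andP[-> ->]]].
  rewrite Rintegral_mkcondr.
  have [||||_] := @Rintegral_dct _ _ _ lam `]a, b[%classic
      (fun N x => h x * bump c d N x) (h \_ `]c, d[) (fun x => `|h x|) mab.
  - move=> N; apply: measurable_funM; first exact: mh.
    by apply: measurable_funTS; exact: measurable_bump.
  - move=> x _; rewrite (_ : (h \_ `]c, d[) x = h x * \1_`]c, d[%classic x).
      by apply: cvgM; [exact: cvg_cst|exact: bump_cvg].
    by rewrite patchE indicE; case: ifP; rewrite ?mulr1 ?mulr0.
  - exact: integrable_norm.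
  - by move=> N x _; rewrite normrM ler_piMr// norm_bump.
  rewrite (_ : (fun N => _) = cst 0).
    by move/(cvg_lim (@Rhausdorff R)) => <-; rewrite lim_cst//; exact: Rhausdorff.
  by apply/funext => N; exact: h0.
by apply: aeS => x + xab; rewrite patchE mem_set.
Qed.

End fundamental_lemma.

(** * Absolute continuity on lines *)

Section product_integral.
Context d1 d2 (T1 : measurableType d1) (T2 : measurableType d2) (R : realType).
Variable m1 : {sigma_finite_measure set T1 -> \bar R}.
Variable m2 : {sigma_finite_measure set T2 -> \bar R}.
Variable f : T1 * T2 -> R.
Hypothesis fi : (m1 \x m2)%E.-integrable setT (EFin \o f).

Lemma Rintegral12 :
  \int[m1]_x \int[m2]_y f (x, y) = \int[(m1 \x m2)%E]_z f z.
Proof.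
have ae1 : {ae m1, forall x, setT x ->
    (\int[m2]_y (f (x, y))%:E = (\int[m2]_y f (x, y))%:E)%E}.
  apply: aeS (ae_integrable1 fi) => x fx _.
  by rewrite /Rintegral fineK//; exact: (integrable_fin_num _ fx).
have mF := measurable_fubini_F fi.
congr fine; rewrite -(ae_eq_integral _ _ _ _ _ ae1)//.
- exact: (integral12_prod_meas1 fi).
- apply/measurable_EFinP; apply: measurableT_comp; first exact: fine_measurable.
  exact: mF.
Qed.

Lemma Rintegral21 :
  \int[m2]_y \int[m1]_x f (x, y) = \int[(m1 \x m2)%E]_z f z.
Proof.
have ae2 : {ae m2, forall y, setT y ->
    (\int[m1]_x (f (x, y))%:E = (\int[m1]_x f (x, y))%:E)%E}.
  apply: aeS (ae_integrable2 fi) => y fy _.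
  by rewrite /Rintegral fineK//; exact: (integrable_fin_num _ fy).
have mG := measurable_fubini_G fi.
congr fine; rewrite -(ae_eq_integral _ _ _ _ _ ae2)//.
- exact: (integral21_prod_meas1 fi).
- apply/measurable_EFinP; apply: measurableT_comp; first exact: fine_measurable.
  exact: mG.
Qed.

End product_integral.

Section absolutely_continuous.
Context (R : realType).
Local Notation lam := (@lebesgue_measure R).
Local Notation RR := (measurableTypeR R).

Lemma integrable_prod (u v : R -> R) :
  lam.-integrable setT (EFin \o u) -> lam.-integrable setT (EFin \o v) ->
  (lam \x lam)%E.-integrable setT (EFin \o (fun p : RR * RR => u p.1 * v p.2)).
Proof.
move=> ui vi.
have mu_ : measurable_fun (setT : set RR) u.
  by apply: (@integrable_measurable _ _ _ lam).
have mv_ : measurable_fun (setT : set RR) v.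
  by apply: (@integrable_measurable _ _ _ lam).
apply/integrable12ltyP.
  apply/measurable_EFinP; apply: measurable_funM.
    exact: (measurableT_comp mu_ measurable_fst).
  exact: (measurableT_comp mv_ measurable_snd).
under eq_integral => x _.
  under eq_integral do rewrite /= normrM EFinM.
  rewrite ge0_integralZl//; last first.
    by apply/measurable_EFinP; exact: measurableT_comp.
  over.
have vfin : (\int[lam]_y `|v y|%:E)%E \is a fin_num.
  by apply: (integrable_fin_num _ (integrable_norm vi)).
rewrite -(fineK vfin) ge0_integralZr//; last 2 first.
- by apply/measurable_EFinP; exact: measurableT_comp.
- by rewrite lee_fin fine_ge0// integral_ge0.
rewrite fineK// lte_mul_pinfty//; first exact: integral_ge0.
  exact: (integrable_fin_num _ (integrable_norm ui)).
by rewrite ltey_eq vfin.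
Qed.

(** Fubini for u(x) v(y) on the plane cut along the diagonal into y < x and x <= y; the closed
    half-line of the second piece may be opened since its end point is null. *)
Lemma mulr_Rintegral (u v : R -> R) :
  lam.-integrable setT (EFin \o u) -> lam.-integrable setT (EFin \o v) ->
  \int[lam]_x u x * \int[lam]_x v x =
  \int[lam]_x (u x * \int[lam]_(y in `]-oo, x[) v y) +
  \int[lam]_x (v x * \int[lam]_(y in `]-oo, x[) u y).
Proof.
move=> ui vi; have Fi := integrable_prod ui vi.
have uiS (A : set RR) : measurable A -> lam.-integrable A (EFin \o u).
  by move=> mA; apply: integrableS ui.
have viS (A : set RR) : measurable A -> lam.-integrable A (EFin \o v).
  by move=> mA; apply: integrableS vi.
set F := (fun p : RR * RR => u p.1 * v p.2) in Fi.
pose A : set (RR * RR) := [set p | p.2 < p.1].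
have mA : measurable A.
  rewrite -[A]setTI.
  exact: (measurable_fun_ltr measurable_snd measurable_fst measurableT (Y := [set true])).
have FAi : (lam \x lam)%E.-integrable setT (EFin \o (F \_ A)).
  exact: ((integrableR_mkcond _ F mA).1 (integrableS measurableT mA (@subsetT _ _) Fi)).
have FCi : (lam \x lam)%E.-integrable setT (EFin \o (F \_ (~` A))).
  have mC := measurableC mA.
  exact: ((integrableR_mkcond _ F mC).1 (integrableS measurableT mC (@subsetT _ _) Fi)).
have -> : \int[lam]_x u x * \int[lam]_x v x = \int[(lam \x lam)%E]_p F p.
  rewrite -Rintegral12// -RintegralZr//.
  by apply: eq_Rintegral => x _; rewrite -RintegralZl.
have -> : \int[(lam \x lam)%E]_p F p =
    \int[(lam \x lam)%E]_p (F \_ A) p + \int[(lam \x lam)%E]_p (F \_ (~` A)) p.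
  rewrite -RintegralD//; apply: eq_Rintegral => p _.
  rewrite !patchE in_setC; case: ifPn; by rewrite ?addr0 ?add0r.
congr (_ + _).
- rewrite -Rintegral12//; apply: eq_Rintegral => x _.
  rewrite -RintegralZl//; [|exact: viS].
  rewrite [RHS]Rintegral_mkcond; apply: eq_Rintegral => y _.
  have e : ((x, y) \in A) = (y < x) by apply/idP/idP; rewrite inE.
  by rewrite !patchE e mem_setE/= in_itv/=.
- rewrite -Rintegral21//; apply: eq_Rintegral => y _.
  rewrite Rintegral_itv_bndo_bndc; last exact: uiS.
  rewrite -RintegralZl//; [|exact: uiS].
  rewrite [RHS]Rintegral_mkcond; apply: eq_Rintegral => x _.
  have e : ((x, y) \in A) = (y < x) by apply/idP/idP; rewrite inE.
  rewrite !patchE in_setC e mem_setE/= in_itv/= -leNgt.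
  by case: ifP => // _; rewrite /F/= mulrC.
Qed.

Definition prim (g : R -> R) (a t : R) : R := \int[lam]_(s in `]a, t[) g s.

Implicit Types (a b : R) (u v f g F G : R -> R).

Lemma integrable_itv_sub a b c e g : a <= c -> e <= b ->
  lam.-integrable `]a, b[ (EFin \o g) -> lam.-integrable `]c, e[ (EFin \o g).
Proof.
move=> ac eb; apply: integrableS; [exact: measurable_itv|exact: measurable_itv|].
by apply: subset_itv; rewrite bnd_simp.
Qed.

Lemma measurable_of_integrable_itv a b g :
  lam.-integrable `]a, b[ (EFin \o g) ->
  measurable_fun (`]a, b[%classic : set RR) g.
Proof. by move=> gi; apply: (@integrable_measurable _ RR R lam). Qed.

Lemma prim_continuous a b g : a <= b -> lam.-integrable `]a, b[ (EFin \o g) ->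
  {within `[a, b], continuous (prim g a)}.
Proof.
(* Extension by 0 gives integrability on the closed interval, where the continuity theorem for the
   integral applies. *)
move=> ab gi; pose g1 := g \_ `]a, b[.
have mI : measurable (`]a, b[%classic : set RR) by exact: measurable_itv.
have g1i : lam.-integrable setT (EFin \o g1) := (integrableR_mkcond lam g mI).1 gi.
have g1S (A : set RR) : measurable A -> lam.-integrable A (EFin \o g1).
  by move=> mA; apply: integrableS g1i.
have H := parameterized_integral_continuous ab (g1S _ (measurable_itv `[a, b])).
apply: (@subspace_eq_continuous _ _ _ _ _ _ H) => t.
rewrite inE/= in_itv/= => /andP[at_ tb].
rewrite /from_subspace/= /parameterized_integral.
rewrite -Rintegral_itv_obnd_cbnd; last by apply: g1S; exact: measurable_itv.
rewrite -Rintegral_itv_bndo_bndc; last by apply: g1S; exact: measurable_itv.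
apply: eq_Rintegral => x; rewrite inE/= in_itv/= => /andP[ax xt].
by rewrite /g1 patchE mem_set//= in_itv/= ax (lt_le_trans xt).
Qed.

Lemma norm_prim a b g t : t <= b -> lam.-integrable `]a, b[ (EFin \o g) ->
  `|prim g a t| <= \int[lam]_(s in `]a, b[) `|g s|.
Proof.
move=> tb gi; have gti := integrable_itv_sub (lexx a) tb gi.
apply: (le_trans (@le_normr_Rintegral _ RR R lam _ g (measurable_itv `]a, t[) gti)).
rewrite Rintegral_mkcond [leRHS]Rintegral_mkcond.
apply: le_Rintegral => //.
- exact: ((@integrableR_mkcond _ RR R lam _ (fun x => `|g x|) (measurable_itv `]a, t[)).1 (integrable_norm gti)).
- exact: ((@integrableR_mkcond _ RR R lam _ (fun x => `|g x|) (measurable_itv `]a, b[)).1 (integrable_norm gi)).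
- move=> x _; rewrite !patchE !mem_setE/= !in_itv/=.
  case: ifPn => [/andP[-> xt]|_]; first by rewrite (lt_le_trans xt).
  by case: ifPn => _; [exact: normr_ge0|exact: lexx].
Qed.

Lemma measurable_prim a b g : a <= b -> lam.-integrable `]a, b[ (EFin \o g) ->
  measurable_fun (`]a, b[%classic : set RR) (prim g a).
Proof.
move=> ab gi; apply: subspace_continuous_measurable_fun; first exact: measurable_itv.
apply: continuous_subspaceW (prim_continuous ab gi).
by apply: subset_itv; rewrite bnd_simp.
Qed.

Lemma integrable_mul_prim a b u v : a <= b ->
  lam.-integrable `]a, b[ (EFin \o u) -> lam.-integrable `]a, b[ (EFin \o v) ->
  lam.-integrable `]a, b[ (EFin \o (fun x => u x * prim v a x)).
Proof.
move=> ab ui vi.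
apply: (@integrable_mulr_bounded _ RR R lam _ _ _ (\int[lam]_(s in `]a, b[) `|v s|)) => //.
  exact: measurable_prim.
by move=> x /=; rewrite in_itv/= => /andP[_ /ltW xb]; exact: norm_prim.
Qed.

(** Integration by parts, by [mulr_Rintegral] for [u] and [v] extended by 0 outside []a, b[]. *)
Lemma prim_mul a b u v : a <= b ->
  lam.-integrable `]a, b[ (EFin \o u) -> lam.-integrable `]a, b[ (EFin \o v) ->
  prim u a b * prim v a b = prim (fun x => u x * prim v a x + v x * prim u a x) a b.
Proof.
move=> ab ui vi; have mI : measurable (`]a, b[%classic : set RR) by exact: measurable_itv.
rewrite [RHS]RintegralD//; try exact: integrable_mul_prim.
rewrite {1 2}/prim.
rewrite Rintegral_mkcond [X in _ * X = _]Rintegral_mkcond mulr_Rintegral; last 2 first.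
- exact: ((integrableR_mkcond lam u mI).1 ui).
- exact: ((integrableR_mkcond lam v mI).1 vi).
have E g x : x \in `]a, b[ ->
    \int[lam]_(y in `]-oo, x[) (g \_ `]a, b[) y = prim g a x.
  rewrite in_itv/= => /andP[ax xb].
  rewrite Rintegral_mkcond [RHS]Rintegral_mkcond; apply: eq_Rintegral => y _.
  rewrite !patchE !mem_setE/= !in_itv/=.
  case: ifPn => [yx|]; first by rewrite (lt_trans yx xb) andbT.
  by rewrite andbF.
have E2 f g : \int[lam]_x ((f \_ `]a, b[) x * \int[lam]_(y in `]-oo, x[) (g \_ `]a, b[) y) =
    \int[lam]_(x in `]a, b[) (f x * prim g a x).
  rewrite (Rintegral_mkcond lam `]a, b[%classic (fun x => f x * prim g a x)).
  apply: eq_Rintegral => x _; rewrite [RHS]patchE.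
  have -> : (f \_ `]a, b[) x = if x \in `]a, b[ then f x else 0.
    by rewrite patchE mem_setE.
  by rewrite mem_setE; case: ifPn => xab; rewrite ?mul0r// E.
by rewrite !E2.
Qed.

(** Absolute continuity in its integral form, with density [f]. The equation holds on the closed
    interval, so the end values of [F] are the traces of its class. *)
Definition ac_on a b F f : Prop :=
  lam.-integrable `]a, b[ (EFin \o f) /\
  exists c, forall t, t \in `[a, b] -> F t = c + prim f a t.

Lemma ac_continuous a b F f : a <= b -> ac_on a b F f ->
  {within `[a, b], continuous F}.
Proof.
move=> ab [fi [c Fc]].
apply: (@subspace_eq_continuous _ _ _ (fun t => c + prim f a t)).
  by move=> t; rewrite inE/= => tab; rewrite /from_subspace/= Fc.
have := prim_continuous ab fi => H x.
by apply: cvgD; [exact: cvg_cst|exact: H].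
Qed.

Lemma prim_a g a : prim g a a = 0.
Proof. by rewrite /prim set_itvoo0// Rintegral_set0. Qed.

Lemma ac_int a b F f : a <= b -> ac_on a b F f ->
  \int[lam]_(t in `]a, b[) f t = F b - F a.
Proof.
move=> ab [fi [c Fc]].
rewrite !Fc ?in_itv/= ?lexx ?ab// prim_a addr0 addrC addKr //.
Qed.

Lemma ac_bounded a b F f : a <= b -> ac_on a b F f ->
  exists M, forall t, t \in `[a, b] -> `|F t| <= M.
Proof.
move=> ab [fi [c Fc]]; exists (`|c| + \int[lam]_(s in `]a, b[) `|f s|) => t tab.
rewrite Fc// (le_trans (ler_normD _ _))// lerD2l norm_prim//.
by move: tab; rewrite in_itv => /andP[].
Qed.

Lemma ac_measurable a b F f : a <= b -> ac_on a b F f ->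
  measurable_fun (`]a, b[%classic : set RR) F.
Proof.
move=> ab /(ac_continuous ab) cF.
apply: subspace_continuous_measurable_fun; first exact: measurable_itv.
apply: continuous_subspaceW cF.
by apply: subset_itv; rewrite bnd_simp.
Qed.

Lemma ac_integrable_mul a b F f g : a <= b -> ac_on a b F f ->
  lam.-integrable `]a, b[ (EFin \o g) ->
  lam.-integrable `]a, b[ (EFin \o (fun t => g t * F t)).
Proof.
move=> ab acF gi; have [M FM] := ac_bounded ab acF.
apply: (@integrable_mulr_bounded _ RR R lam _ _ _ M) => //.
  exact: ac_measurable acF.
move=> t /=; rewrite in_itv/= => /andP[/ltW ? /ltW ?].
by apply: FM; rewrite in_itv/=; apply/andP.
Qed.

(** Writing each factor as a constant plus a primitive, the product expands into constants, linear
    terms and a product of two primitives; only the last needs [prim_mul]. *)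
Lemma ac_mul a b F f G g : a <= b -> ac_on a b F f -> ac_on a b G g ->
  ac_on a b (fun t => F t * G t) (fun t => f t * G t + g t * F t).
Proof.
move=> ab acF acG; have [fi [c Fc]] := acF; have [gi [e Ge]] := acG.
split.
  by apply: integrableRD => //; [exact: ac_integrable_mul acG fi|
                                exact: ac_integrable_mul acF gi].
exists (c * e) => t tab; rewrite Fc// Ge//.
have /andP[at_ tb] : a <= t <= b by move: tab; rewrite in_itv.
have fti := integrable_itv_sub (lexx a) tb fi.
have gti := integrable_itv_sub (lexx a) tb gi.
have mI : measurable (`]a, t[%classic : set RR) by exact: measurable_itv.
rewrite mulrDl !mulrDr prim_mul//.
have -> : prim (fun t => f t * G t + g t * F t) a t =
    prim (fun x => (e * f x + c * g x) + (f x * prim g a x + g x * prim f a x)) a t.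
  apply: eq_Rintegral => x; rewrite inE/= in_itv/= => /andP[ax xt].
  have xab : x \in `[a, b] by rewrite in_itv/= (ltW ax) (ltW (lt_le_trans xt tb)).
  by rewrite Fc// Ge//; ring.
rewrite [X in _ = _ + X]/prim RintegralD//; last 2 first.
- by apply: integrableRD => //; exact: integrableRZ.
- by apply: integrableRD => //; exact: integrable_mul_prim.
rewrite RintegralD//; try exact: integrableRZ.
rewrite (@RintegralZl _ RR R lam _ f e mI fti) (@RintegralZl _ RR R lam _ g c mI gti).
by rewrite -/(prim f a t) -/(prim g a t) -/(prim _ a t); ring.
Qed.

End absolutely_continuous.

(** * The du Bois-Reymond lemma *)

Section du_bois_reymond.
Context (R : realType).
Local Notation lam := (@lebesgue_measure R).
Local Notation RR := (measurableTypeR R).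
Variables (a b : R).
Hypothesis ab : a < b.

Let mI : measurable (`]a, b[%classic : set RR).
Proof. exact: measurable_itv. Qed.

Lemma Rintegral_itv_cst (r : R) : \int[lam]_(x in `]a, b[) r = r * (b - a).
Proof.
by rewrite Rintegral_cst//= lebesgue_measure_itv/= lte_fin ab.
Qed.

Lemma integrable_itv_bounded (f : R -> R) (M : R) :
  measurable_fun (`]a, b[%classic : set RR) f ->
  (forall x, `|f x| <= M) -> lam.-integrable `]a, b[ (EFin \o f).
Proof.
move=> mf fM; apply: (@measurable_bounded_integrable _ RR R lam) => //.
  by rewrite [X in (X < _)%E](@lebesgue_measure_itv R `]a, b[)/= lte_fin ab ltry.
exists M; split; first exact: num_real.
by move=> x Mx y _ /=; rewrite (le_trans (fM _))// ltW.
Qed.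

Lemma integrable_bump c d N : lam.-integrable `]a, b[ (EFin \o bump c d N).
Proof.
apply: (@integrable_itv_bounded _ 1).
  by apply: measurable_funTS; exact: measurable_bump.
exact: norm_bump.
Qed.

Definition mass (u : R -> R) : R := \int[lam]_(x in `]a, b[) u x.

(** For small [N] the bump may be identically 0; its mass tends to b - a. *)
Lemma mass_bump_gt0 : exists N, 0 < mass (bump a b N).
Proof.
have [||||_ H] := @Rintegral_dct _ RR R lam `]a, b[%classic (fun N => bump a b N)
    (\1_`]a, b[%classic) (cst 1) mI.
- by move=> N; apply: measurable_funTS; exact: measurable_bump.
- by move=> x _; exact: bump_cvg.
- by apply: (@integrable_itv_bounded _ 1) => // x; rewrite /cst normr1.
- by move=> N x _; exact: norm_bump.
have E : \int[lam]_(x in `]a, b[) (\1_`]a, b[%classic x) = b - a.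
  rewrite -[RHS]mul1r -Rintegral_itv_cst; apply: eq_Rintegral => x xab.
  by rewrite indicE xab.
rewrite E in H.
have ba0 : 0 < b - a by rewrite subr_gt0.
have [N _ /(_ N (leqnn N)) HN] := cvgr_gt (b - a) H 0 ba0.
by exists N.
Qed.

Section family.
Variable N0 : nat.
Hypothesis m0 : 0 < mass (bump a b N0).
Local Notation psi0 := (bump a b N0).

(* The combination of two bumps with zero integral, so that its primitive is
   again a test function. *)
Definition dtest (c d : R) (N : nat) (x : R) : R :=
  mass psi0 * bump c d N x - mass (bump c d N) * psi0 x.

Definition test (c d : R) (N : nat) (t : R) : R :=
  \int[lam]_(s in `]-oo, t]) dtest c d N s.

Variables (c d : R) (N : nat).
Hypotheses (ac : a <= c) (db : d <= b).

(** Both bumps keep at least this distance from the ends of []a, b[]. *)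
Let e : R := (maxn N N0).+1%:R^-1.

Let e0 : 0 < e. Proof. by rewrite invr_gt0. Qed.

Let le_e (M : nat) : (M <= maxn N N0)%N -> e <= M.+1%:R^-1.
Proof. by move=> MN; rewrite lef_pV2 ?posrE// ler_nat. Qed.

Lemma dtest_neq0 x : dtest c d N x != 0 -> a + e <= x <= b - e.
Proof.
rewrite /dtest; move: (mass psi0) (mass (bump c d N)) => M0 M.
have [->|cx _] := eqVneq (bump c d N x) 0.
  rewrite mulr0 sub0r oppr_eq0 mulf_eq0 negb_or => /andP[_ /bump_neq0].
  move=> /andP[ax xb]; have := le_e (leq_maxr N N0) => ?.
  by rewrite (le_trans _ ax) ?(le_trans xb)// ?lerD2l// lerN2.
have /andP[cx' xd] := bump_neq0 cx; have := le_e (leq_maxl N N0) => ?.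
by rewrite (le_trans _ cx') ?(le_trans xd)// lerD// lerN2.
Qed.

Lemma smooth1_dtest : smooth1 (dtest c d N).
Proof.
rewrite (_ : dtest c d N = (cst (mass psi0) * bump c d N) +
    (cst (- mass (bump c d N)) * psi0)).
  by apply: smooth1D; apply: smooth1M; [exact: smooth1_cst|exact: smooth1_bump|
    exact: smooth1_cst|exact: smooth1_bump].
by apply/funext => x; rewrite /dtest !fctE mulNr.
Qed.

Lemma integrable_dtest : lam.-integrable setT (EFin \o dtest c d N).
Proof.
have -> : dtest c d N = (dtest c d N) \_ `]a, b[.
  apply/funext => x; rewrite patchE; case: ifPn => //.
  rewrite mem_setE in_itv/= => xab; apply/eqP/negPn/negP => /dtest_neq0/andP[ax xb].
  by move: xab; rewrite (lt_le_trans _ ax) ?ltrDl// (le_lt_trans xb)// gtrBl.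
apply: (integrableR_mkcond lam _ mI).1.
apply: (@integrableRB _ RR R lam) => //; apply: (@integrableRZ _ RR R lam) => //;
  exact: integrable_bump.
Qed.

Lemma is_derive_test (x : R) : is_derive x 1 (test c d N) (dtest c d N x).
Proof.
have xx1 : x < x + 1 by rewrite ltrDl.
have di : lam.-integrable `]-oo, x + 1] (EFin \o dtest c d N).
  by apply: integrableS integrable_dtest => //; exact: measurable_itv.
have [||dF FE] := @continuous_FTC1 R (dtest c d N) -oo%O x (x + 1) xx1 di.
- by rewrite ltNyr.
- by apply: smooth1_continuous; exact: smooth1_dtest.
apply: DeriveDef; first exact: dF.
by rewrite -derive1E; exact: FE.
Qed.

Lemma smooth1_test : smooth1 (test c d N).
Proof. exact: smooth1_primitive smooth1_dtest is_derive_test. Qed.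

Lemma mass_dtest : mass (dtest c d N) = 0.
Proof.
rewrite /mass RintegralB//; last 2 first.
- by apply: (@integrableRZ _ RR R lam) => //; exact: integrable_bump.
- by apply: (@integrableRZ _ RR R lam) => //; exact: integrable_bump.
rewrite (@RintegralZl _ RR R lam _ _ _ mI (integrable_bump c d N)).
rewrite (@RintegralZl _ RR R lam _ _ _ mI (integrable_bump a b N0)).
rewrite -/(mass psi0) -/(mass (bump c d N)).
by move: (mass psi0) (mass (bump c d N)) => M0 M; rewrite mulrC subrr.
Qed.

(** Left of the support of [dtest] the integral is 0; right of it, it is the whole mass, cancelled
    by the multiple of the fixed bump. *)
Lemma test_neq0 x : test c d N x != 0 -> a + e <= x <= b - e.
Proof.
move=> tx; apply/andP; split; rewrite leNgt; apply: contra tx => xe; apply/eqP.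
- rewrite /test (@Rintegral_sub_support _ RR R lam set0) ?Rintegral_set0// => s /= sx _.
  apply/eqP/negPn/negP => /dtest_neq0/andP[es _].
  by move: sx; rewrite in_itv/= leNgt (lt_le_trans xe es).
- rewrite -mass_dtest /test /mass Rintegral_mkcond [RHS]Rintegral_mkcond.
  apply: eq_Rintegral => s _; rewrite !patchE !mem_setE !in_itv/=.
  have [->|] := eqVneq (dtest c d N s) 0; first by rewrite !if_same.
  move=> /dtest_neq0/andP[as_ sb].
  rewrite (le_trans sb (ltW xe)) (lt_le_trans _ as_) ?ltrDl//=.
  by rewrite (le_lt_trans sb) ?gtrBl.
Qed.

Lemma test_prim t : t \in `]a, b[ ->
  test c d N t = mass psi0 * prim (bump c d N) a t
                 - mass (bump c d N) * prim psi0 a t.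
Proof.
rewrite in_itv/= => /andP[at_ /ltW tb].
have mt : measurable (`]a, t[%classic : set RR) by exact: measurable_itv.
have S f : lam.-integrable `]a, b[ (EFin \o f) -> lam.-integrable `]a, t[ (EFin \o f).
  by apply: integrable_itv_sub.
have ci := S _ (integrable_bump c d N); have i0 := S _ (integrable_bump a b N0).
rewrite /prim /test /dtest; have mE := dtest_neq0; move: mE.
rewrite /dtest; move: (mass psi0) (mass (bump c d N)) => M0 M mE.
rewrite -(@RintegralZl _ RR R lam _ _ _ mt ci) -(@RintegralZl _ RR R lam _ _ _ mt i0).
rewrite -(@RintegralB _ RR R lam)//; last 2 first.
- exact: (@integrableRZ _ RR R lam).
- exact: (@integrableRZ _ RR R lam).
rewrite Rintegral_itv_bndo_bndc; last first.
  by apply: (@integrableRB _ RR R lam) => //; exact: (@integrableRZ _ RR R lam).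
apply: (@Rintegral_sub_support _ RR R lam).
  by apply: subset_itv; rewrite bnd_simp.
move=> x /= + nx; rewrite in_itv/= => xt; apply/eqP/negPn/negP.
move=> /mE/andP[ax _]; apply: nx.
by rewrite in_itv/= xt andbT (lt_le_trans _ ax)// ltrDl.
Qed.

End family.

Lemma Rintegral_lin4 (r s : R) (f1 f2 g1 g2 : R -> R) :
  lam.-integrable `]a, b[ (EFin \o f1) -> lam.-integrable `]a, b[ (EFin \o f2) ->
  lam.-integrable `]a, b[ (EFin \o g1) -> lam.-integrable `]a, b[ (EFin \o g2) ->
  \int[lam]_(x in `]a, b[) ((r * f1 x - s * f2 x) + (r * g1 x - s * g2 x)) =
  (r * \int[lam]_(x in `]a, b[) f1 x - s * \int[lam]_(x in `]a, b[) f2 x) +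
  (r * \int[lam]_(x in `]a, b[) g1 x - s * \int[lam]_(x in `]a, b[) g2 x).
Proof.
move=> f1i f2i g1i g2i.
have Z r' h' : lam.-integrable `]a, b[ (EFin \o h') ->
    lam.-integrable `]a, b[ (EFin \o (fun x => r' * h' x)).
  exact: (@integrableRZ _ RR R lam).
have B h1 h2 : lam.-integrable `]a, b[ (EFin \o h1) ->
    lam.-integrable `]a, b[ (EFin \o h2) ->
    lam.-integrable `]a, b[ (EFin \o (fun x => h1 x - h2 x)).
  exact: (@integrableRB _ RR R lam).
rewrite (@RintegralD _ RR R lam _ _ _ mI (B _ _ (Z r _ f1i) (Z s _ f2i)) (B _ _ (Z r _ g1i) (Z s _ g2i))).
rewrite (@RintegralB _ RR R lam _ _ _ mI (Z r _ f1i) (Z s _ f2i)).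
rewrite (@RintegralB _ RR R lam _ _ _ mI (Z r _ g1i) (Z s _ g2i)).
by rewrite !(@RintegralZl _ RR R lam _ _ _ mI).
Qed.

(* du Bois-Reymond.  The family is countable so that, on a product space, the
   null sets excluded for its members can be united. *)
Lemma line_test_family : exists (I : countType) (th th' : I -> R -> R),
  [/\ forall k, smooth1 (th k),
      forall k (x : R), is_derive x 1 (th k) (th' k x),
      forall k, exists2 e, 0 < e & forall x,
        (th k x != 0) || (th' k x != 0) -> a + e <= x <= b - e &
      forall f g, lam.-integrable `]a, b[ (EFin \o f) ->
        lam.-integrable `]a, b[ (EFin \o g) ->
        (forall k, \int[lam]_(x in `]a, b[) (f x * th' k x + g x * th k x) = 0) ->
        exists2 F, ac_on a b F g &
          {ae lam, forall x, x \in `]a, b[ -> f x = F x}].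
Proof.
have [N0 m0] := mass_bump_gt0.
pose c (p : rat) : R := Num.max a (ratr p).
pose d (q : rat) : R := Num.min b (ratr q).
have acp p : a <= c p by rewrite le_max lexx.
have dbq q : d q <= b by rewrite ge_min lexx.
exists (rat * rat * nat)%type,
  (fun k => test N0 (c k.1.1) (d k.1.2) k.2), (fun k => dtest N0 (c k.1.1) (d k.1.2) k.2).
split => [k|k x|k|f g fi gi fg0].
- exact: smooth1_test.
- exact: is_derive_test.
- exists ((maxn k.2 N0).+1%:R^-1); first by rewrite invr_gt0.
  by move=> x /orP[/test_neq0|/dtest_neq0]; exact.
pose G := \int[lam]_(x in `]a, b[) g x.
(* Integrating the last term by parts, [A u] is the integral of (f - prim g a) u. Thus [r] is the
   mean of f - prim g a against the normalised reference bump, the only possible integration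
   constant. *)
pose A u := \int[lam]_(x in `]a, b[) (f x * u x) - mass u * G +
            \int[lam]_(x in `]a, b[) (g x * prim u a x).
pose r := A (bump a b N0) / mass (bump a b N0).
pose h x := f x - r - prim g a x.
have fbi c' d' N : lam.-integrable `]a, b[ (EFin \o (fun x => f x * bump c' d' N x)).
  apply: (@integrable_mulr_bounded _ RR R lam _ _ _ 1) => //.
    by apply: measurable_funTS; exact: measurable_bump.
  by move=> x _; exact: norm_bump.
have bgi c' d' N : lam.-integrable `]a, b[ (EFin \o (fun x => bump c' d' N x * prim g a x)).
  by apply: integrable_mul_prim => //; [exact: ltW|exact: integrable_bump].
have gbi c' d' N : lam.-integrable `]a, b[ (EFin \o (fun x => g x * prim (bump c' d' N) a x)).
  by apply: integrable_mul_prim => //; [exact: ltW|exact: integrable_bump].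
have rbi c' d' N : lam.-integrable `]a, b[ (EFin \o (fun x => r * bump c' d' N x)).
  by apply: (@integrableRZ _ RR R lam) => //; exact: integrable_bump.
have hE c' d' N : \int[lam]_(x in `]a, b[) (h x * bump c' d' N x) =
    A (bump c' d' N) - r * mass (bump c' d' N).
  have E : \int[lam]_(x in `]a, b[) (g x * prim (bump c' d' N) a x) =
      mass (bump c' d' N) * G -
      \int[lam]_(x in `]a, b[) (bump c' d' N x * prim g a x).
    have := prim_mul (ltW ab) (integrable_bump c' d' N) gi.
    rewrite [X in _ = X]RintegralD//.
    rewrite -[prim g a b]/G -[prim (bump _ _ _) a b]/(mass (bump c' d' N)) => ->.
    by rewrite addrC addKr.
  rewrite /A E; transitivity (\int[lam]_(x in `]a, b[)
      (f x * bump c' d' N x - r * bump c' d' N x - bump c' d' N x * prim g a x)).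
    by apply: eq_Rintegral => x _; rewrite /h; ring.
  rewrite RintegralB//; last by apply: (@integrableRB _ RR R lam).
  rewrite RintegralB// (@RintegralZl _ RR R lam _ _ _ mI (integrable_bump c' d' N)).
  rewrite -/(mass (bump c' d' N)); ring.
have hi : lam.-integrable `]a, b[ (EFin \o h).
  apply: (@integrableRB _ RR R lam) => //.
    apply: (@integrableRB _ RR R lam) => //.
    by apply: (@integrable_itv_bounded _ `|r|).
  rewrite (_ : prim g a = (fun x => 1 * prim g a x)); last by apply/funext => x; rewrite mul1r.
  apply: integrable_mul_prim => //; first exact: ltW.
  by apply: (@integrable_itv_bounded _ 1) => // x; rewrite normr1.
(* The hypothesis for the test function built from two bumps says that [A] is proportional to [mass]
   on them. *)
have AE p q N : mass (bump a b N0) * A (bump (c p) (d q) N) =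
    mass (bump (c p) (d q) N) * A (bump a b N0).
  have := fg0 (p, q, N) => /=.
  set u := bump (c p) (d q) N; set u0 := bump a b N0.
  rewrite (_ : \int[lam]_(x in _) _ = \int[lam]_(x in `]a, b[)
      ((mass u0 * (f x * u x) - mass u * (f x * u0 x)) +
       (mass u0 * (g x * prim u a x) - mass u * (g x * prim u0 a x)))); last first.
    apply: eq_Rintegral => x; rewrite mem_setE => xab.
    rewrite test_prim// /dtest -/u -/u0.
    by move: (mass u) (mass u0) (prim u a x) (prim u0 a x) (u x) (u0 x) => *; ring.
  rewrite (Rintegral_lin4 _ _ (fbi _ _ _) (fbi _ _ _) (gbi _ _ _) (gbi _ _ _)) => H.
  have alg (m1 m2 G' a1 a2 b1 b2 : R) :
      m2 * (a1 - m1 * G' + b1) - m1 * (a2 - m2 * G' + b2) =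
      (m2 * a1 - m1 * a2) + (m2 * b1 - m1 * b2) by ring.
  by apply/eqP; rewrite -subr_eq0 /A alg; apply/eqP.
exists (fun t => r + prim g a t); first by split => //; exists r.
have : {ae lam, forall x, x \in `]a, b[ -> h x = 0}.
  apply: bump_rat_ae0 => // p q N; rewrite hE -/(c p) -/(d q) /r.
  rewrite mulrAC [A (bump a b N0) * _]mulrC -AE mulrAC divff ?gt_eqF// mul1r subrr//.
apply: aeS => x H /H /eqP; rewrite /h -addrA -opprD subr_eq0 => /eqP //.
Qed.

End du_bois_reymond.

(** * Weak derivatives on lines parallel to an axis *)

Section slices.
Context (R : realType) (n : nat) (i : 'I_n.+1).
Local Notation lam := (@lebesgue_measure R).
Local Notation RR := (measurableTypeR R).
Local Notation E := 'rV[R]_n.+1.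

Lemma measurable_del : measurable_fun setT (del i : E -> 'rV[R]_n).
Proof.
apply: measurable_mxP => k j; rewrite ord1.
under eq_fun do rewrite mxE.
exact: measurable_mx_coord.
Qed.

Lemma smooth1_bounded (f : R -> R) (a b : R) : smooth1 f ->
  (forall x, f x != 0 -> a <= x <= b) -> exists M, forall x, `|f x| <= M.
Proof.
move=> /smooth1_continuous cf fab.
have cfs : {within `[a, b], continuous f} by exact: continuous_subspaceT.
have /compact_bounded[M [_ HM]] := continuous_compact cfs (@segment_compact _ a b).
exists (`|M| + 1) => x; have [->|/fab xab] := eqVneq (f x) 0.
  by rewrite normr0 addr_ge0.
apply: (HM (`|M| + 1)); first by rewrite (le_lt_trans (ler_norm _))// ltrDl.
by exists x => //=; rewrite in_itv.
Qed.

Variables (a b : 'I_n.+1 -> R).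
Hypothesis abi : a i < b i.
Let a' k := a (lift i k).
Let b' k := b (lift i k).

Lemma box_ins t y : box a b (ins i t y) <-> (t \in `]a i, b i[) /\ box a' b' y.
Proof.
have := preimage_ins_box i a b => /seteqP[h1 h2].
by split => [H|H]; [have := h1 (t, y) H|have := h2 (t, y) H].
Qed.

Lemma measurable_smooth_coord (f : R -> R) : smooth1 f ->
  measurable_fun setT (fun z : E => f (z 0 i)).
Proof.
move=> /smooth1_continuous cf.
apply: (measurableT_comp (continuous_measurable_fun cf)).
exact: measurable_mx_coord.
Qed.

Lemma line_test_neq0 (u : R -> R) c d N e z : 0 < e ->
  (forall k, a' k <= c k) -> (forall k, d k <= b' k) ->
  (forall x, u x != 0 -> a i + e <= x <= b i - e) ->
  line_test i u (fun l => bump (c l) (d l) N) z != 0 -> box a b z.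
Proof.
move=> e0 ac db ue.
rewrite mulf_eq0 negb_or => /andP[/ue/andP[h1 h2] /prodf_neq0 h3].
apply: (forall_ord_lift (i := i)) => [|l].
  by rewrite (lt_le_trans _ h1) ?ltrDl//= (le_lt_trans h2)// gtrBl.
have /bump_neq0/andP[h4 h5] := h3 l isT.
rewrite (le_lt_trans (ac l))/= ?(lt_le_trans _ (db l))//.
  by rewrite (le_lt_trans h5)// gtrBl invr_gt0.
by rewrite (lt_le_trans _ h4)// ltrDl invr_gt0.
Qed.

Lemma weak_partial_line_test (O : set E) (f g : E -> R) th th' c d N e :
  box a b `<=` O -> weak_partial O i f g ->
  smooth1 th -> (forall x : R, is_derive x 1 th (th' x)) -> 0 < e ->
  (forall x, (th x != 0) || (th' x != 0) -> a i + e <= x <= b i - e) ->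
  (forall k, a' k <= c k) -> (forall k, d k <= b' k) ->
  \int[leb R n.+1]_(z in box a b)
    (f z * line_test i th' (fun l => bump (c l) (d l) N) z) =
  - \int[leb R n.+1]_(z in box a b)
    (g z * line_test i th (fun l => bump (c l) (d l) N) z).
Proof.
move=> abO fg sth dth e0 He ac db; pose ch l := bump (c l) (d l) N.
have the x : th x != 0 -> a i + e <= x <= b i - e by move=> h; apply: He; rewrite h.
have the' x : th' x != 0 -> a i + e <= x <= b i - e by move=> h; apply: He; rewrite h orbT.
have tf : test_function O (line_test i th ch).
  pose v : R := N.+1%:R^-1.
  have v0 : 0 < v by rewrite invr_gt0.
  apply: (test_function_line
    (a := fun j => oapp (fun l => c l + v) (a i + e) (unlift i j))
    (b := fun j => oapp (fun l => d l - v) (b i - e) (unlift i j))) => //.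
  - by move=> l; exact: smooth1_bump.
  - by rewrite unlift_none.
  - by move=> l x; rewrite liftK; exact: bump_neq0.
  - move=> z Hz; apply: abO; apply: (forall_ord_lift (i := i)) => [|l].
      have := Hz i; rewrite unlift_none/= => /andP[h1 h2].
      by rewrite (lt_le_trans _ h1) ?ltrDl//= (le_lt_trans h2)// gtrBl.
    have := Hz (lift i l); rewrite liftK/= => /andP[h1 h2].
    rewrite (le_lt_trans (ac l))/= ?(lt_le_trans _ (db l))//.
      by rewrite (le_lt_trans h2)// gtrBl.
    by rewrite (lt_le_trans _ h1)// ltrDl.
rewrite -(@Rintegral_sub_support _ _ _ _ (box a b) O)//; last first.
  move=> z _ nz; apply/eqP; rewrite mulf_eq0; apply/orP; right.
  by apply/negPn/negP => /(line_test_neq0 e0 ac db the').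
rewrite -[X in _ = - X](@Rintegral_sub_support _ _ _ _ (box a b) O)//; last first.
  move=> z _ nz; apply/eqP; rewrite mulf_eq0; apply/orP; right.
  by apply/negPn/negP => /(line_test_neq0 e0 ac db the).
rewrite -(fg _ tf).
by apply: eq_Rintegral => z _; rewrite (@derive_line_test _ _ _ _ th').
Qed.

(** For one member of the family on the line, the slice integral of f th' + g th is an integrable
    function of the other variables, and the weak identity makes it orthogonal to every bump in
    them. It therefore vanishes for almost every line. *)
Lemma weak_partial_slices (O : set E) (f g : E -> R) :
  box a b `<=` O ->
  (leb R n.+1).-integrable (box a b) (EFin \o f) ->
  (leb R n.+1).-integrable (box a b) (EFin \o g) ->
  weak_partial O i f g ->
  {ae leb R n, forall y, box a' b' y ->
    exists2 F, ac_on (a i) (b i) F (fun t => g (ins i t y)) &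
      {ae lam, forall t, t \in `]a i, b i[ -> f (ins i t y) = F t}}.
Proof.
move=> abO fi gi fg.
have [I [th [th' [sth dth thab thP]]]] := line_test_family abi.
have sth' k : smooth1 (th' k).
  have [u su thu] := smooth1_derive (sth k).
  rewrite (_ : th' k = u)//; apply/funext => x.
  by have [_ <-] := dth k x; have [_ <-] := thu x.
have mB := measurable_box a b.
set f1 := f \_ (box a b); set g1 := g \_ (box a b).
have f1i : (leb R n.+1).-integrable setT (EFin \o f1) := (integrableR_mkcond _ f mB).1 fi.
have g1i : (leb R n.+1).-integrable setT (EFin \o g1) := (integrableR_mkcond _ g mB).1 gi.
pose P k z := f1 z * th' k (z 0 i) + g1 z * th k (z 0 i).
have Pi k : (leb R n.+1).-integrable setT (EFin \o P k).
  have [e e0 He] := thab k.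
  have [M HM] := smooth1_bounded (sth k) (fun x tx => He x (introT orP (or_introl tx))).
  have [M' HM'] := smooth1_bounded (sth' k) (fun x tx => He x (introT orP (or_intror tx))).
  apply: integrableRD => //.
    apply: (integrable_mulr_bounded (M := M')) => //.
    exact: measurable_smooth_coord.
  apply: (integrable_mulr_bounded (M := M)) => //.
  exact: measurable_smooth_coord.
have H0 k : {ae leb R n, forall y, box a' b' y -> \int[lam]_t P k (ins i t y) = 0}.
  apply: bump_box_ae0.
    by apply: integrableS (integrable_slice_Rint i (Pi k)) => //; exact: measurable_box.
  move=> c d N ac db.
  have [e e0 He] := thab k.
  pose ch l := bump (c l) (d l) N.
  have the x : th k x != 0 -> a i + e <= x <= b i - e by move=> h; apply: He; rewrite h.
  have the' x : th' k x != 0 -> a i + e <= x <= b i - e by move=> h; apply: He; rewrite h orbT.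
  pose bb z := bump_box c d N (del i z).
  have ltE u z : line_test i u ch z = u (z 0 i) * bb z.
    rewrite /line_test /bb /bump_box; congr (_ * _); apply: eq_bigr => l _.
    by rewrite mxE.
  have mbb : measurable_fun setT bb.
    exact: (measurableT_comp (measurable_bump_box _ _ _) measurable_del).
  have Pbi : (leb R n.+1).-integrable setT (EFin \o (fun z => P k z * bb z)).
    apply: (integrable_mulr_bounded (M := 1)) => // z _; exact: norm_bump_box.
  have -> : \int[leb R n]_(y in box a' b')
      (\int[lam]_t P k (ins i t y) * bump_box c d N y) =
      \int[leb R n]_y \int[lam]_t (P k (ins i t y) * bb (ins i t y)).
    rewrite -(@Rintegral_sub_support _ _ _ _ (box a' b') setT)//; last first.
      move=> y _ ny; rewrite [X in X * _](_ : _ = 0) ?mul0r//.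
      rewrite /Rintegral integral0_eq// => t _; rewrite /P /f1 /g1 !patchE memNset ?mul0r ?addr0//.
      by move=> /box_ins[].
    apply: Rintegral_ae_eq => //.
    - apply: measurable_funM; first exact: measurable_slice_Rint (Pi k).
      exact: measurable_bump_box.
    - exact: measurable_slice_Rint Pbi.
    - apply: aeS (ae_integrable_slice i (Pi k)) => y Pyi _.
      rewrite -(@RintegralZr _ RR R lam setT _ _ measurableT Pyi); apply: eq_Rintegral => t _.
      by rewrite /bb insK.
  rewrite [LHS](Rintegral_slice i Pbi).
  have bMi h u : smooth1 u -> (forall x, u x != 0 -> a i + e <= x <= b i - e) ->
      (leb R n.+1).-integrable (box a b) (EFin \o h) ->
      (leb R n.+1).-integrable (box a b) (EFin \o (fun z => h z * line_test i u ch z)).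
    move=> su ue hi; have [M HM] := smooth1_bounded su ue.
    apply: (integrable_mulr_bounded (M := M)) => //.
      rewrite (_ : line_test i u ch = (fun z => u (z 0 i) * bb z)); last first.
        by apply/funext => z; exact: ltE.
      apply: measurable_funM; apply: measurable_funTS => //.
      exact: measurable_smooth_coord.
    move=> z _; rewrite ltE normrM -[leRHS]mulr1 ler_pM//.
    exact: norm_bump_box.
  transitivity (\int[leb R n.+1]_(z in box a b)
      (f z * line_test i (th' k) ch z + g z * line_test i (th k) ch z)).
    rewrite [RHS]Rintegral_mkcond; apply: eq_Rintegral => z _.
    rewrite /P /f1 /g1 !patchE; case: ifPn => _; last by rewrite !mul0r addr0 mul0r.
    by rewrite !ltE; ring.
  rewrite RintegralD//; [|exact: bMi|exact: bMi].
  by rewrite (weak_partial_line_test N abO fg (sth k) (dth k) e0 He ac db) addNr.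
(* Countability of the family: one null set of lines serves all its members. *)
have := aeI (ae_all H0) (aeI (ae_integrable_slice i f1i) (ae_integrable_slice i g1i)).
apply: aeS => y [Hy [fyi gyi]] yab.
have mI : measurable (`]a i, b i[%classic : set RR) by exact: measurable_itv.
have restr (h : E -> R) : (fun t => (h \_ (box a b)) (ins i t y)) = (fun t => h (ins i t y)) \_ `]a i, b i[.
  apply/funext => t; rewrite !patchE; congr (if _ then _ else _).
  apply/idP/idP => [/set_mem/box_ins[h1 _]|]; first by rewrite mem_setE.
  by rewrite mem_setE => h1; apply/mem_set/box_ins.
have fyi' : lam.-integrable `]a i, b i[ (EFin \o (fun t => f (ins i t y))).
  by apply: (integrableR_mkcond lam _ mI).2; rewrite -restr.
have gyi' : lam.-integrable `]a i, b i[ (EFin \o (fun t => g (ins i t y))).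
  by apply: (integrableR_mkcond lam _ mI).2; rewrite -restr.
have [k|F acF fF] := thP _ _ fyi' gyi'; last by exists F.
rewrite -[RHS](Hy k yab) Rintegral_mkcond; apply: eq_Rintegral => t _.
rewrite /P /f1 /g1 ins_eq; have /(congr1 (@^~ t)) -> := restr f; have /(congr1 (@^~ t)) -> := restr g.
by rewrite !patchE; case: ifPn => // _; rewrite !mul0r addr0.
Qed.

End slices.

(** * Projection onto a closed convex set *)

Section dot_product.
Context (R : realType) (m : nat).
Implicit Types (u v w : 'cV[R]_m).

Lemma dotC u v : dot u v = dot v u.
Proof. by apply: eq_bigr => k _; rewrite mulrC. Qed.

Lemma dotDl u v w : dot (u + v) w = dot u w + dot v w.
Proof. by rewrite /dot -big_split; apply: eq_bigr => k _; rewrite mxE mulrDl. Qed.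

Lemma dotZl (a : R) u v : dot (a *: u) v = a * dot u v.
Proof. by rewrite /dot mulr_sumr; apply: eq_bigr => k _; rewrite mxE mulrA. Qed.

Lemma dotNl u v : dot (- u) v = - dot u v.
Proof. by rewrite -scaleN1r dotZl mulN1r. Qed.

Lemma dotBl u v w : dot (u - v) w = dot u w - dot v w.
Proof. by rewrite dotDl dotNl. Qed.

Lemma dotDr u v w : dot w (u + v) = dot w u + dot w v.
Proof. by rewrite dotC dotDl ![dot _ w]dotC. Qed.

Lemma dotBr u v w : dot w (u - v) = dot w u - dot w v.
Proof. by rewrite dotC dotBl ![dot _ w]dotC. Qed.

Lemma dotZr (a : R) u v : dot u (a *: v) = a * dot u v.
Proof. by rewrite dotC dotZl dotC. Qed.

Lemma dot_sq_ge0 u : 0 <= dot u u.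
Proof. by apply: sumr_ge0 => k _; rewrite -expr2 sqr_ge0. Qed.

Lemma enorm_sq u : enorm u ^+ 2 = dot u u.
Proof. by rewrite sqr_sqrtr// dot_sq_ge0. Qed.

Lemma le_enorm u v : (enorm u <= enorm v) = (dot u u <= dot v v).
Proof. by rewrite ler_sqrt// dot_sq_ge0. Qed.

Lemma sqr_coord_le_dot u k : u k 0 ^+ 2 <= dot u u.
Proof.
rewrite /dot (bigD1 k)//= -expr2 lerDl.
by apply: sumr_ge0 => j _; rewrite -expr2 sqr_ge0.
Qed.

End dot_product.

Section projection.
Context (R : realType) (m : nat) (K : set 'cV[R]_m).
Hypotheses (K_closed : closed K) (K_convex : convex_set K) (K0 : K 0).
Implicit Types (u v p q : 'cV[R]_m).
Local Notation P := (euclid_proj K).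

Lemma continuous_sum_seq (V : topologicalType) I (s : seq I) (F : I -> V -> R) :
  (forall i, continuous (F i)) -> continuous (fun x => \sum_(i <- s) F i x).
Proof.
move=> cF; elim: s => [|i s IH] x.
  rewrite (_ : (fun _ => _) = cst 0); first exact: cvg_cst.
  by apply/funext => y; rewrite big_nil.
rewrite (_ : (fun _ => _) = (fun y => F i y + \sum_(i <- s) F i y)).
  by apply: cvgD; [exact: cF|exact: IH].
by apply/funext => y; rewrite big_cons.
Qed.

Lemma closed_trmx : closed [set v : 'rV[R]_m | K v^T].
Proof.
apply: (@preimage_closed _ _ (fun v : 'rV[R]_m => v^T) K) => //.
move=> v _ A /nbhs_ballP[e e0 eA]; apply/nbhs_ballP; exists e => // w [_ vw].
by apply: eA; split => // i j; rewrite !mxE; exact: vw.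
Qed.

Lemma proj_exists u : exists p, K p /\ forall q, K q -> enorm (u - p) <= enorm (u - q).
Proof.
pose f (v : 'rV[R]_m) := dot (u - v^T) (u - v^T).
have fE : f = fun v : 'rV[R]_m => \sum_(k < m) (u k 0 - v 0 k) * (u k 0 - v 0 k).
  by apply/funext => v; apply: eq_bigr => k _; rewrite !mxE.
have cf : continuous f.
  rewrite fE; apply: continuous_sum_seq => k v.
  have cc : {for v, continuous (fun v : 'rV[R]_m => u k 0 - v 0 k)}.
    by apply: continuousB; [exact: cst_continuous|exact: coord_continuous].
  exact: (continuousM cc cc).
(* The squared distance from [u] to the point 0 of [K]: minimisers are sought only among the points
   of [K] that are no farther, which form a compact set. *)
pose c := dot u u.
pose A := [set v : 'rV[R]_m | K v^T] `&` f @^-1` [set x | x <= c].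
have cA : compact A.
  (* From (s - t)^2 <= c follows |s - t| <= 1 + c, a crude bound without square roots. *)
  pose C : set 'rV[R]_m := [set v | forall k, v 0 k \in `[u k 0 - (1 + c), u k 0 + (1 + c)] ].
  have cC : compact C.
    apply: (@rV_compact R m (fun k => `[u k 0 - (1 + c), u k 0 + (1 + c)]%classic)) => k.
    exact: segment_compact.
  apply: (subclosed_compact _ cC).
    apply: closedI; first exact: closed_trmx.
    by apply: preimage_closed => [v _|]; [exact: cf|exact: closed_le].
  move=> v [_ /= fv] k; rewrite in_itv/=.
  have := le_trans (sqr_coord_le_dot (u - v^T) k) fv; rewrite !mxE.
  move: (u k 0) (v 0 k) => s t h.
  have := sqr_ge0 (s - t - 2^-1); have := sqr_ge0 (s - t + 2^-1).
  by move=> *; apply/andP; split; nra.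
have A0 : A !=set0.
  by exists 0; split; rewrite /= ?trmx0// /f trmx0 subr0.
have [|v] := @EVT_min_rV R m f A A0 cA; first exact: continuous_subspaceT.
rewrite inE => -[Kv fv] vmin; exists v^T; split => // q Kq.
rewrite le_enorm -/(f v); have [qc|cq] := leP (dot (u - q) (u - q)) c.
  have := vmin q^T; rewrite inE /f trmxK; apply.
  by split; rewrite /= ?trmxK// /f trmxK.
by rewrite (le_trans fv)// ltW.
Qed.

Lemma projP u : K (P u) /\ forall q, K q -> enorm (u - P u) <= enorm (u - q).
Proof. exact: (xgetPex 0 (proj_exists u)). Qed.

Lemma proj_var u q : K q -> dot (u - P u) (q - P u) <= 0.
Proof.
have [KP Pmin] := projP u; move=> Kq; rewrite leNgt; apply/negP.
set x := u - P u; set y := q - P u => xy0.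
have yy0 := dot_sq_ge0 y.
(* With X = [dot x y] > 0 and Y = [dot y y], minimality along the segment says 2 X <= l Y. This [l]
   lies in ]0, 1] even when Y = 0, and l Y < X contradicts it. *)
pose l := dot x y / (dot x y + dot y y).
have s0 : 0 < dot x y + dot y y by rewrite ltr_pwDl.
have l0 : 0 < l by rewrite divr_gt0.
have l1 : l <= 1 by rewrite ler_pdivrMr// mul1r lerDl.
have : K (P u + l *: y).
  have := K_convex (Itv01 (ltW l0) l1) (mem_set Kq) (mem_set KP).
  rewrite inE; congr K; rewrite /conv/= /y scalerBr scalerBl scale1r.
  by rewrite addrCA.
move=> /Pmin; rewrite le_enorm -/x opprD addrA -/x.
clearbody x y.
rewrite dotBl !dotBr !dotZl !dotZr (dotC y x) => h.
have {}h : 2 * dot x y <= l * dot y y.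
  by rewrite -(ler_pM2l l0); move: h; set X := dot x y; set Y := dot y y; nra.
have : l * dot y y < dot x y.
  rewrite /l mulrAC ltr_pdivrMr//; move: xy0 yy0; set X := dot x y; set Y := dot y y.
  by move=> *; nra.
by move: h xy0; lra.
Qed.

(** Adding the variational inequalities at [u] and [v] bounds |Pu - Pv|^2 by the scalar product of u
    - v and Pu - Pv; the square of their difference then plays the role of Cauchy-Schwarz. *)
Lemma proj_nonexp u v :
  dot (P u - P v) (P u - P v) <= dot (u - v) (u - v).
Proof.
have h1 := proj_var u (projP v).1.
have h2 := proj_var v (projP u).1.
have h3 := dot_sq_ge0 ((u - v) - (P u - P v)).
move: h1 h2 h3; rewrite !(dotBl, dotBr).
rewrite (dotC v u) (dotC (P u) u) (dotC (P v) u) (dotC (P u) v) (dotC (P v) v) (dotC (P v) (P u)).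
by lra.
Qed.

Lemma proj_dissipative u kappa : K kappa -> dot (u - kappa) (P u - u) <= 0.
Proof.
move=> Kk; have := proj_var u Kk; have := dot_sq_ge0 (u - P u).
rewrite !(dotBl, dotBr).
rewrite (dotC (P u) u) (dotC u kappa) (dotC (P u) kappa).
by lra.
Qed.

(** The point 0 of [K] is a competitor. This makes the relaxation term square integrable. *)
Lemma dist_proj_le u : dot (P u - u) (P u - u) <= dot u u.
Proof.
have := (projP u).2 _ K0; rewrite subr0 le_enorm.
by rewrite -opprB dotNl dotC dotNl opprK.
Qed.

Lemma continuous_proj k : continuous (fun u => P u k 0).
Proof.
move=> u; apply/(@cvgrPdist_lt _ _ _ (nbhs u) _) => e e0.
(* A sum of [m] squares below d^2 is at most m e^2/(m+1)^2 < e^2; the successor also covers m =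
   0. *)
pose d := e / m.+1%:R.
have d0 : 0 < d by rewrite divr_gt0.
apply/nbhs_ballP; exists d => // v [_ uvb] /=.
have uv i : `|u i 0 - v i 0| < d by exact: uvb.
rewrite -(ltr_pXn2r (n := 2))// ?nnegrE ?(ltW e0)//.
rewrite real_normK ?num_real//.
have := sqr_coord_le_dot (P u - P v) k; rewrite !mxE => /le_lt_trans; apply.
apply: (le_lt_trans (proj_nonexp u v)).
rewrite /dot (@le_lt_trans _ _ (\sum_(i < m) d ^+ 2))//.
  apply: ler_sum => i _; rewrite !mxE -expr2 -real_normK ?num_real//.
  by rewrite lerXn2r// ?nnegrE ?(ltW d0)// ltW.
rewrite sumr_const card_ord -mulr_natl /d expr_div_n mulrCA -[ltRHS]mulr1.
rewrite ltr_pM2l ?exprn_gt0// ltr_pdivrMr ?exprn_gt0// mul1r expr2.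
by rewrite -natrM ltr_nat; exact: leq_pmull.
Qed.

End projection.

(** * Measurability of continuous functions of a vector *)

Section measurable_continuous.
Context (R : realType) (m : nat).
Local Notation V := 'cV[R]_m.

(** The sigma-algebra on vectors is generated by the entries, so open sets have to be recovered:
    each is the countable union of the rational boxes that it contains. *)
Lemma open_measurable_cV (A : set V) : open A -> measurable A.
Proof.
move=> oA.
pose B (pq : {ffun 'I_m -> rat * rat}) : set V :=
  \bigcap_(k in [set: 'I_m]) ((fun x : V => x k 0) @^-1` `]ratr (pq k).1, ratr (pq k).2[).
have mB pq : measurable (B pq).
  apply: fin_bigcap_measurable => // k _; rewrite -[X in measurable X]setTI.
  exact: measurable_mx_coord.
rewrite (_ : A = \bigcup_pq if `[< B pq `<=` A >] then B pq else set0).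
  apply: countable_bigcupT_measurable; first exact: countableP.
  by move=> pq; case: ifP.
apply/seteqP; split => [x Ax|x [pq _]]; last by case: ifP => // /asboolP BA /BA.
have /nbhs_ballP[e e0 xeA] : nbhs x A by exact: open_nbhs_nbhs.
have H k : exists pq : rat * rat, x k 0 - e < ratr pq.1 < x k 0 /\ x k 0 < ratr pq.2 < x k 0 + e.
  have /rat_in_itvoo[p /[!inE]/= /itvP hp] : x k 0 - e < x k 0 by rewrite gtrBl.
  have /rat_in_itvoo[q /[!inE]/= /itvP hq] : x k 0 < x k 0 + e by rewrite ltrDl.
  by exists (p, q); rewrite /= !hp !hq.
pose pq := [ffun k => projT1 (cid (H k))].
have Hpq k : x k 0 - e < ratr (pq k).1 < x k 0 /\ x k 0 < ratr (pq k).2 < x k 0 + e.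
  by rewrite ffunE; exact: projT2 (cid (H k)).
exists pq => //; rewrite ifT.
  by move=> k _ /=; rewrite in_itv/=; have [/andP[_ ->] /andP[-> _]] := Hpq k.
apply/asboolP.
  move=> y By; apply: xeA; split => // k j; rewrite ord1.
  have := By k I; rewrite /= in_itv/= => /andP[h1 h2].
  have [/andP[h3 _] /andP[_ h4]] := Hpq k.
  by rewrite /ball/= ltr_distlC; apply/andP; split; lra.
Qed.

Lemma continuous_measurable_cV (f : V -> R) : continuous f ->
  measurable_fun setT f.
Proof.
move=> cf; apply: (measurability (RGenOInfty.G (R := R))).
  exact: RGenOInfty.measurableE.
move=> _ [_ [x ->] <-]; rewrite setTI; apply: open_measurable_cV.
by move/continuousP : cf; apply; exact: interval_open.
Qed.

Lemma measurable_cV d (T : measurableType d) (D : set T) (f : T -> V) :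
  (forall k, measurable_fun D (fun x => f x k 0)) -> measurable_fun D f.
Proof.
move=> mf mD; apply: (@measurability _ _ _ _ D f (@mx_coord_sets _ R m 1)) => //.
move=> _ [_ [i [j [C [mC ->]]]] <-].
by rewrite ord1; exact: mf.
Qed.

End measurable_continuous.

(** * Divergence formula and traces *)

Section ac_lemmas.
Context (R : realType).
Local Notation lam := (@lebesgue_measure R).
Local Notation RR := (measurableTypeR R).
Implicit Types (a b c e : R) (f F : R -> R).

Lemma derive_support f f' a b :
  (forall x : R, is_derive x 1 f (f' x)) ->
  (forall x, f x != 0 -> a <= x <= b) ->
  forall x, f' x != 0 -> a <= x <= b.
Proof.
move=> ff' fab x; apply: contraNT => xab; apply/eqP.
have [_ <-] := ff' x.
have f0 y : ~~ (a <= y <= b) -> f y = 0.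
  by move=> yab; apply/eqP; apply: contraNT yab => /fab.
rewrite -[RHS](@derive_cst R R^o R^o 0 x 1).
apply: near_eq_derive; move: xab; rewrite negb_and -!ltNge => /orP[xa|bx].
- near=> y; apply: f0; rewrite negb_and -!ltNge; apply/orP; left.
  near: y; exact: lt_nbhsl.
- near=> y; apply: f0; rewrite negb_and -!ltNge; apply/orP; right.
  near: y; exact: lt_nbhsr.
Unshelve. all: by end_near. Qed.

Lemma ac_on_subr a b F f r : ac_on a b F f -> ac_on a b (fun t => F t - r) f.
Proof.
by move=> [fi [c Fc]]; split => //; exists (c - r) => t /Fc ->; rewrite addrAC.
Qed.

Lemma ac_on_sub a b c e F f : a <= c -> c <= e -> e <= b ->
  ac_on a b F f -> ac_on c e F f.
Proof.
move=> ac ce eb [fi [r Fr]]; split; first exact: integrable_itv_sub fi.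
exists (r + prim f a c) => t; rewrite in_itv/= => /andP[ct te].
rewrite Fr; last by rewrite in_itv/= (le_trans ac ct) (le_trans te eb).
rewrite -addrA; congr (_ + _).
have ti : lam.-integrable `]a, t[ (EFin \o f).
  exact: integrable_itv_sub (lexx _) (le_trans te eb) fi.
have ci : lam.-integrable `]a, c[ (EFin \o f).
  exact: integrable_itv_sub (lexx _) (le_trans ce eb) fi.
have [->|nct] := eqVneq c t; first by rewrite prim_a addr0.
have {}ct : c < t by rewrite lt_neqAle nct.
have := @Rintegral_itvB R f (BRight a) (BLeft t) c ti.
rewrite !bnd_simp => /(_ ac ct).
rewrite -(Rintegral_itv_bndo_bndc ci) -/(prim f a t) -/(prim f a c) -/(prim f c t) => <-.
by rewrite addrC subrK.
Qed.

Lemma ac_right_lim a b F f : a < b -> ac_on a b F f -> F t @[t --> b^'-] --> F b.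
Proof.
move=> ab /(ac_continuous (ltW ab)) /(continuous_within_itvP _ ab)[_ _].
exact.
Qed.

Lemma ac_left_lim a b F f : a < b -> ac_on a b F f -> F t @[t --> a^'+] --> F a.
Proof.
move=> ab /(ac_continuous (ltW ab)) /(continuous_within_itvP _ ab)[_ + _].
exact.
Qed.

Lemma ac_right0 a b c F f : a < b -> c < b -> ac_on a b F f ->
  (forall t, c < t < b -> F t = 0) -> F b = 0.
Proof.
move=> ab cb acF F0; have Fl := ac_right_lim ab acF.
have F0l : F t @[t --> b^'-] --> (0 : R).
  apply: cvg_near_cst; near=> t; apply: F0; apply/andP; split.
    near: t; exact: nbhs_left_gt.
  near: t; exact: nbhs_left_lt.
exact: (cvg_unique _ Fl F0l).
Unshelve. all: by end_near. Qed.

Lemma ac_left0 a b c F f : a < b -> a < c -> ac_on a b F f ->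
  (forall t, a < t < c -> F t = 0) -> F a = 0.
Proof.
move=> ab acl acF F0; have Fl := ac_left_lim ab acF.
have F0l : F t @[t --> a^'+] --> (0 : R).
  apply: cvg_near_cst; near=> t; apply: F0; apply/andP; split.
    near: t; exact: nbhs_right_gt.
  near: t; exact: nbhs_right_lt.
exact: (cvg_unique _ Fl F0l).
Unshelve. all: by end_near. Qed.

(** If the two functions differed at one point, they would differ on a ball around it, which has
    positive measure. *)
Lemma ae_eq_continuous a b f F :
  {in `]a, b[, continuous f} -> {in `]a, b[, continuous F} ->
  {ae lam, forall t, t \in `]a, b[ -> f t = F t} ->
  forall t, t \in `]a, b[ -> f t = F t.
Proof.
move=> cf cF [N [mN N0 HN]] t tab; apply/eqP; apply: contrapT => /negP ft.
have cg : {for t, continuous (fun x => f x - F x)}.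
  by apply: continuousB; [exact: cf|exact: cF].
have g0 : 0 < `|f t - F t| by rewrite normr_gt0 subr_eq0.
have : \forall x \near t, N x.
  have h1 : \forall x \near t, x \in `]a, b[.
    by apply: near_in_itvoo.
  have h2 : \forall x \near t, `|f t - F t - (f x - F x)| < `|f t - F t|.
    by move/cvgrPdist_lt : cg; apply.
  near=> x; apply: HN => /= H.
  have xab : x \in `]a, b[ by near: x.
  have : `|f t - F t - (f x - F x)| < `|f t - F t| by near: x.
  by rewrite (H xab) subrr subr0 ltxx.
move=> /nbhs_ballP[e /= e0 He].
have : (lam (ball t e) <= lam N)%E.
  by apply: le_measure => //; rewrite inE//; exact: measurable_ball.
rewrite N0 lebesgue_measure_ball ?(ltW e0)// lee_fin leNgt.
by rewrite pmulrn_lgt0// e0.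
Unshelve. all: by end_near. Qed.

End ac_lemmas.

(** * Integration by parts on a box *)

Section lines.
Context (R : realType) (n : nat) (i : 'I_n.+1).
Local Notation lam := (@lebesgue_measure R).
Local Notation RR := (measurableTypeR R).
Local Notation E := 'rV[R]_n.+1.
Variables (a b : 'I_n.+1 -> R).
Hypothesis abi : a i < b i.
Let a' k := a (lift i k).
Let b' k := b (lift i k).

Lemma weak_partial_zero (O : set E) (f g : E -> R) :
  box a b `<=` O -> (forall z, box a b z -> f z = 0) ->
  (leb R n.+1).-integrable (box a b) (EFin \o g) ->
  weak_partial O i f g ->
  {ae leb R n.+1, forall z, box a b z -> g z = 0}.
Proof.
move=> abO f0 gi fg; apply: bump_box_ae0 => // c d N ac db.
have [th' _ dth] := smooth1_derive (smooth1_bump (c i) (d i) N).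
pose e : R := N.+1%:R^-1.
have e0 : 0 < e by rewrite invr_gt0.
have thab x : bump (c i) (d i) N x != 0 -> a i + e <= x <= b i - e.
  move=> /bump_neq0/andP[h1 h2].
  by rewrite (le_trans _ h1) ?(le_trans h2)// ?lerD2r// lerD2r.
have He x : (bump (c i) (d i) N x != 0) || (th' x != 0) -> a i + e <= x <= b i - e.
  by move=> /orP[/thab//|]; exact: (derive_support dth thab).
have := weak_partial_line_test N abO fg (smooth1_bump _ _ _) dth e0 He
  (fun k => ac (lift i k)) (fun k => db (lift i k)).
rewrite [X in X = _](_ : _ = 0); last first.
  rewrite /Rintegral integral0_eq// => z zab; rewrite f0 ?mul0r//.
move/eqP; rewrite eq_sym oppr_eq0 => /eqP H.
rewrite -[RHS]H; apply: eq_Rintegral => z _; congr (_ * _).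
by rewrite /bump_box (bigD1_ord i).
Qed.

(** [J] collects the end values of the absolutely continuous representatives, since [U], [V] and
    [phi] themselves agree with them only almost everywhere. It is a parameter because it is 0 along
    the space axes and carries the initial datum along the time axis. *)
Lemma line_ibp (U V phi u v w : E -> R) (J : 'rV[R]_n -> R) :
  (leb R n.+1).-integrable (box a b) (EFin \o
    (fun z => (u z * V z + v z * U z) * phi z + w z * (U z * V z))) ->
  measurable_fun (box a' b') J ->
  {ae leb R n, forall y, box a' b' y -> exists FU FV Fphi : R -> R,
    [/\ ac_on (a i) (b i) FU (fun t => u (ins i t y)),
        ac_on (a i) (b i) FV (fun t => v (ins i t y)),
        ac_on (a i) (b i) Fphi (fun t => w (ins i t y)),
        {ae lam, forall t, t \in `]a i, b i[ ->
          [/\ U (ins i t y) = FU t, V (ins i t y) = FV t &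
              phi (ins i t y) = Fphi t]} &
        FU (b i) * FV (b i) * Fphi (b i) - FU (a i) * FV (a i) * Fphi (a i) = J y]} ->
  \int[leb R n.+1]_(z in box a b)
    ((u z * V z + v z * U z) * phi z + w z * (U z * V z)) =
  \int[leb R n]_(y in box a' b') J y.
Proof.
set Psi := (fun z => _ + _) => Pi mJ H.
have mB := measurable_box a b; have mB' := measurable_box a' b'.
have P1i : (leb R n.+1).-integrable setT (EFin \o (Psi \_ (box a b))) :=
  (integrableR_mkcond _ Psi mB).1 Pi.
rewrite Rintegral_mkcond -(Rintegral_slice i P1i).
rewrite (@Rintegral_sub_support _ _ _ _ (box a' b') setT)//; last first.
  move=> y _ ny; rewrite /Rintegral integral0_eq// => t _.
  by rewrite patchE memNset// => /(box_ins i a b)[].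
apply: Rintegral_ae_eq => //.
  by apply: measurable_funTS; exact: measurable_slice_Rint.
apply: aeS (aeI H (ae_integrable_slice i P1i)) => y [Hy Pyi] yab.
have [FU [FV [Fp [acU acV acp ae3 <-]]]] := Hy yab.
have mI : measurable (`]a i, b i[%classic : set RR) by exact: measurable_itv.
have restr : (fun t => (Psi \_ (box a b)) (ins i t y)) =
    (fun t => Psi (ins i t y)) \_ `]a i, b i[.
  apply/funext => t; rewrite !patchE; congr (if _ then _ else _).
  apply/idP/idP => [/set_mem/(box_ins i a b)[h1 _]|]; first by rewrite mem_setE.
  by rewrite mem_setE => h1; apply/mem_set/(box_ins i a b).
rewrite restr -Rintegral_mkcond.
have Psi_i : lam.-integrable `]a i, b i[ (EFin \o (fun t => Psi (ins i t y))).
  by apply: (integrableR_mkcond lam _ mI).2; rewrite -restr.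
have acUVp := ac_mul (ltW abi) (ac_mul (ltW abi) acU acV) acp.
rewrite -(ac_int (ltW abi) acUVp).
apply: (@Rintegral_ae_eq _ RR R lam) => //.
- exact: measurable_of_integrable_itv Psi_i.
- exact: measurable_of_integrable_itv acUVp.1.
- apply: aeS ae3 => t Ht tab; have [hU hV hp] := Ht tab.
  by rewrite /Psi hU hV hp.
Qed.

End lines.

Section vanishing_integrals.
Local Open Scope ereal_scope.
Context d (T : measurableType d) (R : realType) (mu : {measure set T -> \bar R}).

(* By Fatou the lower limit of the [G j] vanishes almost everywhere. *)
Lemma ae_not_bounded_below (G : nat -> T -> \bar R) :
  (forall j, measurable_fun setT (G j)) -> (forall j x, 0 <= G j x) ->
  (forall e : R, (0 < e)%R -> exists J, forall j, (J <= j)%N -> \int[mu]_x G j x <= e%:E) ->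
  {ae mu, forall x, forall e : R, (0 < e)%R ->
    ~ exists J, forall j, (J <= j)%N -> e%:E <= G j x}.
Proof.
move=> mG G0 Ge.
have limE u : limn_einf u = ereal_sup (range (einfs u)) :> \bar R.
  by rewrite limn_einf_lim; apply/cvg_lim => //; exact: cvg_einfs_sup.
have L0 x : 0 <= limn_einf (G ^~ x).
  rewrite limE; apply: le_trans (_ : einfs (G ^~ x) 0%N <= _).
    by apply: le_ereal_inf_tmp => _ [k _ <-].
  by apply: ereal_sup_ubound; exists 0%N.
have mL : measurable_fun setT (fun x => limn_einf (G ^~ x)).
  rewrite (_ : (fun x => _) = -%E \o (fun x => limn_esup (fun j => - G j x))).
    apply: measurableT_comp => //; apply: measurable_fun_limn_esup => j.
    exact: measurableT_comp.
  apply/funext => x /=; rewrite -[LHS]oppeK; congr (- _).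
  by rewrite -limn_esupN.
have : \int[mu]_x `|limn_einf (G ^~ x)| = 0.
  under eq_integral => x _ do rewrite gee0_abs//.
  apply/eqP; rewrite eq_le integral_ge0 ?andbT//.
  apply: (le_trans (@fatou _ _ _ mu setT measurableT G mG (fun n x _ => G0 n x))).
  rewrite limE; apply: ge_ereal_sup => _ [n _ <-].
  apply/lee_addgt0Pr => e e0; rewrite add0e.
  have [J HJ] := Ge e e0.
  apply: le_trans (HJ (maxn n J) (leq_maxr _ _)).
  by apply: ereal_inf_lbound; exists (maxn n J) => //=; exact: leq_maxl.
move/(ae_eq_integral_abs mu measurableT mL); apply: aeS => x /(_ I) Lx e e0 [J HJ].
have : e%:E <= limn_einf (G ^~ x).
  rewrite limE; apply: le_trans (_ : einfs (G ^~ x) J <= _).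
    by apply: le_ereal_inf_tmp => _ [k Jk <-]; exact: HJ.
  by apply: ereal_sup_ubound; exists J.
by rewrite Lx leNgt lte_fin e0.
Qed.

End vanishing_integrals.

(** * The initial value on almost every line *)

Section initial_trace.
Context (R : realType) (n m : nat).
Local Notation lam := (@lebesgue_measure R).
Local Notation RR := (measurableTypeR R).
Local Notation E := 'rV[R]_n.+1.
Variables (T : R) (W : E -> 'cV[R]_m) (W0 : 'rV[R]_n -> 'cV[R]_m).
Hypothesis T0 : 0 < T.

Lemma measurable_slab (S : R) : measurable (@slab R n S).
Proof.
rewrite (_ : slab _ = (fun z : E => z ord0 ord0) @^-1` `]0, S[).
  by rewrite -[X in measurable X]setTI; exact: measurable_mx_coord.
by apply/seteqP; split => z /=; rewrite in_itv.
Qed.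

Hypothesis mW : forall k, measurable_fun (slab T) (fun z => W z k 0).
Hypothesis mW0 : forall k, measurable_fun setT (fun x => W0 x k 0).
Hypothesis iv : initial_value T W W0.

(* The averages over ]0, T/(j+2)[ of |W - W0|^2 along the lines tend to 0 in L^1,
   while they stay bounded below on a line whose trace at 0 is not W0. *)
Lemma initial_slices : {ae leb R n, forall y, forall k (F : R -> R),
  F t @[t --> 0^'+] --> F 0 ->
  {ae lam, forall t, t \in `]0, T[ -> W (ins ord0 t y) k 0 = F t} ->
  F 0 = W0 y k 0}.
Proof.
suff H k : {ae leb R n, forall y, forall F : R -> R,
    F t @[t --> 0^'+] --> F 0 ->
    {ae lam, forall t, t \in `]0, T[ -> W (ins ord0 t y) k 0 = F t} ->
    F 0 = W0 y k 0}.
  by have := ae_all H; exact: aeS.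
have [w [L2w cw aew aew0]] := iv.
(* The shift by 2 keeps every [dl j] strictly below [T], so that these intervals lie inside the
   slab. *)
pose dl (j : nat) : R := T / j.+2%:R.
have dl0 j : 0 < dl j by rewrite divr_gt0.
have dlT j : dl j < T.
  by rewrite /dl ltr_pdivrMr// ltr_pMr// ltr1n.
pose q z := (W z k 0 - W0 (del ord0 z) k 0) ^+ 2.
pose f j := q \_ (@slab R n (dl j)).
have f0 j z : 0 <= f j z by rewrite /f patchE; case: ifP => // _; exact: sqr_ge0.
have mq : measurable_fun (slab T) q.
  apply: measurable_funX; apply: measurable_funB; first exact: mW.
  by apply: measurable_funTS; apply: (measurableT_comp (mW0 k)); exact: measurable_del.
have mf j : measurable_fun setT (f j).
  have mqj : measurable_fun (slab (dl j)) q.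
    apply: (measurable_funS (measurable_slab T) _ mq).
    by move=> z /= /andP[z0 zj]; rewrite /slab/= z0 (lt_trans zj).
  exact: ((measurable_restrictT q (measurable_slab _)).1 mqj).
have mfE j : measurable_fun setT (EFin \o f j) by exact/measurable_EFinP.
have fE0 j z : (0 <= (EFin \o f j) z)%E by rewrite lee_fin.
pose G j y := ((dl j)^-1%:E * \int[lam]_t (f j (ins ord0 t y))%:E)%E.
have mG j : measurable_fun setT (G j).
  by apply: measurable_funeM; exact: (@measurable_slice_int R n ord0 (EFin \o f j)).
have G0 j y : (0 <= G j y)%E.
  apply: mule_ge0; first by rewrite lee_fin invr_ge0 ltW.
  by apply: integral_ge0 => t _; rewrite lee_fin.
have fin j t y : f j (ins ord0 t y) = if t \in `]0, dl j[ then q (ins ord0 t y) else 0.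
  rewrite /f patchE (_ : (_ \in _) = (t \in `]0, dl j[))//.
  by rewrite in_itv/=; apply/idP/idP; rewrite inE /slab/= ins_eq.
have sl : forall e : R, 0 < e -> exists J, forall j, (J <= j)%N ->
    (\int[leb R n]_y G j y <= e%:E)%E.
  move=> e e0.
  have T00 : 0 <= (0 : R) <= T by rewrite lexx ltW.
  have := cw 0 T00 => /cvgrPdist_lt /(_ e e0) [r /= r0 Hr].
  have {}Hr t : 0 < t < T -> t < r -> \int[leb R n]_x (enorm (w t x - w 0 x) ^+ 2) < e.
    move=> /andP[t0 tT] tr.
    have := Hr t; rewrite /ball_/= sub0r normrN gtr0_norm// => /(_ tr).
    rewrite in_itv/= !ltW// => /(_ isT).
    by rewrite sub0r normrN ger0_norm// Rintegral_ge0// => x _; rewrite sqr_ge0.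
  have [J HJ] : exists J : nat, T / r < J%:R.
    by exists (Num.truncn `|T / r|).+1; rewrite (le_lt_trans (ler_norm _))// truncnS_gt.
  exists J => j Jj.
  have djr : dl j < r.
    rewrite /dl ltr_pdivrMr// mulrC -ltr_pdivrMr// (lt_le_trans HJ)// ler_nat.
    by rewrite (leq_trans Jj)// -addn2 leq_addr.
  rewrite ge0_integralZl//; last 3 first.
  - exact: (@measurable_slice_int R n ord0 (EFin \o f j)).
  - by move=> y _; apply: integral_ge0 => t _; rewrite lee_fin.
  - by rewrite lee_fin invr_ge0 ltW.
  (* Tonelli exchanges the average along lines for an average over times of squared L^2 distances on
     slices; each is below [e] for small times, by continuity of [w] at 0. *)
  rewrite -(@tonelli_ins R n ord0 (EFin \o f j))// (@tonelli_ins' R n ord0 (EFin \o f j))//.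
  rewrite muleC lee_pdivrMr//.
  have <- : (\int[lam]_(t in `]0%R, dl j[) e%:E = e%:E * (dl j)%:E)%E.
    by rewrite integral_cst//= lebesgue_measure_itv/= lte_fin dl0 oppr0 adde0.
  rewrite [leRHS]integral_mkcond.
  apply: ae_ge0_le_integral => //.
  - by move=> t _; apply: integral_ge0 => y _; rewrite lee_fin.
  - apply: (measurable_fun_fubini_tonelli_F ((EFin \o f j) \o @insp R n ord0)) => [|z].
      by apply: measurableT_comp => //; exact: measurable_insp.
    exact: fE0.
  - by move=> t _; rewrite patchE; case: ifP => // _; rewrite lee_fin ltW.
  - apply/(measurable_restrictT _ _).1 => //; exact: measurable_cst.
  apply: aeS aew => t Ht _; rewrite patchE mem_setE.
  case: ifPn => td; last first.
    by rewrite integral0_eq// => y _ /=; rewrite fin (negbTE td).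
  have /andP[t0 tdj] : 0 < t < dl j by move: td; rewrite in_itv.
  have tT : 0 < t < T by rewrite t0 (lt_trans tdj).
  have T0T : 0 <= (0 : R) <= T by rewrite lexx ltW.
  have t0T : 0 <= t <= T by have /andP[? ?] := tT; rewrite !ltW.
  (* The bound on the real integral carries over to the extended one only if the latter is finite,
     since [fine] of an infinite value is 0. *)
  have wi : (leb R n).-integrable setT
      (EFin \o (fun x => enorm (w t x - w 0 x) ^+ 2)).
    have mwl s l : 0 <= s <= T -> measurable_fun setT (fun x => w s x l 0).
      by move=> /L2w /(_ l)[].
    apply: (@integrable_dominated _ _ _ _ _ _ (fun x =>
      \sum_(l < m) (2 * w t x l 0 ^+ 2 + 2 * w 0 x l 0 ^+ 2))) => //.
    - rewrite (_ : (fun x => _) = (fun x => \sum_(l < m) (w t x l 0 - w 0 x l 0) ^+ 2)).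
        apply: measurable_sum => l; apply: measurable_funX.
        by apply: measurable_funB; exact: mwl.
      apply/funext => x; rewrite enorm_sq; apply: eq_bigr => l _.
      by rewrite !mxE expr2.
    - apply: integrableR_sum => // l; apply: integrableRD => //; apply: integrableRZ => //.
        by have [_] := L2w t t0T l.
      by have [_] := L2w 0 T0T l.
    - move=> x _; rewrite ger0_norm ?sqr_ge0// enorm_sq; apply: ler_sum => l _.
      rewrite !mxE; move: (w t x l 0) (w 0 x l 0) => a b.
      by have := sqr_ge0 (a + b); rewrite -!expr2; nra.
  have wE : (\int[leb R n]_y (enorm (w t y - w 0 y) ^+ 2)%:E <= e%:E)%E.
    rewrite -[leLHS]fineK; last by exact: (integrable_fin_num _ wi).
    by rewrite lee_fin ltW// Hr// (lt_trans tdj).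
  apply: le_trans wE; apply: ae_ge0_le_integral => //.
  - apply/measurable_EFinP; apply: (measurableT_comp (mf j)).
    exact: measurable_insl.
  - by move=> y _; rewrite lee_fin sqr_ge0.
  - by have := measurable_int _ wi.
  apply: aeS (aeI (Ht tT) aew0) => y [Wy W0y] _ /=.
  rewrite lee_fin fin td /q insK Wy -W0y enorm_sq.
  have := sqr_coord_le_dot (w t y - w 0 y) k; by rewrite !mxE.
apply: aeS (ae_not_bounded_below mG G0 sl) => y Hy F Fl FW.
apply/eqP; apply: contrapT => /negP FW0.
(* Half the gap: near time 0 the slice stays at distance [g] from [W0 y k 0], so the averages
   [G j y] are eventually at least [g ^+ 2]. *)
pose g := `|F 0 - W0 y k 0| / 2.
have g0 : 0 < g by rewrite divr_gt0// normr_gt0 subr_eq0.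
apply: (Hy (g ^+ 2)); first by rewrite exprn_gt0.
have [r r0 Hr] : exists2 r, 0 < r & forall t, 0 < t < r -> g <= `|F t - W0 y k 0|.
  have /cvgrPdist_lt /(_ g g0)[r /= r0 Hr] := Fl.
  exists r => // t /andP[t0 tr].
  have := Hr t; rewrite /ball_/= sub0r normrN gtr0_norm// => /(_ tr t0) h.
  have := ler_distD (F t) (F 0) (W0 y k 0); rewrite -[X in X <= _](@mulfVK _ 2)//.
  by rewrite -/g; move: h; lra.
have [J HJ] : exists J : nat, T / r < J%:R.
  by exists (Num.truncn `|T / r|).+1; rewrite (le_lt_trans (ler_norm _))// truncnS_gt.
exists J => j Jj.
have djr : dl j < r.
  rewrite /dl ltr_pdivrMr// mulrC -ltr_pdivrMr// (lt_le_trans HJ)// ler_nat.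
  by rewrite (leq_trans Jj)// -addn2 leq_addr.
rewrite /G muleC lee_pdivlMr//.
have <- : (\int[lam]_(t in `]0%R, dl j[) (g ^+ 2)%:E = (g ^+ 2)%:E * (dl j)%:E)%E.
  by rewrite integral_cst//= lebesgue_measure_itv/= lte_fin dl0 oppr0 adde0.
rewrite [leLHS]integral_mkcond.
apply: ae_ge0_le_integral => //.
- by move=> t _; rewrite patchE; case: ifP => // _; rewrite lee_fin sqr_ge0.
- apply/(measurable_restrictT _ _).1 => //; exact: measurable_cst.
- by move=> t _; rewrite lee_fin.
- apply/measurable_EFinP; apply: (measurableT_comp (mf j)); exact: measurable_insr.
apply: aeS FW => t Ft _; rewrite patchE mem_setE fin; case: ifPn => // td.
have /andP[t0 tdj] : 0 < t < dl j by move: td; rewrite in_itv.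
rewrite lee_fin /q insK Ft; last by rewrite in_itv/= t0 (lt_trans tdj).
rewrite -[leRHS]real_normK ?num_real// lerXn2r ?nnegrE ?(ltW g0)//.
by rewrite Hr// t0 (lt_trans tdj).
Qed.

End initial_trace.

(** * Square integrable functions *)

Section square_integrable.
Context d (T : measurableType d) (R : realType).
Variable mu : {measure set T -> \bar R}.
Implicit Types (D : set T) (f g h : T -> R).

Lemma integrable_ae_dominated D f g : measurable D -> measurable_fun D f ->
  mu.-integrable D (EFin \o g) -> {ae mu, forall x, D x -> `|f x| <= g x} ->
  mu.-integrable D (EFin \o f).
Proof.
move=> mD mf gi fg; have mg := integrable_measurable mD gi.
apply/integrableP; split; first exact/measurable_EFinP.
move/integrableP : gi => [_]; apply: le_lt_trans.
apply: ae_ge0_le_integral => //.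
- by apply/measurable_EFinP; exact: measurableT_comp.
- by apply/measurable_EFinP; exact: measurableT_comp.
- apply: aeS fg => x fg Dx; rewrite lee_fin.
  by rewrite (le_trans (fg Dx))// ler_norm.
Qed.

Lemma integrable_mulr_ae_bounded D f h M : measurable D ->
  mu.-integrable D (EFin \o f) -> measurable_fun D h ->
  {ae mu, forall x, D x -> `|h x| <= M} ->
  mu.-integrable D (EFin \o (fun x => f x * h x)).
Proof.
move=> mD fi mh hM; have mf := integrable_measurable mD fi.
apply: (@integrable_ae_dominated D _ (fun x => M * `|f x|)) => //.
- exact: measurable_funM.
- exact: (integrableZl mD M (integrable_norm fi)).
- by apply: aeS hM => x hM Dx; rewrite normrM mulrC ler_wpM2r// hM.
Qed.

Lemma integrable_cstR D (c : R) : measurable D -> (mu D < +oo)%E ->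
  mu.-integrable D (EFin \o (fun=> c)).
Proof.
move=> mD muD; apply/integrableP; split; first exact: measurable_cst.
by rewrite (@integral_cst _ _ _ mu D mD `|c|%:E) lte_mul_pinfty.
Qed.

Lemma integrable_ae_bounded D f M : measurable D -> (mu D < +oo)%E ->
  measurable_fun D f -> {ae mu, forall x, D x -> `|f x| <= M} ->
  mu.-integrable D (EFin \o f).
Proof.
move=> mD muD mf fM; apply: (@integrable_ae_dominated D _ (fun=> M)) => //.
exact: integrable_cstR.
Qed.

(** For the measure [leb R d] this is convertible to [L2]. *)
Definition sq_integrable D f :=
  measurable_fun D f /\ mu.-integrable D (EFin \o (fun x => f x ^+ 2)).

Lemma sq_integrableS D E f : measurable D -> measurable E -> D `<=` E ->
  sq_integrable E f -> sq_integrable D f.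
Proof.
move=> mD mE DE [mf fi]; split; first exact: measurable_funS mf.
exact: integrableS fi.
Qed.

Lemma sq_integrable_mul D f g : measurable D ->
  sq_integrable D f -> sq_integrable D g ->
  mu.-integrable D (EFin \o (fun x => f x * g x)).
Proof.
move=> mD [mf fi] [mg gi].
apply: (@integrable_dominated _ _ _ mu D _ (fun x => f x ^+ 2 + g x ^+ 2)) => //.
- exact: measurable_funM.
- exact: integrableRD.
- move=> x _; rewrite normrM -(real_normK (num_real (f x))) -(real_normK (num_real (g x))).
  move: `|f x| `|g x| => p q.
  by have := sqr_ge0 (p + q); have := sqr_ge0 (p - q); rewrite !expr2; nra.
Qed.

Lemma sq_integrable_cst D (c : R) : measurable D -> (mu D < +oo)%E ->
  sq_integrable D (fun=> c).
Proof.
move=> mD muD; split; first exact: measurable_cst.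
exact: integrable_cstR.
Qed.

Lemma sq_integrableB D f g : measurable D ->
  sq_integrable D f -> sq_integrable D g -> sq_integrable D (fun x => f x - g x).
Proof.
move=> mD fi gi; have [mf f2] := fi; have [mg g2] := gi.
split; first exact: measurable_funB.
have H := integrableRB mD (integrableRD mD f2 g2)
  (integrableRZ 2 mD (sq_integrable_mul mD fi gi)).
rewrite (_ : (fun x => _ ^+ 2) = fun x => f x ^+ 2 + g x ^+ 2 - 2 * (f x * g x))//.
by apply/funext => x; ring.
Qed.

Lemma sq_integrable_integrable D f : measurable D -> (mu D < +oo)%E ->
  sq_integrable D f -> mu.-integrable D (EFin \o f).
Proof.
move=> mD muD fi.
have := sq_integrable_mul mD fi (sq_integrable_cst 1 mD muD).
by rewrite (_ : (fun x => f x * 1) = f)//; apply/funext => x; rewrite mulr1.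
Qed.

End square_integrable.

Section vector_tests.
Context (R : realType) (d : nat).
Local Notation E := 'rV[R]_d.

Lemma smooth_scalel (V W : normedModType R) (f : V -> R) (w : W) :
  smooth f -> smooth (fun z => f z *: w).
Proof.
move=> sf s x.
have -> : foldr (fun v g => 'D_v g) (fun z => f z *: w) s =
    (fun z => foldr (fun v g => 'D_v g) f s z *: w).
  elim: s => //= v s ->; apply/funext => z.
  rewrite deriveE; last by apply: differentiableZl; exact: sf.
  by rewrite diffZl//= deriveE.
by apply: differentiableZl; exact: sf.
Qed.

Lemma test_function_scalel (V W : normedModType R) (O : set V) (f : V -> R) (w : W) :
  w != 0 -> test_function O f -> test_function O (fun z => f z *: w).
Proof.
move=> w0 [sf cf fO].
have E0 : [set x | f x *: w != 0] = [set x | f x != 0].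
  by apply/seteqP; split => x /=; rewrite scaler_eq0 (negbTE w0) orbF.
by split; rewrite ?E0//; exact: smooth_scalel.
Qed.

Lemma test_function_bump_box (c e : 'I_d -> R) N : test_function setT (bump_box c e N).
Proof.
apply: (@test_function_prod R d (fun k => bump (c k) (e k) N)
  (fun k => c k + N.+1%:R^-1) (fun k => e k - N.+1%:R^-1)) => //.
- by move=> k; exact: smooth1_bump.
- by move=> k x; exact: bump_neq0.
Qed.

Lemma bump_box_neq0 (a b c e : 'I_d -> R) N x : (forall k, a k <= c k) ->
  (forall k, e k <= b k) -> bump_box c e N x != 0 -> box a b x.
Proof.
move=> ac eb; rewrite /bump_box prodf_seq_neq0 => /allP H k.
have e0 : 0 < N.+1%:R^-1 :> R by rewrite invr_gt0.
have /bump_neq0/andP[h1 h2] : bump (c k) (e k) N (x 0 k) != 0.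
  by apply: (H k); exact: mem_index_enum.
have := ac k; have := eb k; move: h1 h2 e0.
by move: N.+1%:R^-1 => r; lra.
Qed.

End vector_tests.

Section compact_below.
Context (R : realType) (n : nat) (T : R).

Lemma compact_below_margin (C : set 'rV[R]_n.+1) : compact C -> C `<=` @below R n T ->
  exists M e : R, [/\ 0 < M, 0 < e &
    forall z, C z -> (forall k, `|z 0 k| <= M) /\ z 0 0 <= T - e].
Proof.
move=> cC CT.
have [M M0 CM] : exists2 M : R, 0 < M & forall z, C z -> forall k, `|z 0 k| <= M.
  have /ex_strict_bound_gt0[M M0 HM] := compact_bounded cC.
  exists M => // z Cz k; have := ltW (HM z Cz); apply: le_trans.
  by rewrite [leRHS]mx_normrE; apply: (le_bigmax _ (fun i => `|z i.1 i.2|) (0, k)).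
have [C0|/set0P C0] := eqVneq C set0.
  by exists M, 1; split => // z; rewrite C0.
have cc : {within C, continuous (fun z : 'rV[R]_n.+1 => z 0 0)}.
  by apply: continuous_subspaceT; exact: coord_continuous.
have [z0 z0C Hz0] := EVT_max_rV C0 cC cc.
exists M, (T - z0 0 0); split => //.
  by rewrite subr_gt0; apply: CT; rewrite inE in z0C.
by move=> z Cz; split; [exact: CM|rewrite subKr; apply: Hz0; rewrite inE].
Qed.

End compact_below.

(** * The entropy inequality *)

(* The cylinder ]0,T[ x ]-L,L[^n is [box (cyl_lo L) (cyl_hi T L)]. *)
Definition cyl_lo (R : realType) (n : nat) (L : R) (k : 'I_n.+1) : R :=
  if k == ord0 then 0 else - L.
Definition cyl_hi (R : realType) (n : nat) (T L : R) (k : 'I_n.+1) : R :=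
  if k == ord0 then T else L.

(** * Slices and support of the test function *)

Section entropy_test_slices.
Context (R : realType) (n : nat).
Local Notation lam := (@lebesgue_measure R).
Local Notation RR := (measurableTypeR R).
Local Notation E := 'rV[R]_n.+1.
Variables (T L r : R).
Hypotheses (T0 : 0 < T) (L2_lt : 2 < L) (r0 : 0 < r).
Variables (phi : E -> R) (Dphi : 'I_n.+1 -> E -> R).
Hypothesis phi_W : W1oo (below T) phi Dphi.
Hypothesis phi_cont : {within below T, continuous phi}.
Hypothesis phi_supp : forall z, below T z -> phi z != 0 ->
  (forall k, `|z 0 k| <= L - 2) /\ z 0 0 <= T - r.

Local Notation lo := (@cyl_lo R n L).
Local Notation hi := (@cyl_hi R n T L).
Local Notation Q := (box lo hi).

Lemma box_below a b : b ord0 <= T -> box a b `<=` @below R n T.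
Proof. by move=> b0 z /(_ ord0)/andP[_ zb]; exact: lt_le_trans b0. Qed.

Lemma box_slab : Q `<=` slab T.
Proof. by move=> z /(_ ord0). Qed.

Lemma open_below : open (@below R n T).
Proof.
rewrite (_ : @below R n T = (fun z : E => z ord0 ord0) @^-1` [set x | x < T])//.
apply: open_comp; last exact: open_lt.
by move=> z _; exact: coord_continuous.
Qed.

Lemma measurable_below : measurable (@below R n T).
Proof.
rewrite (_ : @below R n T = (fun z : E => z ord0 ord0) @^-1` `]-oo, T[).
  by rewrite -[X in measurable X]setTI; exact: measurable_mx_coord.
by apply/seteqP; split => z /=; rewrite in_itv.
Qed.

Lemma continuous_ins i (y : 'rV[R]_n) : continuous (fun t : R => ins i t y).
Proof.
move=> t A /nbhs_ballP[e e0 eA]; apply/nbhs_ballP; exists e => // s ts.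
apply: eA; split => // k j; rewrite ord1.
case: (unliftP i j) => [l|] ->; first by rewrite !ins_lift; exact: ballxx.
by rewrite !ins_eq.
Qed.

Lemma Loo_integrable a b f : b ord0 <= T -> Loo (below T) f ->
  (leb R n.+1).-integrable (box a b) (EFin \o f).
Proof.
move=> bT [mf [M fM]].
apply: (@integrable_ae_bounded _ _ _ _ _ _ M); first exact: measurable_box.
- exact: leb_box_lty.
- exact: measurable_funS measurable_below (box_below bT) mf.
- by apply: aeS fM => z fM /(box_below bT).
Qed.

(* [phi] is continuous, so its absolutely continuous slices agree with it
   everywhere, in particular at time 0, which is interior to ]-L,T[. *)
Lemma phi_slices i : {ae leb R n, forall y,
  box (fun k => lo (lift i k)) (fun k => hi (lift i k)) y ->
  exists F, [/\ ac_on (lo i) (hi i) F (fun t => Dphi i (ins i t y)),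
    {ae lam, forall t, t \in `]lo i, hi i[ -> phi (ins i t y) = F t} &
    F (hi i) = 0 /\ F (lo i) = if i == ord0 then phi (ins i 0 y) else 0]}.
Proof.
pose lo' (k : 'I_n.+1) : R := - L.
have L0 : 0 < L by rewrite (lt_trans _ L2_lt).
have abi : lo' i < hi i.
  by rewrite /lo' /cyl_hi; case: ifP => _; rewrite ltrNl (lt_trans _ L0)// oppr_lt0.
have hi0 : hi ord0 <= T by rewrite /cyl_hi eqxx.
have := weak_partial_slices abi (box_below hi0) (Loo_integrable lo' hi0 phi_W.1)
  (Loo_integrable lo' hi0 (phi_W.2 i).1) (phi_W.2 i).2.
apply: aeS => y Hy yab.
have y' : box (fun k => lo' (lift i k)) (fun k => hi (lift i k)) y.
  move=> k; have /andP[h1 ->] := yab k; rewrite andbT (le_lt_trans _ h1)//.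
  by rewrite /cyl_lo; case: ifP => _ //; rewrite oppr_le0 ltW.
have [F acF aeF] := Hy y'.
have inb t : t \in `]lo' i, hi i[ -> below T (ins i t y).
  by move=> t'; apply: (@box_below lo' hi) => //; apply/(box_ins i).
have FE t : t \in `]lo' i, hi i[ -> phi (ins i t y) = F t.
  apply: (ae_eq_continuous (f := fun t => phi (ins i t y))) => //.
    move=> s /inb sb; apply: (continuous_comp (f := fun t => ins i t y) (g := phi)).
      exact: continuous_ins.
    by move: phi_cont; rewrite continuous_open_subspace//; [apply; rewrite inE|exact: open_below].
  have := ac_continuous (ltW abi) acF => /(continuous_within_itvP _ abi)[+ _ _].
  by move=> H s /H.
have lolo : lo' i <= lo i by rewrite /lo' /cyl_lo; case: ifP => // _; rewrite oppr_le0 ltW.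
have lohi : lo i < hi i.
  by rewrite /cyl_lo /cyl_hi; case: ifP => // _; rewrite (lt_trans _ L0)// oppr_lt0.
exists F; split.
- exact: ac_on_sub (ltW lohi) (lexx _) acF.
- by apply: aeW => t /[!in_itv]/= /andP[h1 h2]; apply: FE; rewrite in_itv/= h2 (le_lt_trans _ h1).
have F0 t : t \in `]lo' i, hi i[ ->
    ~ ((forall k, `|ins i t y 0 k| <= L - 2) /\ ins i t y 0 0 <= T - r) -> F t = 0.
  move=> tb nt; rewrite -FE//; apply/eqP; apply: contrapT => /negP.
  by move=> /(phi_supp (inb _ tb)).
have [i0|i0] := eqVneq i ord0.
  subst i; split; last by rewrite FE// in_itv/= /cyl_lo /lo' /cyl_hi eqxx T0 andbT oppr_lt0.
  apply: (@ac_right0 _ _ _ (Num.max (lo' ord0) (T - r)) _ _ abi _ acF).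
    by rewrite gt_max abi /cyl_hi eqxx ltrBlDr ltrDl.
  move=> t /andP[]; rewrite gt_max => /andP[h1 h2] h3; apply: F0; first by rewrite in_itv/= h1 h3.
  by move=> [_]; rewrite ins_eq leNgt h2.
have hiE : hi i = L by rewrite /cyl_hi (negbTE i0).
have loE : lo i = - L by rewrite /cyl_lo (negbTE i0).
split.
  apply: (@ac_right0 _ _ _ (L - 2) _ _ abi _ acF).
    by rewrite hiE ltrBlDr ltrDl.
  move=> t /andP[h1 h2]; apply: F0.
    by rewrite in_itv/= h2 andbT /lo'; move: h1 L2_lt; lra.
  by move=> [/(_ i)]; rewrite ins_eq => h _; have := le_trans (ler_norm _) h; rewrite leNgt h1.
rewrite loE; apply: (@ac_left0 _ _ _ (2 - L) _ _ abi _ acF).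
  by rewrite /lo'; lra.
move=> t /andP[h1 h2]; apply: F0.
  by rewrite in_itv/= h1 hiE; move: h2 L2_lt; lra.
move=> [/(_ i)]; rewrite ins_eq => h _; have := le_trans (ler_norm (- t)) (eq_ind _ (fun x => x <= _) h _ (esym (normrN t))).
by move: h2; lra.
Qed.

(* Off the support of [phi] every point has a neighbourhood among countably
   many boxes on which [phi], hence its weak gradient, vanishes. *)
Lemma Dphi_outside i : {ae leb R n.+1, forall z, slab T z -> ~ Q z -> Dphi i z = 0}.
Proof.
pose bp (p : {ffun 'I_n.+1 -> int}) (k : 'I_n.+1) : R :=
  if k == ord0 then 0 else (p k)%:~R.
pose bq (p : {ffun 'I_n.+1 -> int}) (k : 'I_n.+1) : R :=
  if k == ord0 then T else (p k)%:~R + 2.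
have bq0 p : bq p ord0 <= T by rewrite /bq eqxx.
have H p : {ae leb R n.+1, forall z, (forall x, box (bp p) (bq p) x -> phi x = 0) ->
    box (bp p) (bq p) z -> Dphi i z = 0}.
  have [p0|np0] := pselect (forall x, box (bp p) (bq p) x -> phi x = 0); last first.
    by apply: aeW => z.
  have := weak_partial_zero (box_below (bq0 p)) p0
    (Loo_integrable (bp p) (bq0 p) (phi_W.2 i).1) (phi_W.2 i).2.
  by apply: aeS => z Hz _; exact: Hz.
apply: aeS (ae_all H) => z Hz zs nQ.
have [k k0 zk] : exists2 k, k != ord0 & L <= `|z 0 k|.
  apply: contrapT => nk; apply: nQ => k; rewrite /cyl_lo /cyl_hi; case: ifPn => [/eqP ->//|k0].
  by rewrite -ltr_norml ltNge; apply/negP => zk; apply: nk; exists k.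
(* Starting one below the floor, with side 2, the open box contains [z] even at integer coordinates.
   Its points are within 2 of [z] in each space coordinate, hence off the support as soon as |z_k|
   >= L. *)
pose p : {ffun 'I_n.+1 -> int} := [ffun k => Num.floor (z 0 k) - 1].
have zp : box (bp p) (bq p) z.
  move=> l; rewrite /bp /bq; case: ifPn => [/eqP ->//|l0].
  rewrite ffunE intrB mulr1z.
  have /andP[] := floor_itv (z 0 l); rewrite intrD mulr1z.
  by move=> h1 h2; apply/andP; split; lra.
apply: (Hz p) => // x xp; apply/eqP; apply: contrapT => /negP px.
have [/(_ k) xk _] := phi_supp (box_below (bq0 p) xp) px.
have := zp k; have := xp k; rewrite /bp /bq (negbTE k0); move: xk zk.
rewrite ler_norml; case: (lerP 0 (z 0 k)) => z0; rewrite ?(ger0_norm z0) ?(ltr0_norm z0);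
  by move=> /andP[? ?] ? /andP[? ?] /andP[? ?]; lra.
Qed.

End entropy_test_slices.

(** * The divergence formula for quadratic entries *)

Section entropy_identity.
Context (R : realType) (n m : nat).
Local Notation lam := (@lebesgue_measure R).
Local Notation E := 'rV[R]_n.+1.
Variables (T L r : R).
Hypotheses (T0 : 0 < T) (L2_lt : 2 < L) (r0 : 0 < r).
Variables (phi : E -> R) (Dphi : 'I_n.+1 -> E -> R).
Hypothesis phi_W : W1oo (below T) phi Dphi.
Hypothesis phi_cont : {within below T, continuous phi}.
Hypothesis phi_supp : forall z, below T z -> phi z != 0 ->
  (forall k, `|z 0 k| <= L - 2) /\ z 0 0 <= T - r.
Variables (W : E -> 'cV[R]_m) (DW : 'I_n.+1 -> E -> 'cV[R]_m).
Hypothesis W_H1 : H1v (slab T) W DW.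
Variable kappa : 'cV[R]_m.

Local Notation lo := (@cyl_lo R n L).
Local Notation hi := (@cyl_hi R n T L).
Local Notation Q := (box lo hi).
Let mQ : measurable Q := measurable_box lo hi.
Let Qlty : (leb R n.+1 Q < +oo)%E := leb_box_lty lo hi.
Let Qslab : Q `<=` @slab R n T := @box_slab R n T L.
Let hiT : hi ord0 <= T. Proof. by rewrite /cyl_hi eqxx. Qed.

Lemma sq_integrable_sol k : sq_integrable (leb R n.+1) Q (fun z => W z k 0).
Proof. exact: sq_integrableS mQ (@measurable_slab R n T) Qslab (W_H1 k).1. Qed.

Lemma sq_integrable_grad i k : sq_integrable (leb R n.+1) Q (fun z => DW i z k 0).
Proof. exact: sq_integrableS mQ (@measurable_slab R n T) Qslab ((W_H1 k).2 i).1. Qed.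

Lemma sq_integrable_dev k :
  sq_integrable (leb R n.+1) Q (fun z => W z k 0 - kappa k 0).
Proof.
by apply: sq_integrableB => //; [exact: sq_integrable_sol|exact: sq_integrable_cst].
Qed.

Lemma integrable_mul_Loo f g : Loo (below T) g ->
  (leb R n.+1).-integrable Q (EFin \o f) ->
  (leb R n.+1).-integrable Q (EFin \o (fun z => f z * g z)).
Proof.
move=> [mg [M gM]] fi; apply: (@integrable_mulr_ae_bounded _ _ _ _ _ _ _ M) => //.
  exact: measurable_funS (@measurable_below R n T) (box_below hiT) mg.
by apply: aeS gM => z gM /(box_below hiT).
Qed.

(* The [(k, l)] component of the [i]-th partial derivative of
   [(W - kappa) (W - kappa)^T phi]. *)
Definition dquad i k l (z : E) : R :=
  (DW i z k 0 * (W z l 0 - kappa l 0) + DW i z l 0 * (W z k 0 - kappa k 0)) * phi z +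
  Dphi i z * ((W z k 0 - kappa k 0) * (W z l 0 - kappa l 0)).

Lemma integrable_dquad i k l :
  (leb R n.+1).-integrable Q (EFin \o dquad i k l).
Proof.
apply: integrableRD => //.
  apply: integrable_mul_Loo; first exact: phi_W.1.
  apply: integrableRD => //; apply: sq_integrable_mul => //;
    by [exact: sq_integrable_grad|exact: sq_integrable_dev].
rewrite (_ : _ \o _ = EFin \o (fun z =>
    (W z k 0 - kappa k 0) * (W z l 0 - kappa l 0) * Dphi i z)); last first.
  by apply/funext => z /=; rewrite mulrC.
apply: integrable_mul_Loo; first exact: (phi_W.2 i).1.
by apply: sq_integrable_mul => //; exact: sq_integrable_dev.
Qed.

Let lohi i : lo i < hi i.
Proof.
have L0 : 0 < L := lt_trans (ltr0Sn R 1) L2_lt.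
by rewrite /cyl_lo /cyl_hi; case: ifP => // _; rewrite (lt_trans _ L0)// oppr_lt0.
Qed.

Lemma sol_slices i k : {ae leb R n, forall y,
  box (fun k => lo (lift i k)) (fun k => hi (lift i k)) y ->
  exists2 F, ac_on (lo i) (hi i) F (fun t => DW i (ins i t y) k 0) &
    {ae lam, forall t, t \in `]lo i, hi i[ -> W (ins i t y) k 0 = F t}}.
Proof.
apply: (weak_partial_slices (f := fun z => W z k 0) (g := fun z => DW i z k 0)
  (lohi i) Qslab).
- exact: sq_integrable_integrable (sq_integrable_sol k).
- exact: sq_integrable_integrable (sq_integrable_grad i k).
- exact: ((W_H1 k).2 i).2.
Qed.

Lemma Rintegral_dquad_space j k l :
  \int[leb R n.+1]_(z in Q) dquad (lift ord0 j) k l z = 0.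
Proof.
set i := lift ord0 j.
rewrite (@line_ibp R n i lo hi (lohi i) (fun z => W z k 0 - kappa k 0)
  (fun z => W z l 0 - kappa l 0) phi (fun z => DW i z k 0) (fun z => DW i z l 0)
  (Dphi i) (fun=> 0)).
- by rewrite /Rintegral integral0_eq.
- exact: integrable_dquad.
- exact: measurable_cst.
have := phi_slices T0 L2_lt r0 phi_W phi_cont phi_supp i.
move=> /(aeI (aeI (sol_slices i k) (sol_slices i l))).
apply: aeS => y [[Hk Hl] Hp] yQ.
have [FU acU aeU] := Hk yQ; have [FV acV aeV] := Hl yQ.
have [Fp [acp aep [p1 p0]]] := Hp yQ.
exists (fun t => FU t - kappa k 0), (fun t => FV t - kappa l 0), Fp; split => //.
- exact: ac_on_subr.
- exact: ac_on_subr.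
- apply: aeS (aeI (aeI aeU aeV) aep) => t [[hU hV] hp] tQ.
  by rewrite hU// hV// hp.
- by rewrite p1 p0 !mulr0 subrr.
Qed.

Lemma measurable_trace : measurable_fun setT (fun y : 'rV[R]_n => phi (cons_rV 0 y)).
Proof.
apply: (measurable_comp (F := @below R n T)).
- exact: measurable_below.
- by move=> _ [y _ <-]; rewrite /below/= cons_rV0.
- exact: phi_W.1.1.
- exact: (measurable_insl ord0).
Qed.

Variable W0 : 'rV[R]_n -> 'cV[R]_m.
Hypothesis mW0 : forall k, measurable_fun setT (fun x => W0 x k 0).
Hypothesis W_init : initial_value T W W0.

(** The slice of [phi] vanishes at [T], so only the lower end of each line contributes; hence the
    sign. *)
Lemma Rintegral_dquad_time k :
  \int[leb R n.+1]_(z in Q) dquad ord0 k k z =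
  \int[leb R n]_(y in box (fun=> - L) (fun=> L))
    - ((W0 y k 0 - kappa k 0) ^+ 2 * phi (cons_rV 0 y)).
Proof.
set i := ord0.
rewrite (@line_ibp R n i lo hi (lohi i) (fun z => W z k 0 - kappa k 0)
  (fun z => W z k 0 - kappa k 0) phi (fun z => DW i z k 0) (fun z => DW i z k 0)
  (Dphi i) (fun y => - ((W0 y k 0 - kappa k 0) ^+ 2 * phi (ins i 0 y)))).
- by [].
- exact: integrable_dquad.
- apply: measurable_funTS; apply: measurableT_comp => //; apply: measurable_funM.
    by apply: measurable_funX; apply: measurable_funB.
  exact: measurable_trace.
have mW l : measurable_fun (slab T) (fun z => W z l 0) by have [[]] := W_H1 l.
have := phi_slices T0 L2_lt r0 phi_W phi_cont phi_supp i.
move=> /(aeI (aeI (sol_slices i k) (initial_slices T0 mW mW0 W_init))).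
apply: aeS => y [[Hk H0] Hp] yQ.
have [FU acU aeU] := Hk yQ.
have [Fp [acp aep [p1 p0]]] := Hp yQ.
exists (fun t => FU t - kappa k 0), (fun t => FU t - kappa k 0), Fp; split => //.
- exact: ac_on_subr.
- exact: ac_on_subr.
- by apply: aeS (aeI aeU aep) => t [hU hp] tQ; rewrite hU// hp.
- have F0 : FU (lo i) = W0 y k 0 by apply: (H0 k FU) => //; exact: ac_left_lim (lohi i) acU.
  by rewrite p1 p0 F0 eqxx !mulr0 sub0r expr2.
Qed.

End entropy_identity.

Section quadratic_forms.
Context (R : realType) (m : nat).
Implicit Types (u v : 'cV[R]_m) (A : 'M[R]_m).

Lemma dot_delta u k : dot u (delta_mx k 0) = u k 0.
Proof.
rewrite /dot (bigD1 k)//= mxE !eqxx mulr1 big1 ?addr0// => l lk.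
by rewrite mxE (negbTE lk) mulr0.
Qed.

Lemma delta_cV_neq0 k : delta_mx k 0 != 0 :> 'cV[R]_m.
Proof.
by apply/eqP => /matrixP /(_ k 0); rewrite !mxE !eqxx => /eqP; rewrite oner_eq0.
Qed.

Lemma dot_mulmx u v A : dot u (A *m v) = \sum_k \sum_l A k l * (u k 0 * v l 0).
Proof.
apply: eq_bigr => k _; rewrite mxE mulr_sumr; apply: eq_bigr => l _.
by rewrite mulrCA mulrA.
Qed.

Lemma dot_mulmx_sym u v A : A^T = A -> dot u (A *m v) = dot v (A *m u).
Proof.
move=> AT; rewrite !dot_mulmx exchange_big; apply: eq_bigr => k _.
by apply: eq_bigr => l _; rewrite -[in LHS]AT mxE (mulrC (u _ _)).
Qed.

Lemma dotr_sum I (s : seq I) (F : I -> 'cV[R]_m) u :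
  dot u (\sum_(i <- s) F i) = \sum_(i <- s) dot u (F i).
Proof.
elim: s => [|i s IH]; last by rewrite !big_cons dotDr IH.
by rewrite !big_nil /dot big1// => k _; rewrite mxE mulr0.
Qed.

End quadratic_forms.

(** * Contraction of the entries and dissipation *)

Section entropy_inequality.
Context (R : realType) (n m : nat).
Local Notation lam := (@lebesgue_measure R).
Local Notation E := 'rV[R]_n.+1.
Variables (T L r eps : R) (K : set 'cV[R]_m) (B : 'I_n -> 'M[R]_m).
Hypotheses (T0 : 0 < T) (L2_lt : 2 < L) (r0 : 0 < r) (eps0 : 0 < eps).
Hypotheses (K_closed : closed K) (K_convex : convex_set K) (K0 : K 0).
Hypothesis B_sym : forall j, (B j)^T = B j.
Variables (phi : E -> R) (Dphi : 'I_n.+1 -> E -> R).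
Hypothesis phi_W : W1oo (below T) phi Dphi.
Hypothesis phi_cont : {within below T, continuous phi}.
Hypothesis phi_ge0 : forall z, below T z -> 0 <= phi z.
Hypothesis phi_supp : forall z, below T z -> phi z != 0 ->
  (forall k, `|z 0 k| <= L - 2) /\ z 0 0 <= T - r.
(** A pointwise bound: the essential bound in [Loo] says nothing on the null set t = 0, where the
    trace term lives. Continuity and compact support supply it. *)
Hypothesis phi_bounded : exists M, forall z, below T z -> `|phi z| <= M.
Variables (W : E -> 'cV[R]_m) (DW : 'I_n.+1 -> E -> 'cV[R]_m).
Hypothesis W_H1 : H1v (slab T) W DW.
Hypothesis W_pde : forall psi : E -> 'cV[R]_m, test_function setT psi ->
  \int[leb R n.+1]_(z in slab T)
    dot (DW ord0 z + \sum_(j < n) B j *m DW (lift ord0 j) z) (psi z) =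
  \int[leb R n.+1]_(z in slab T)
    dot (eps^-1 *: (euclid_proj K (W z) - W z)) (psi z).
Variable W0 : 'rV[R]_n -> 'cV[R]_m.
Hypothesis W0_L2 : L2v setT W0.
Hypothesis W_init : initial_value T W W0.
Variable kappa : 'cV[R]_m.
Hypothesis kappa_K : K kappa.

Local Notation P := (euclid_proj K).
Local Notation lo := (@cyl_lo R n L).
Local Notation hi := (@cyl_hi R n T L).
Local Notation Q := (box lo hi).
Local Notation Q' := (box (fun=> - L) (fun=> L) : set 'rV[R]_n).
Let mQ : measurable Q := measurable_box lo hi.
Let Qlty : (leb R n.+1 Q < +oo)%E := leb_box_lty lo hi.
Let Qslab : Q `<=` @slab R n T := @box_slab R n T L.
Let Wi := sq_integrable_sol L W_H1.
Let DWi := sq_integrable_grad L W_H1.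
Let Ui := sq_integrable_dev L W_H1 kappa.
Let mW k : measurable_fun (slab T) (fun z => W z k 0) := (W_H1 k).1.1.

Local Notation grad z := (DW ord0 z + \sum_(j < n) B j *m DW (lift ord0 j) z).

Lemma sq_integrable_relax k :
  sq_integrable (leb R n.+1) Q (fun z => (P (W z) - W z) k 0).
Proof.
have mQW : measurable_fun Q W by apply: measurable_cV => l; exact: (Wi l).1.
have mP : measurable_fun Q (fun z => (P (W z) - W z) k 0).
  rewrite (_ : (fun z => _) = fun z => P (W z) k 0 - W z k 0); last first.
    by apply/funext => z; rewrite !mxE.
  apply: measurable_funB; last exact: (Wi k).1.
  apply: (measurableT_comp (f := fun u => P u k 0)) => //.
  by apply: continuous_measurable_cV; exact: continuous_proj.
split => //.
apply: (@integrable_dominated _ _ _ _ _ _ (fun z => \sum_(l < m) W z l 0 ^+ 2)) => //.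
- exact: measurable_funX.
- by apply: integrableR_sum => // l; exact: (Wi l).2.
- move=> z _; rewrite ger0_norm ?sqr_ge0//.
  apply: le_trans (sqr_coord_le_dot _ _) _.
  exact: dist_proj_le.
Qed.

Lemma integrable_grad k : (leb R n.+1).-integrable Q (EFin \o (fun z => grad z k 0)).
Proof.
rewrite (_ : (fun z => _) = fun z => DW ord0 z k 0 +
    \sum_(j < n) \sum_(l < m) B j k l * DW (lift ord0 j) z l 0); last first.
  by apply/funext => z; rewrite mxE summxE; congr (_ + _);
    apply: eq_bigr => j _; rewrite mxE.
apply: integrableRD => //; first exact: sq_integrable_integrable (DWi _ _).
apply: integrableR_sum => // j; apply: integrableR_sum => // l.
by apply: integrableRZ => //; exact: sq_integrable_integrable (DWi _ _).
Qed.

(** The weak equation is tested entry by entry, with a bump times a basis vector. Bumps supported in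
    [Q] reduce both sides to integrals over [Q], where the terms are integrable. *)
Lemma pde_ae : {ae leb R n.+1, forall z, Q z ->
  grad z = eps^-1 *: (P (W z) - W z)}.
Proof.
suff H k : {ae leb R n.+1, forall z, Q z ->
    grad z k 0 - (eps^-1 *: (P (W z) - W z)) k 0 = 0}.
  apply: aeS (ae_all H) => z Hz Qz; apply/matrixP => k j.
  by rewrite ord1; apply/eqP; rewrite -subr_eq0 Hz.
have ri : (leb R n.+1).-integrable Q
    (EFin \o (fun z => (eps^-1 *: (P (W z) - W z)) k 0)).
  rewrite (_ : (fun z => _) = fun z => eps^-1 * (P (W z) - W z) k 0); last first.
    by apply/funext => z; rewrite mxE.
  by apply: integrableRZ => //; exact: sq_integrable_integrable (sq_integrable_relax k).
have gi := integrable_grad k.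
apply: bump_box_ae0; first exact: integrableRB.
move=> c d N lc dh.
have := W_pde (test_function_scalel (delta_cV_neq0 R k) (test_function_bump_box c d N)).
have dotE u z : dot u (bump_box c d N z *: delta_mx k 0) = u k 0 * bump_box c d N z.
  by rewrite dotZr dot_delta mulrC.
under eq_Rintegral do rewrite dotE.
under [RHS]eq_Rintegral do rewrite dotE.
have b0 z : ~ Q z -> bump_box c d N z = 0.
  by move=> nQ; apply/eqP; apply: contrapT => /negP /(bump_box_neq0 lc dh).
rewrite (Rintegral_sub_support _ Qslab); last by move=> z _ /b0 ->; rewrite mulr0.
rewrite [RHS](Rintegral_sub_support _ Qslab); last by move=> z _ /b0 ->; rewrite mulr0.
have mb : measurable_fun Q (bump_box c d N).
  by apply: measurable_funTS; exact: measurable_bump_box.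
have bi f : (leb R n.+1).-integrable Q (EFin \o f) ->
    (leb R n.+1).-integrable Q (EFin \o (fun z => f z * bump_box c d N z)).
  by move=> fi; apply: (integrable_mulr_bounded (M := 1)) => // z _; exact: norm_bump_box.
move=> H; under eq_Rintegral do rewrite mulrBl.
by rewrite RintegralB//; [rewrite H subrr|exact: bi|exact: bi].
Qed.

Definition entropy_prod (z : E) : R :=
  enorm (W z - kappa) ^+ 2 * Dphi ord0 z +
  \sum_(j < n) dot (W z - kappa) (B j *m (W z - kappa)) * Dphi (lift ord0 j) z.

(** In the derivative of U_k U_l, with U = [W z - kappa], the two terms become equal after
    contraction: trivially for the identity, by symmetry for [B j]. This is the factor 2. *)
Lemma entropy_prod_dquad z :
  entropy_prod z + 2 * phi z * dot (W z - kappa) (grad z) =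
  \sum_k dquad phi Dphi W DW kappa ord0 k k z +
  \sum_(j < n) \sum_k \sum_l B j k l * dquad phi Dphi W DW kappa (lift ord0 j) k l z.
Proof.
have dE i k l : dquad phi Dphi W DW kappa i k l z =
    (DW i z k 0 * (W z - kappa) l 0 + DW i z l 0 * (W z - kappa) k 0) * phi z +
    Dphi i z * ((W z - kappa) k 0 * (W z - kappa) l 0) by rewrite !mxE.
under [X in _ = X + _]eq_bigr do rewrite dE.
under [X in _ = _ + X]eq_bigr do under eq_bigr do under eq_bigr do rewrite dE.
rewrite /entropy_prod enorm_sq; move: (W z - kappa) => u.
rewrite dotDr dotr_sum mulrDr addrACA; congr (_ + _).
  rewrite /dot mulr_suml mulr_sumr -big_split; apply: eq_bigr => k _ /=.
  by ring.
rewrite mulr_sumr -big_split; apply: eq_bigr => j _ /=.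
rewrite (_ : 2 * phi z * _ = phi z * (dot (DW (lift ord0 j) z) (B j *m u) +
    dot u (B j *m DW (lift ord0 j) z))); last first.
  by rewrite (dot_mulmx_sym _ _ (B_sym j)); ring.
rewrite !dot_mulmx mulr_suml -big_split mulr_sumr -big_split.
apply: eq_bigr => k _ /=.
rewrite mulr_suml -big_split mulr_sumr -big_split.
by apply: eq_bigr => l _ /=; ring.
Qed.

Lemma integrable_entropy_prod : (leb R n.+1).-integrable Q (EFin \o entropy_prod).
Proof.
have UUi k l : (leb R n.+1).-integrable Q
    (EFin \o (fun z => (W z - kappa) k 0 * (W z - kappa) l 0)).
  have := sq_integrable_mul mQ (Ui k) (Ui l); congr (_.-integrable _ _).
  by apply/funext => z /=; rewrite !mxE.
apply: integrableRD => //.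
  apply: integrable_mul_Loo; first exact: (phi_W.2 _).1.
  under eq_fun do rewrite enorm_sq.
  by apply: integrableR_sum => // k; exact: UUi.
apply: integrableR_sum => // j.
apply: integrable_mul_Loo; first exact: (phi_W.2 _).1.
under eq_fun do rewrite dot_mulmx.
apply: integrableR_sum => // k; apply: integrableR_sum => // l.
by apply: integrableRZ => //; exact: UUi.
Qed.

Definition relax_prod (z : E) : R :=
  2 * phi z * dot (W z - kappa) (eps^-1 *: (P (W z) - W z)).

Lemma relax_prod_le0 z : below T z -> relax_prod z <= 0.
Proof.
move=> zT; rewrite /relax_prod dotZr mulr_ge0_le0//.
  by rewrite mulr_ge0// phi_ge0.
by rewrite mulr_ge0_le0 ?invr_ge0 ?(ltW eps0)//; exact: proj_dissipative.
Qed.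

Lemma integrable_relax_prod : (leb R n.+1).-integrable Q (EFin \o relax_prod).
Proof.
rewrite (_ : relax_prod = fun z => (2 * eps^-1 * \sum_k
    (W z k 0 - kappa k 0) * (P (W z) - W z) k 0) * phi z); last first.
  apply/funext => z; rewrite /relax_prod dotZr.
  rewrite (_ : dot _ _ = \sum_k (W z k 0 - kappa k 0) * (P (W z) - W z) k 0); first by ring.
  by apply: eq_bigr => k _; congr (_ * _); rewrite !mxE.
apply: integrable_mul_Loo; first exact: phi_W.1.
apply: integrableRZ => //; apply: integrableR_sum => // k.
exact: sq_integrable_mul (Ui k) (sq_integrable_relax k).
Qed.

Lemma measurable_entropy_prod : measurable_fun (slab T) entropy_prod.
Proof.
have mU k : measurable_fun (slab T) (fun z => (W z - kappa) k 0).
  under eq_fun do rewrite !mxE.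
  by apply: measurable_funB => //; exact: measurable_cst.
have mD i : measurable_fun (slab T) (Dphi i).
  apply: measurable_funS (phi_W.2 i).1.1; first exact: measurable_below.
  by move=> z /andP[].
apply: measurable_funD.
  apply: measurable_funM => //; under eq_fun do rewrite enorm_sq.
  by apply: measurable_sum => k; exact: measurable_funM.
apply: measurable_sum => j; apply: measurable_funM => //.
under eq_fun do rewrite dot_mulmx.
apply: measurable_sum => k; apply: measurable_sum => l.
apply: measurable_funM; first exact: measurable_cst.
exact: measurable_funM.
Qed.

(** The weak gradient vanishes outside [Q] only almost everywhere, so the integrand is first
    replaced by its restriction to [Q]. *)
Lemma Rintegral_entropy_prod :
  \int[leb R n.+1]_(z in slab T) entropy_prod z =
  \int[leb R n.+1]_(z in Q) entropy_prod z.
Proof.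
have mS := @measurable_slab R n T.
rewrite (@Rintegral_ae_eq _ _ _ _ _ _ (entropy_prod \_ Q)) //.
- rewrite (Rintegral_sub_support _ Qslab); last by move=> z _ nQ; rewrite patchE memNset.
  by apply: eq_Rintegral => z zQ; rewrite patchE zQ.
- exact: measurable_entropy_prod.
- apply: measurable_funTS; apply: (measurable_restrictT entropy_prod mQ).1.
  exact: measurable_funS mS Qslab measurable_entropy_prod.
have D0 i := Dphi_outside phi_W phi_supp i.
apply: aeS (ae_all D0) => z Hz zs; rewrite patchE; case: ifPn => // /negP zQ.
have nQ : ~ Q z by move=> h; apply: zQ; rewrite inE.
rewrite /entropy_prod Hz// mulr0 add0r big1// => j _; by rewrite Hz// mulr0.
Qed.

Let phi0i k : (leb R n).-integrable Q'
  (EFin \o (fun y => (W0 y k 0 - kappa k 0) ^+ 2 * phi (cons_rV 0 y))).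
Proof.
have [M phiM] := phi_bounded.
have b0 y : below T (cons_rV 0 y : E) by rewrite /below/= cons_rV0.
have mQ'' : measurable Q' by exact: measurable_box.
apply: (integrable_mulr_bounded (M := M)) => //.
- have h : sq_integrable (leb R n) Q' (fun y => W0 y k 0).
    exact: sq_integrableS mQ'' measurableT _ (W0_L2 k).
  have c := @sq_integrable_cst _ _ _ (leb R n) Q' (kappa k 0) mQ'' (leb_box_lty _ _).
  by have [] := sq_integrableB mQ'' h c.
- by apply: measurable_funTS; exact: (measurable_trace T0 phi_W).
- by move=> y _; exact: phiM.
Qed.

Lemma Rintegral_trace :
  \int[leb R n]_x (enorm (W0 x - kappa) ^+ 2 * phi (cons_rV 0 x)) =
  - \sum_k \int[leb R n.+1]_(z in Q) dquad phi Dphi W DW kappa ord0 k k z.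
Proof.
have b0 y : below T (cons_rV 0 y : E) by rewrite /below/= cons_rV0.
have mQ'' : measurable Q' by exact: measurable_box.
rewrite (@Rintegral_sub_support _ _ _ _ Q')//; last first.
  move=> y _ nQ; rewrite (_ : phi _ = 0) ?mulr0//.
  apply/eqP; apply: contrapT => /negP/(phi_supp (b0 y))[H _]; apply: nQ => j.
  have := H (lift ord0 j); rewrite cons_rVS ler_norml => /andP[h1 h2].
  by apply/andP; split; lra.
have mW0 k : measurable_fun setT (fun x => W0 x k 0) := (W0_L2 k).1.
under [in RHS]eq_bigr => k _ do
  rewrite (Rintegral_dquad_time T0 L2_lt r0 phi_W phi_cont phi_supp W_H1 _ mW0 W_init).
rewrite -Rintegral_sum//; last first.
  move=> k; have := integrableRZ (-1) mQ'' (phi0i k); congr (_.-integrable _ _).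
  by apply/funext => y /=; rewrite mulN1r.
rewrite -[RHS]mulN1r -RintegralZl//; last first.
  apply: integrableR_sum => // k.
  have := integrableRZ (-1) mQ'' (phi0i k); congr (_.-integrable _ _).
  by apply/funext => y /=; rewrite mulN1r.
apply: eq_Rintegral => y _; rewrite enorm_sq /dot mulr_suml mulr_sumr.
by apply: eq_bigr => k _; rewrite !mxE; ring.
Qed.

Lemma entropy_inequality :
  0 <= \int[leb R n.+1]_(z in slab T) entropy_prod z +
    \int[leb R n]_x (enorm (W0 x - kappa) ^+ 2 * phi (cons_rV 0 x)).
Proof.
rewrite Rintegral_entropy_prod Rintegral_trace subr_ge0.
have di i k l := integrable_dquad L phi_W W_H1 kappa i k l.
(* The space entries integrate to 0, so adding them completes the time entries to the full
   contraction at no cost. *)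
have -> : \sum_k \int[leb R n.+1]_(z in Q) dquad phi Dphi W DW kappa ord0 k k z =
    \int[leb R n.+1]_(z in Q) (entropy_prod z + 2 * phi z * dot (W z - kappa) (grad z)).
  under [RHS]eq_Rintegral do rewrite entropy_prod_dquad.
  have Bi j k l : (leb R n.+1).-integrable Q
      (EFin \o (fun z => B j k l * dquad phi Dphi W DW kappa (lift ord0 j) k l z)).
    by apply: integrableRZ.
  rewrite RintegralD//.
  - rewrite [X in _ = _ + X]Rintegral_sum//; last first.
      by move=> j; apply: integrableR_sum => // k; exact: integrableR_sum.
    rewrite [X in _ = _ + X]big1 ?addr0 ?Rintegral_sum// => j _.
    rewrite Rintegral_sum//; last by move=> k; exact: integrableR_sum.
    rewrite big1// => k _; rewrite Rintegral_sum// big1// => l _.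
    by rewrite RintegralZl// (Rintegral_dquad_space T0 L2_lt r0 phi_W phi_cont phi_supp W_H1) mulr0.
  - exact: integrableR_sum.
  - apply: integrableR_sum => // j; apply: integrableR_sum => // k.
    exact: integrableR_sum.
have ei := integrable_entropy_prod; have ri := integrable_relax_prod.
have sumi := integrableRD mQ ei ri.
rewrite (@Rintegral_ae_eq _ _ _ _ _ _ (fun z => entropy_prod z + relax_prod z)) //.
- apply: le_Rintegral => // z Qz; rewrite gerDl; apply: relax_prod_le0.
  by have /andP[] := Qslab Qz.
- have : (leb R n.+1).-integrable Q (EFin \o (fun z =>
      \sum_k dquad phi Dphi W DW kappa ord0 k k z +
      \sum_(j < n) \sum_k \sum_l B j k l * dquad phi Dphi W DW kappa (lift ord0 j) k l z)).
    apply: integrableRD => //; first exact: integrableR_sum.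
    apply: integrableR_sum => // j; apply: integrableR_sum => // k.
    by apply: integrableR_sum => // l; exact: integrableRZ.
  move=> /(integrable_measurable mQ); congr (measurable_fun _ _).
  by apply/funext => z; rewrite entropy_prod_dquad.
- exact: integrable_measurable sumi.
- by apply: aeS pde_ae => z Hz Qz; rewrite /relax_prod Hz.
Qed.

End entropy_inequality.

Theorem lemma4p1 (R : realType) (n m : nat) (T eps : R)
    (K : set 'cV[R]_m) (B : 'I_n -> 'M[R]_m)
    (W0 : 'rV[R]_n -> 'cV[R]_m) (W : 'rV[R]_n.+1 -> 'cV[R]_m)
    (n_gt0 : (0 < n)%N) (m_gt0 : (0 < m)%N) (T_gt0 : 0 < T) (eps_gt0 : 0 < eps)
    (K_closed : closed K) (K_convex : convex_set K) (K_int0 : K° 0)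
    (B_sym : forall j, (B j)^T = B j)
    (W0_H1 : exists DW0, H1v setT W0 DW0)
    (W0_K : {ae leb R n, forall x, K (W0 x)})
    (W_sol : relaxation_solution T eps K B W0 W)
    (kappa : 'cV[R]_m) (kappa_K : K kappa)
    (phi : 'rV[R]_n.+1 -> R) (Dphi : 'I_n.+1 -> 'rV[R]_n.+1 -> R)
    (phi_test : entropy_test T phi Dphi) :
  0 <= \int[leb R n.+1]_(z in slab T)
         (enorm (W z - kappa) ^+ 2 * Dphi ord0 z +
          \sum_(j < n) dot (W z - kappa) (B j *m (W z - kappa)) *
                       Dphi (lift ord0 j) z) +
       \int[leb R n]_x (enorm (W0 x - kappa) ^+ 2 * phi (cons_rV 0 x)).
Proof.
have [DW [W_H1 W_pde W_init]] := W_sol.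
have [phi_W phi_cont phi_ge0 [C [cC CT phiC]]] := phi_test.
have [M [r [M0 r0 HC]]] := compact_below_margin cC CT.
have [DW0 W0H] := W0_H1.
have phiC' z : below T z -> phi z != 0 -> C z.
  by move=> zT pz; apply: contrapT => /(phiC z zT) pz0; rewrite pz0 eqxx in pz.
(* [M] bounds the coordinates on the support of [phi]; the added 2 is the side of the boxes in
   [Dphi_outside]. *)
apply: (@entropy_inequality R n m T (M + 2) r eps K B _ _ _ _ _ _ _ _ phi Dphi _ _ _ _ _ W DW).
- exact: T_gt0.
- by rewrite ltrDr.
- exact: r0.
- exact: eps_gt0.
- exact: K_closed.
- exact: K_convex.
- exact: interior_subset K_int0.
- exact: B_sym.
- exact: phi_W.
- exact: phi_cont.
- exact: phi_ge0.
- by move=> z zT /(phiC' z zT)/HC; rewrite addrK.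
- have /ex_strict_bound_gt0[S S0 HS] :=
    compact_bounded (continuous_compact (continuous_subspaceW CT phi_cont) cC).
  exists S => z zT; have [->|/(phiC' z zT) Cz] := eqVneq (phi z) 0.
    by rewrite normr0 ltW.
  by apply/ltW/HS; exists z.
- exact: W_H1.
- exact: W_pde.
- by move=> k; have [] := W0H k.
- exact: W_init.
- exact: kappa_K.
Qed.
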